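(* $Z$ is a sample continuous $H$-process which is centered, Gaussian, Markov and stationary, having invariant measure $\mathcal{N}\big(0,-\tfrac12\Gamma^{-1}C\big)$ and with transition probability $$p(t;f,\cdot)=\mathcal{N}\Big(e^{-|\gamma|t}f,\ (1-e^{-2|\gamma|t})\big(-\tfrac12\Gamma^{-1}C\big)\Big)(\cdot),\qquad f\in D_K,$$ where $\Gamma=-|\gamma|\mathbf{I}$ and $C=2(-A)^{-1}$.
   Context: Setting: $X=\{X(t):t\ge0\}$ is a progressively measurable continuous-parameter Markov process on a measurable state space $(S,\mathcal{S})$, defined on a complete probability space, starting from an ergodic invariant probability $\pi$. $L^2(S,\pi)$ has inner product $\langle\cdot,\cdot\rangle_\pi$, and $1_\pi^\perp=\{f\in L^2(S,\pi):\langle f,1\rangle_\pi=0\}$. Assumption on the generator: $A$ is a densely defined self-adjoint infinitesimal generator on $L^2(S,\pi)$ of the strongly continuous semigroup of $X$, with ergodic invariant probability $\pi$, such that $A^{-1}$ (the inverse of the bijection $A:\mathcal{D}(A)\cap\mathcal{N}(A)^\perp\to\mathcal{R}(A)$, where $\mathcal{N}(A)$ and $\mathcal{R}(A)$ are the null space and range of $A$) is a bounded linear operator on $\mathcal{R}(A)=1_\pi^\perp$. Brownian field: $B=\{B(f,t):f\in 1_\pi^\perp,t\in\mathbb{R}\}$ is the centered Gaussian field, linear in $f$, with $\mathrm{cov}(B(f_1,t_1),B(f_2,t_2))=(|t_1|\wedge|t_2|)(-2\langle f_1,A^{-1}f_2\rangle_\pi)$ if $t_1t_2>0$ and $0$ if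 $t_1t_2\le 0$. (It arises as the weak limit of the additive functionals $n^{-1/2}\int_0^{nt}f(X_s)\,ds$, extended to two-sided time.) Stationary field: for a fixed $\gamma<0$, $Z(f,t)=e^{-|\gamma|t}\frac{1}{\sqrt{2|\gamma|}}B(f,e^{2|\gamma|t})$ for $f\in 1_\pi^\perp$, $t\in\mathbb{R}$. Rigged Hilbert space: with $\Gamma=-|\gamma|\mathbf{I}$, let $D=\mathcal{D}(\Gamma)=1_\pi^\perp$, and let $r(f,g)=\frac{(1+|\gamma|)^2}{|\gamma|}\langle f,(-A)^{-1}g\rangle_\pi$ for $f,g\in 1_\pi^\perp$, where $(D,r)$ is taken to be a separable Hilbert space. Let $\{d_n\}$ be an orthonormal basis of $(D,r)$ with $d_n\in\mathcal{D}(\Gamma^2)=1_\pi^\perp$ for each $n$, let $\{\lambda_n\}$ be a sequence of positive numbers with $\sum_n\lambda_n^2<\infty$, and let $Kf=\sum_n\lambda_n r(d_n,f)\,d_n$, $f\in D$, a strictly positive definite Hilbert–Schmidt operator on $(D,r)$. Let $D_K=KD$ with inner product $r_K(f,g)=r(K^{-1}f,K^{-1}g)$, a separable Hilbert space. $(H,\|\cdot\|)$ is the dual space of bounded linear functionals on $(D_K,r_K)$; the triple $(D_K,r_K),(D,r),(H,\|\cdot\|)$ is a Gelfand triple (rigged Hilbert space). $\langle y|f\rangle$ denotes the value of $y\in H$ at $f\in D_K$. Terminology: an $H$-process is a family $\{Y(t):t\in\mathbb{R}\}$ of $H$-valued random variables; it is sample continuous if for each $\omega$ the map $t\mapsto Y(t,\omega)$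 is continuous for the norm of $H$; it is centered Gaussian if $\{\langle Y(t)|f\rangle:f\in D_K,t\in\mathbb{R}\}$ is a centered Gaussian collection of random variables. As an $H$-process, $Z$ is understood through its continuous regular version, i.e. the sample continuous $H$-process whose value at time $t$ paired with $f\in D_K$ equals $Z(f,t)$ a.s. $\mathcal{N}(m,\Sigma)$ denotes the Gaussian measure on the Hilbert space $H$ with mean vector $m$ and covariance operator $\Sigma$, the covariance functional being $\langle f,\Sigma g\rangle_\pi$ for $f,g\in D_K$; for the invariant measure this is $\frac{1}{|\gamma|}\langle f,(-A)^{-1}g\rangle_\pi$. *)

(* Defs.v *)
From HB Require Import structures.
From mathcomp Require Import all_boot all_order all_algebra.
From mathcomp Require Import all_classical all_reals all_analysis.
From mathcomp Require Import measurable_realfun.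

Set Implicit Arguments.
Unset Strict Implicit.
Unset Printing Implicit Defensive.

Import Order.TTheory GRing.Theory Num.Theory.
Import numFieldNormedType.Exports.

Local Open Scope classical_set_scope.
Local Open Scope ring_scope.

Section L2_space.
Context d (T : measurableType d) (R : realType).
Variable mu : {measure set T -> \bar R}.

Local Notation Lfun2 := (LfunType mu (lee1n 2)).
Local Notation L2 := (LspaceType2 mu).

Lemma Lfun2_finite_norm (g : Lfun2) (f : {mfun T >-> measurableTypeR R}) :
  (g : T -> R) = (f : T -> R) %[ae mu] -> finite_norm mu 2%:R%:E f.
Proof.
move=> gf; have : finite_norm mu 2%:R%:E g by exact: Lfunction_finite.
pose sq (h : T -> R) : T -> \bar R := fun x => (`|(EFin \o h) x| `^ 2)%E.
have msq (h : T -> R) : measurable_fun setT h -> measurable_fun setT (sq h).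
  move=> mh.
  apply: (@measurableT_comp _ _ _ _ _ _ (fun x : \bar R => (x `^ 2)%E : \bar R)).
    exact: measurable_poweR.
  apply: measurableT_comp => //.
  exact/measurable_EFinP.
rewrite /finite_norm unlock => gfin.
rewrite (@ae_eq_integral _ _ _ mu setT (sq g) (sq f)) //.
- apply: msq; exact: measurable_funPT f.
- apply: msq; exact: measurable_funPT g.
by apply: filterS gf => x /= gfx Dx; rewrite /sq /= gfx.
Qed.

Lemma Lspace_rep_in (u : L2) : (u : T -> R) \in Lfun mu 2%:R%:E.
Proof.
apply/andP; split; rewrite inE /=.
  exact: (measurable_funPT (repr (LebesgueSpace.sort u))).
exact: Lebesgue_finite.
Qed.

(* The vector space structure of the library's L^2 space of classes modulo a.e.
   equality is transported from the space of square-integrable functions. *)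
Definition Lrep (u : L2) : Lfun2 := Lfun_Sub (lee1n 2) (Lspace_rep_in u).

Definition mfun_of (f : Lfun2) : {mfun T >-> measurableTypeR R} :=
  HB.pack (f : T -> measurableTypeR R)
    (isMeasurableFun.Build _ _ _ _ (f : T -> measurableTypeR R) (measurable_funPT f)).

Local Open Scope quotient_scope.

Definition ae_class (f : Lfun2) : {mfun_ mu, T >-> measurableTypeR R} :=
  \pi_({mfun_ mu, T >-> measurableTypeR R}) (mfun_of f).

Lemma ae_classE (f : Lfun2) : (f : T -> R) = (ae_class f : T -> R) %[ae mu].
Proof.
have /eqquotP/asboolP := reprK (ae_class f).
by apply: filterS => x e Dx; exact: esym (e Dx).
Qed.

Lemma ae_class_finite (f : Lfun2) : finite_norm mu 2%:R%:E (ae_class f).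
Proof. exact: Lfun2_finite_norm (ae_classE f). Qed.

Definition Lclass (f : Lfun2) : L2 :=
  HB.pack (ae_class f)
    (isFinLebesgue.Build _ _ _ mu 2%:R%:E (lee1n 2) (ae_class f) (ae_class_finite f)).

Lemma LrepE (u : L2) x : Lrep u x = u x.
Proof. by []. Qed.

Lemma Lclass_val (f : Lfun2) : LebesgueSpace.sort (Lclass f) = ae_class f.
Proof. by []. Qed.

Lemma L2_inj (u v : L2) : LebesgueSpace.sort u = LebesgueSpace.sort v -> u = v.
Proof.
case: u v => [u [[hu]]] [v [[hv]]] /= uv; subst v.
by rewrite (Prop_irrelevance hu hv).
Qed.

Lemma Lclass_eq (f g : Lfun2) :
  (f : T -> R) = (g : T -> R) %[ae mu] -> Lclass f = Lclass g.
Proof. by move=> fg; apply/L2_inj/eqquotP/asboolP. Qed.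

Lemma LclassE (f : Lfun2) : (Lclass f : T -> R) = (f : T -> R) %[ae mu].
Proof. exact/ae_eq_sym/ae_classE. Qed.

Lemma LrepK (u : L2) : Lclass (Lrep u) = u.
Proof.
apply: L2_inj; rewrite Lclass_val.
rewrite -[RHS]reprK; apply/eqquotP/asboolP.
by apply: filterS (ae_eq_refl mu setT (u : T -> R)) => x.
Qed.

Lemma L2_eq (u v : L2) : (u : T -> R) = (v : T -> R) %[ae mu] -> u = v.
Proof. by move=> uv; rewrite -(LrepK u) -(LrepK v); exact: Lclass_eq. Qed.

HB.instance Definition _ := gen_eqMixin L2.
HB.instance Definition _ := gen_choiceMixin L2.

Definition L2add (u v : L2) : L2 := Lclass (Lrep u + Lrep v).
Definition L2opp (u : L2) : L2 := Lclass (- Lrep u).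
Definition L2scale (a : R) (u : L2) : L2 := Lclass (a *: Lrep u).

Lemma L2add_class f g : L2add (Lclass f) (Lclass g) = Lclass (f + g).
Proof.
apply: Lclass_eq; have := LclassE g; have := LclassE f.
by apply: filterS2 => x ef eg Dx; congr (_ + _); [exact: ef|exact: eg].
Qed.

Lemma L2opp_class f : L2opp (Lclass f) = Lclass (- f).
Proof.
apply: Lclass_eq; have := LclassE f.
by apply: filterS => x ef Dx; congr (- _); exact: ef.
Qed.

Lemma L2scale_class a f : L2scale a (Lclass f) = Lclass (a *: f).
Proof.
apply: Lclass_eq; have := LclassE f.
by apply: filterS => x ef Dx; congr (a * _); exact: ef.
Qed.

Fact L2addA : associative L2add.
Proof.
move=> u v w; rewrite -(LrepK u) -(LrepK v) -(LrepK w).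
by rewrite !L2add_class addrA.
Qed.

Fact L2addC : commutative L2add.
Proof.
by move=> u v; rewrite -(LrepK u) -(LrepK v) !L2add_class addrC.
Qed.

Fact L2add0 : left_id (Lclass 0) L2add.
Proof. by move=> u; rewrite -(LrepK u) L2add_class add0r. Qed.

Fact L2addN : left_inverse (Lclass 0) L2opp L2add.
Proof.
by move=> u; rewrite -(LrepK u) L2opp_class L2add_class addNr.
Qed.

HB.instance Definition _ :=
  GRing.isZmodule.Build L2 L2addA L2addC L2add0 L2addN.

Lemma Lclass_add f g : Lclass (f + g) = Lclass f + Lclass g.
Proof. exact/esym/L2add_class. Qed.

Fact L2scaleA a b (u : L2) : L2scale a (L2scale b u) = L2scale (a * b) u.
Proof. by rewrite -(LrepK u) !L2scale_class scalerA. Qed.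

Fact L2scale1 : left_id 1 L2scale.
Proof. by move=> u; rewrite -(LrepK u) L2scale_class scale1r. Qed.

Fact L2scaleDr : right_distributive L2scale +%R.
Proof.
move=> a u v; rewrite -(LrepK u) -(LrepK v) -Lclass_add !L2scale_class.
by rewrite scalerDr Lclass_add.
Qed.

Fact L2scaleDl (u : L2) : {morph L2scale^~ u : a b / a + b}.
Proof.
by move=> a b; rewrite -(LrepK u) !L2scale_class scalerDl Lclass_add.
Qed.

HB.instance Definition _ := GRing.Zmodule_isLmodule.Build R L2
  L2scaleA L2scale1 L2scaleDr L2scaleDl.

Definition ip (u v : L2) : R := \int[mu]_x (u x * v x).

End L2_space.

Section dual_space.
Context (R : realType) (V : lmodType R) (E : set V) (q : V -> V -> R).

Definition qnorm (f : V) : R := Num.sqrt (q f f).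

(* The operator norm (dual_norm below) is the infimum of this set; no property of
   E and q is needed for it to be a norm. *)
Definition dual_bounds (y : V -> R^o) : set R :=
  [set M | 0 <= M /\ forall f, E f -> `|y f| <= M * qnorm f].

(* A bounded linear functional on (E, q) is encoded as a function on the whole
   of V vanishing outside E, so that equality of functionals on E is Leibniz
   equality. *)
Definition bounded_functional : {pred V -> R^o} := mem [set y : V -> R^o |
  [/\ forall a f g, E f -> E g -> y (a *: f + g) = a *: y f + y g,
      dual_bounds y !=set0 &
      forall f, ~ E f -> y f = 0] ].

Fact bounded_functional_submod : submod_closed bounded_functional.
Proof.
split=> [|a y z].
  rewrite inE; split=> // [b f g _ _|].
    by rewrite scaler0 addr0.
  by exists 0; split=> // f _; rewrite normr0 mul0r.
rewrite !inE => -[yl [M [M0 yM]] y0] [zl [N [N0 zN]] z0]; split.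
- move=> b f g Ef Eg.
  change (a *: y (b *: f + g) + z (b *: f + g) =
    b *: (a *: y f + z f) + (a *: y g + z g)).
  rewrite yl// zl// !scalerDr !scalerA (mulrC a b) -!addrA; congr (_ + _).
  by rewrite addrCA.
- exists (`|a| * M + N); split; first by rewrite addr_ge0// mulr_ge0.
  move=> f Ef; change (`|a * y f + z f| <= (`|a| * M + N) * qnorm f).
  rewrite (le_trans (ler_normD _ _))// mulrDl lerD// ?zN//.
  by rewrite normrM -mulrA ler_wpM2l// yM.
- move=> f Ef; change (a *: y f + z f = 0).
  by rewrite y0// z0// scaler0 addr0.
Qed.

HB.instance Definition _ := GRing.isSubmodClosed.Build R (V -> R^o)
  bounded_functional bounded_functional_submod.

Record dual := Dual {
  dual_fun : V -> R^o;
  dual_funP : dual_fun \in bounded_functional }.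

HB.instance Definition _ := [isSub for dual_fun].
HB.instance Definition _ := [Choice of dual by <:].
HB.instance Definition _ := [SubChoice_isSubLmodule of dual by <:].

Definition pairing (y : dual) (f : V) : R := dual_fun y f.

Definition dual_norm (y : dual) : R := inf (dual_bounds (dual_fun y)).

Lemma dual_bounds_neq0 (y : dual) : dual_bounds (dual_fun y) !=set0.
Proof. by have := dual_funP y; rewrite inE => -[]. Qed.

Lemma dual_bounds_lb (y : dual) : has_lbound (dual_bounds (dual_fun y)).
Proof. by exists 0 => M []. Qed.

Lemma dual_bounds_inf (y : dual) : has_inf (dual_bounds (dual_fun y)).
Proof. by split; [exact: dual_bounds_neq0|exact: dual_bounds_lb]. Qed.

Lemma dual_norm_le (y : dual) M : dual_bounds (dual_fun y) M -> dual_norm y <= M.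
Proof. by move=> yM; apply: ge_inf => //; exact: dual_bounds_lb. Qed.

Lemma dual_norm_bound (y : dual) : dual_bounds (dual_fun y) (dual_norm y).
Proof.
split.
  by apply: lb_le_inf => [|M []//]; exact: dual_bounds_neq0.
move=> f Ef; have [q0|qf] := eqVneq (qnorm f) 0.
  by have [M [M0 /(_ _ Ef)]] := dual_bounds_neq0 y; rewrite q0 !mulr0.
have qf0 : 0 < qnorm f by rewrite lt_neqAle eq_sym qf sqrtr_ge0.
rewrite -ler_pdivrMr//; apply: lb_le_inf; first exact: dual_bounds_neq0.
by move=> M [M0 yM]; rewrite ler_pdivrMr// yM.
Qed.

Fact dual_normD y z : dual_norm (y + z) <= dual_norm y + dual_norm z.
Proof.
have [y0 yM] := dual_norm_bound y; have [z0 zM] := dual_norm_bound z.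
apply: dual_norm_le; split; first exact: addr_ge0.
move=> f Ef; change (`|dual_fun y f + dual_fun z f| <=
  (dual_norm y + dual_norm z) * qnorm f).
by rewrite (le_trans (ler_normD _ _))// mulrDl lerD// ?yM ?zM.
Qed.

Let dual_normZ_le (a : R) y : dual_norm (a *: y) <= `|a| * dual_norm y.
Proof.
have [y0 yM] := dual_norm_bound y.
apply: dual_norm_le; split; first exact: mulr_ge0.
move=> f Ef; change (`|a * dual_fun y f| <= `|a| * dual_norm y * qnorm f).
by rewrite normrM -mulrA ler_wpM2l// yM.
Qed.

Fact dual_norm0 y : dual_norm y = 0 -> y = 0.
Proof.
have [y0 yM] := dual_norm_bound y => y00.
apply/val_inj/funext => f; change (dual_fun y f = 0).
have [Ef|nEf] := pselect (E f).
  by apply/eqP; rewrite -normr_le0; have := yM _ Ef; rewrite y00 mul0r.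
by have := dual_funP y; rewrite inE => -[_ _]; exact.
Qed.

Fact dual_normZ (a : R) y : dual_norm (a *: y) = `|a| * dual_norm y.
Proof.
have [->|a0] := eqVneq a 0.
  rewrite scale0r normr0 mul0r; apply/eqP; rewrite eq_le.
  have [-> _] := dual_norm_bound 0; rewrite andbT.
  by have := dual_normZ_le 0 0; rewrite scale0r normr0 mul0r.
apply/eqP; rewrite eq_le dual_normZ_le/=.
rewrite -ler_pdivlMl ?normr_gt0// -normfV.
by have := dual_normZ_le a^-1 (a *: y); rewrite scalerA mulVf// scale1r.
Qed.

HB.instance Definition _ :=
  Lmodule_isNormed.Build R dual dual_normD dual_normZ dual_norm0.

End dual_space.

Definition borel (H : ptopologicalType) := g_sigma_algebraType (@open H).
HB.instance Definition _ (H : ptopologicalType) := Measurable.on (borel H).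


Arguments ip {d T R} mu u v.

Section hilbert.
Context (R : realType) (V : lmodType R).
Implicit Types (E : set V) (q : V -> V -> R).

Definition inner_product_on E q :=
  [/\ E 0 /\ (forall (a : R) f g, E f -> E g -> E (a *: f + g)),
      forall f g, E f -> E g -> q f g = q g f,
      forall (a : R) f g h, E f -> E g -> E h ->
        q (a *: f + g) h = a * q f h + q g h,
      forall f, E f -> 0 <= q f f &
      forall f, E f -> q f f = 0 -> f = 0].

Definition q_cvg q (u : nat -> V) (l : V) :=
  qnorm q (u n - l) @[n --> \oo] --> (0 : R).

Definition complete_on E q :=
  forall u : nat -> V, (forall n, E (u n)) ->
    (forall e : R, 0 < e -> exists N : nat, forall m n, (N <= m)%N -> (N <= n)%N ->
      qnorm q (u m - u n) < e) ->
    exists2 l, E l & q_cvg q u l.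

Definition dense_in E q (D : set V) :=
  forall f (e : R), E f -> 0 < e -> exists2 g, D g & qnorm q (f - g) < e.

Definition separable_hilbert E q :=
  [/\ inner_product_on E q, complete_on E q &
      exists u : nat -> V, (forall n, E (u n)) /\ dense_in E q (range u)].

(* The basis is indexed by an arbitrary set I of naturals and padded with zeros
   outside I, so that finite-dimensional spaces are covered; an infinite
   sequence is the case I = setT. *)
Definition orthonormal_basis E q (I : set nat) (e : nat -> V) :=
  [/\ forall n, E (e n),
      forall m n, q (e m) (e n) = ((m == n) && (n \in I))%:R,
      forall n, ~ I n -> e n = 0 &
      forall f, E f -> q_cvg q (fun N => \sum_(n < N) q (e n) f *: e n) f].

(* Partially defined operators are pairs of a domain and a function on V whose
   values off the domain are irrelevant. *)
Definition null_space (D : set V) (A : V -> V) : set V :=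
  [set f | D f /\ A f = 0].

(* The inverse of the bijection A : D `&` N(A)^perp -> R(A). *)
Definition op_inv q (D : set V) (A : V -> V) (g : V) : V :=
  xget 0 [set f | [/\ D f, forall h, null_space D A h -> q f h = 0 & A f = g]].

(* (D, A) and its adjoint have the same graph. *)
Definition self_adjoint q (D : set V) (A : V -> V) :=
  forall f h, (D f /\ A f = h) <-> (forall g, D g -> q (A g) f = q g h).

Definition bounded_on q (E : set V) (L : V -> V) :=
  exists M : R, forall f, E f -> qnorm q (L f) <= M * qnorm q f.

End hilbert.

Section one_perp.
Context d (T : measurableType d) (R : realType) (mu : probability T R).

Definition L2one : LspaceType2 mu := Lclass (Lfun_Sub (lee1n 2) (Lfun_cst mu 1 2%:R)).

Definition one_perp : set (LspaceType2 mu) := [set f | ip mu f L2one = 0].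

End one_perp.

Arguments one_perp {d T R} mu _.

Section markov.
Context (R : realType) d (S : measurableType d).
Implicit Types (p : R -> R.-pker S ~> S).

Definition transition_function p :=
  (forall x, p 0 x = \d_x :> (set S -> \bar R)) /\
  (forall s t x U, 0 <= s -> 0 <= t -> measurable U ->
    p (s + t) x U = (\int[p s x]_y p t y U)%E).

Definition invariant_measure p (mu : probability S R) :=
  forall t U, 0 <= t -> measurable U -> (\int[mu]_x p t x U)%E = mu U.

Definition ergodic_measure p (mu : probability S R) :=
  forall U, measurable U ->
    (forall t, 0 <= t -> \forall x \ae mu, p t x U = \d_x U) ->
    mu U = 0%E \/ mu U = 1%E.

Definition semigroup p (t : R) (f : S -> R) (x : S) : R := \int[p t x]_y f y.

Definition strongly_continuous p (mu : probability S R) :=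
  forall f : LspaceType2 mu,
    ('N[mu]_2%:R%:E[(fun x => (semigroup p t f x - f x)%:E)])%E
      @[t --> 0^'+] --> (0%E : \bar R).

Definition generator p (mu : probability S R)
    (DA : set (LspaceType2 mu)) (A : LspaceType2 mu -> LspaceType2 mu) :=
  forall f g : LspaceType2 mu, (DA f /\ A f = g) <->
    ('N[mu]_2%:R%:E[(fun x => (t^-1 * (semigroup p t f x - f x) - g x)%:E)])%E
      @[t --> 0^'+] --> (0%E : \bar R).

Context d' (Om : measurableType d').

Definition filtration (F : R -> set (set Om)) :=
  (forall t, sigma_algebra setT (F t) /\ F t `<=` measurable) /\
  (forall s t, s <= t -> F s `<=` F t).

Definition progressively_measurable (F : R -> set (set Om)) (X : R -> Om -> S) :=
  forall t, 0 <= t ->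
    measurable_fun ((`[0, t] : set R) `*` setT)
      ((fun sw => X sw.1 sw.2) :
        (measurableTypeR R * g_sigma_algebraType (F t))%type -> S).

(* P(X (s + t) \in U | F s) = p t (X s) U almost surely, through the defining
   property of conditional expectation; I is the time set. *)
Definition markov_process (P : probability Om R) (I : set R)
    (F : R -> set (set Om)) (X : R -> Om -> S) p :=
  forall s t G U, I s -> 0 <= t -> F s G -> measurable U ->
    P (G `&` X (s + t) @^-1` U) = (\int[P]_(w in G) p t (X s w) U)%E.

Definition natural_filtration (X : R -> Om -> S) (s : R) : set (set Om) :=
  <<s \bigcup_(u in [set u | u <= s]) preimage_set_system setT (X u) measurable >>.

(* Equality of the finite-dimensional laws, tested on measurable rectangles. *)
Definition stationary (P : probability Om R) (X : R -> Om -> S) :=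
  forall (n : nat) (t : 'I_n -> R) (h : R) (U : 'I_n -> set S),
    (forall i, measurable (U i)) ->
    P (\bigcap_i (X (t i + h) @^-1` U i)) = P (\bigcap_i (X (t i) @^-1` U i)).

End markov.

Section gaussian.
Context (R : realType).

(* normal_prob m 0 is not the Dirac mass at m. *)
Definition normal_law (m v : R) (U : set R) : \bar R :=
  if v == 0 then \d_m U else normal_prob m (Num.sqrt v) U.

Definition centered_gaussian d (Om : measurableType d) (P : probability Om R)
    (J : Type) (W : J -> Om -> R) (I : set J) :=
  (forall j, I j -> measurable_fun setT (W j)) /\
  (forall n (c : 'I_n -> R) (j : 'I_n -> J), (forall i, I (j i)) ->
    exists2 v : R, 0 <= v & forall U, measurable U ->
      P ((fun w => \sum_(i < n) c i * W (j i) w) @^-1` U) = normal_law 0 v U).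

(* N(m, Sigma) on the dual H of (E, q), whose dual is in turn (E, q) by
   reflexivity; k is the inner product for which the covariance functional is
   (f, g) |-> k f (Sigma g). *)
Definition gaussian_measure (V : lmodType R) (E : set V) (q k : V -> V -> R)
    (nu : {measure set (borel (dual E q)) -> \bar R})
    (m : dual E q) (Sigma : V -> V) :=
  (forall f U, E f -> measurable U ->
    nu ((fun y => pairing y f) @^-1` U) = normal_law (pairing m f) (k f (Sigma f)) U) /\
  (forall f g, E f -> E g ->
    (\int[nu]_y ((pairing y f - pairing m f) * (pairing y g - pairing m g))%:E
      = (k f (Sigma g))%:E)%E).

End gaussian.

Section fields.
Context d (S : measurableType d) (R : realType) (mu : probability S R).
Local Notation L2 := (LspaceType2 mu).
Context d' (Om : measurableType d') (P : probability Om R).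

Definition brownian_field (DA : set L2) (A : L2 -> L2) (B : L2 -> R -> Om -> R) :=
  [/\ centered_gaussian P (fun ft => B ft.1 ft.2) [set ft : L2 * R | one_perp mu ft.1],
      forall (a : R) f g t, one_perp mu f -> one_perp mu g ->
        \forall w \ae P, B (a *: f + g) t w = a * B f t w + B g t w &
      forall f1 f2 t1 t2, one_perp mu f1 -> one_perp mu f2 ->
        covariance P (B f1 t1) (B f2 t2) =
          (if 0 < t1 * t2
           then Num.min `|t1| `|t2| * (- 2 * ip mu f1 (op_inv (ip mu) DA A f2))
           else 0)%:E].

Definition stationary_field (gamma : R) (B : L2 -> R -> Om -> R)
    (f : L2) (t : R) (w : Om) : R :=
  expR (- `|gamma| * t) * (Num.sqrt (2 * `|gamma|))^-1 * B f (expR (2 * `|gamma| * t)) w.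

End fields.

Section rigging.
Context d (S : measurableType d) (R : realType) (mu : probability S R).
Local Notation L2 := (LspaceType2 mu).
Variables (DA : set L2) (A : L2 -> L2) (gamma : R).

(* negAinv is (-A)^-1. *)
Definition negAinv : L2 -> L2 := op_inv (ip mu) DA (fun f => - A f).

Definition Gamma_op (f : L2) : L2 := - `|gamma| *: f.

Definition Gammainv : L2 -> L2 := op_inv (ip mu) (one_perp mu) Gamma_op.

Definition C_op (f : L2) : L2 := 2 *: negAinv f.

Definition Sigma_op (f : L2) : L2 := - 2^-1 *: Gammainv (C_op f).

Definition r_D (f g : L2) : R :=
  (1 + `|gamma|) ^+ 2 / `|gamma| * ip mu f (negAinv g).

Variables (e : nat -> L2) (lambda : nat -> R).

(* K f = sum_n lambda_n r(e_n, f) e_n, the series converging in (D, r). *)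
Definition K_op (f : L2) : L2 :=
  xget 0 [set g | one_perp mu g /\
    q_cvg r_D (fun N => \sum_(n < N) (lambda n * r_D (e n) f) *: e n) g].

Definition D_K : set L2 := K_op @` one_perp mu.

Definition Kinv (f : L2) : L2 := xget 0 [set g | one_perp mu g /\ K_op g = f].

Definition r_K (f g : L2) : R := r_D (Kinv f) (Kinv g).

Definition H_space := dual D_K r_K.

Context d' (Om : measurableType d') (P : probability Om R).

(* Y is a sample continuous H-process representing the field W. *)
Definition continuous_version (W : L2 -> R -> Om -> R)
    (Y : R -> {RV P >-> borel H_space}) :=
  (forall w, continuous (fun t => Y t w : H_space)) /\
  (forall t f, D_K f -> \forall w \ae P, pairing (Y t w) f = W f t w).

End rigging.

(* Main.v *)
(* In a separable Hilbert space with an orthonormal basis [b], an element of the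
   dual is a square-summable sequence of coordinates on [b], and the Borel
   sigma-algebra of the dual is generated by the coordinates.  Laws on the dual,
   and on families of elements of the dual, are therefore determined by their
   finite linear functionals (Cramer-Wold).  The stationary field [Z] is Gaussian
   with covariance [expR (- |gamma| |t - s|) * sigma f g], so each claim on a
   continuous version [Y] becomes an identity between covariances: with [nu] the
   law of [Y 0], [a = expR (- |gamma| t)] and [c = sqrt (1 - a ^ 2)], the transition
   probability [p t y] is the law of [a y + c xi] for [xi] of law [nu], and the
   Markov property says that the past together with [Y (s + t)] has the law of the
   past together with [a Y s + c xi], [xi] being independent of the past.
   A continuous version is obtained from Kolmogorov's argument on dyadic times,
   applied to all the coordinates [Z e_n] at once: the random Hoelder constants are
   summable against [lambda_n ^ 2], which is what continuity in [H] requires. *)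

Require Import Defs.
From HB Require Import structures.
From mathcomp Require Import all_boot all_order all_algebra.
From mathcomp Require Import all_classical all_reals all_analysis.
From mathcomp Require Import measurable_realfun zify ring lra.

Set Implicit Arguments.
Unset Strict Implicit.
Unset Printing Implicit Defensive.

Import Order.TTheory GRing.Theory Num.Theory.
Import numFieldNormedType.Exports.

Local Open Scope classical_set_scope.
Local Open Scope ring_scope.

(** * Gaussian laws on the line *)

(** Laws are compared without inverting characteristic functions: if all linear forms have equal
    laws, so do the integrals of [cos (l x + c)], and bounded limits then reach indicators. For this
    the law of each finite combination must be determined by the covariance kernel; its variance,
    only asserted to exist in [centered_gaussian], is therefore identified with a quadratic form in
    the kernel. Variance zero occurs naturally (basis vectors outside [I], the noise at time 0), so
    normal laws always carry a Dirac case. No Gaussian measure on [H] is built by hand: the law of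
    [Y 0] serves as invariant law, and its rescaled copies provide all the noise. The independence
    of that noise is realised on a product space. Increments of [Z e_n] have variance of order
    [|t - s|], so second moments do not suffice for Kolmogorov's argument. Fourth moments are of
    order [(t - s) ^+ 2], and the [2 ^ k] increments of level [k] contribute only [2 ^- k] in
    total. *)

Section normal_density_integral.
Context (R : realType).
Local Notation leb := (@lebesgue_measure R).
Implicit Types (m s a : R).

(** [normal_prob] is an integral of [normal_pdf], so its Radon-Nikodym derivative has the same
    integrals over measurable sets as [normal_pdf] and agrees with it almost everywhere. *)
Lemma ge0_integral_normal_prob m s (f : R -> \bar R) :
  (forall x, (0 <= f x)%E) -> measurable_fun setT f ->
  (\int[normal_prob m s]_x f x = \int[leb]_x (f x * (normal_pdf m s x)%:E))%E.
Proof.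
move=> f0 mf; pose nu := normal_prob m s.
have dom : nu `<< leb by exact: normal_prob_dominates.
rewrite -(Radon_Nikodym_SigmaFinite.change_of_variables dom f0 measurableT mf).
have mRN := measurable_int _ (Radon_Nikodym_SigmaFinite.f_integrable dom).
have mpdf : measurable_fun setT (fun x => (normal_pdf m s x)%:E).
  by apply/measurable_EFinP; exact: measurable_normal_pdf.
apply: ae_eq_integral => //.
- exact: emeasurable_funM.
- exact: emeasurable_funM.
apply: ae_eqe_mul2l.
apply: integral_ae_eq => //.
  exact: Radon_Nikodym_SigmaFinite.f_integrable.
by move=> E _ mE; rewrite -Radon_Nikodym_SigmaFinite.f_integral.
Qed.

(** Half-open intervals determine Lebesgue measure, and on these the translated measure has the same
    value. *)
Lemma lebesgue_measure_shift a (A : set R) : measurable A ->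
  pushforward leb (fun x : measurableTypeR R => x + a : measurableTypeR R) A = leb A.
Proof.
have ms : measurable_fun setT (fun x : measurableTypeR R => x + a : measurableTypeR R).
  exact: measurable_funD.
pose ms' := isMeasurableFun.Build _ _ _ _ _ ms.
pose sh : {mfun measurableTypeR R >-> measurableTypeR R} := HB.pack (fun x => x + a) ms'.
move=> mA; apply/esym; apply: (@lebesgue_measure_unique _ (pushforward leb sh)) => //= _ [[b c]] _ <-.
rewrite /pushforward.
have -> : sh @^-1` [set` `]b, c]] = [set` `](b - a), (c - a)]].
  apply/seteqP; split => x /=; rewrite !in_itv/=; lra.
rewrite !lebesgue_measure_itv/= !lte_fin ltrD2r.
by case: ifPn => // _; rewrite -!EFinD; congr EFin; ring.
Qed.

Lemma ge0_integral_shift a (f : R -> \bar R) :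
  (forall x, (0 <= f x)%E) -> measurable_fun setT f ->
  (\int[leb]_x f (x + a)%R = \int[leb]_x f x)%E.
Proof.
move=> f0 mf.
have ms : measurable_fun setT (fun x : measurableTypeR R => x + a : measurableTypeR R).
  exact: measurable_funD.
have := ge0_integral_pushforward ms leb measurableT mf (fun y _ => f0 y).
rewrite preimage_setT /= => <-.
by apply: eq_measure_integral => A mA _; exact: lebesgue_measure_shift.
Qed.

Lemma normal_pdf_shift m s a x : s != 0 -> normal_pdf m s x = normal_pdf (m + a) s (x + a).
Proof.
move=> s0; rewrite !normal_pdfE// /normal_fun.
by have -> : x + a - (m + a) = x - m by ring.
Qed.

Lemma normal_prob_shift m s a (U : set R) : s != 0 -> measurable U ->
  normal_prob m s ((fun x => x + a) @^-1` U) = normal_prob (m + a) s U.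
Proof.
move=> s0 mU; rewrite /normal_prob integral_mkcond [RHS]integral_mkcond.
rewrite -[RHS](ge0_integral_shift a).
- apply: eq_integral => x _; rewrite !patchE; congr (if _ then _ else _).
  by rewrite -normal_pdf_shift.
- by move=> x; rewrite patchE; case: ifP => // _; rewrite lee_fin normal_pdf_ge0.
- apply/(measurable_restrictT _ mU).
  by apply/measurable_EFinP; apply: measurable_funTS; exact: measurable_normal_pdf.
Qed.

End normal_density_integral.

(** * Second and fourth moments of the centred normal law *)

Section normal_moments.
Context (R : realType) (s : R) (s_gt0 : 0 < s).
Local Notation leb := (@lebesgue_measure R).
Local Notation G := (normal_pdf 0 s : R -> R).

Lemma is_derive_normal_pdf (x : R) : is_derive x (1 : R) (G : R -> R) (- (x / s ^+ 2) * G x).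
Proof.
have s0 : s != 0 by rewrite gt_eqF.
have -> : G = fun x => normal_peak s * expR (- (s ^+ 2 *+ 2)^-1 * (x ^+ 2)).
  apply/funext => y; rewrite normal_pdfE// /normal_fun subr0.
  by congr (_ * expR _); rewrite !mulNr mulrC.
apply: is_derive_eq => /=.
rewrite /GRing.scale/= -mulr_natl; field.
exact: s0.
Qed.

Lemma derive1_normal_pdf (x : R) : (G : R -> R)^`()%classic x = - (x / s ^+ 2) * G x.
Proof. by rewrite derive1E; exact: (@derive_val _ _ _ _ _ _ _ (is_derive_normal_pdf x)). Qed.

(** The truncation to a segment is there for integration by parts, whose boundary term is then
    explicit. *)
Definition truncated_moment (k n : nat) : R := \int[leb]_(x in `[- n%:R, n%:R]) (x ^+ k * G x).


Lemma derivable_LRcontinuous (f : R -> R) a b :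
  (forall x, derivable f x 1) -> derivable_oo_LRcontinuous f a b.
Proof.
move=> df; have cf x : {for x, continuous f}.
  by apply: differentiable_continuous; apply/derivable1_diffP.
split=> [x _||]; first exact: df.
- exact: cvg_at_right_filter (cf a).
- exact: cvg_at_left_filter (cf b).
Qed.

Lemma continuous_normal_pdf0 : continuous G.
Proof. by apply: continuous_normal_pdf; rewrite gt_eqF. Qed.

(** Integration by parts of [x ^+ k.+1] against the derivative of [G], which is
    [- (x / s ^+ 2) * G x]. Since [k] is even, [x ^+ k.+1] is odd and the two boundary contributions
    add up instead of cancelling. *)
Lemma truncated_moment_rec k n : (0 < n)%N -> ~~ odd k ->
  truncated_moment k.+2 n =
    s ^+ 2 * (k.+1%:R * truncated_moment k n - 2 * n%:R ^+ k.+1 * G n%:R).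
Proof.
move=> n0 ek.
have nn : - n%:R < n%:R :> R by rewrite -subr_gt0 opprK addr_gt0 // ltr0n.
have s0 : s != 0 by rewrite gt_eqF.
have cX j : continuous (fun x : R => x ^+ j) by move=> x; exact: exprn_continuous.
have int (f : R -> R) : continuous f ->
    leb.-integrable `[- n%:R, n%:R] (EFin \o f).
  move=> cf; apply: continuous_compact_integrable; first exact: segment_compact.
  exact: continuous_subspaceT.
have cXG j : continuous (fun x : R => x ^+ j * G x).
  by move=> x; apply: cvgM; [exact: cX|exact: continuous_normal_pdf0].
have := @Rintegration_by_parts R (fun x => x ^+ k.+1) G (fun x => k.+1%:R * x ^+ k)
  (fun x => - (x / s ^+ 2) * G x) (- n%:R) n%:R nn.
have -> : (fun x : R => k.+1%:R * x ^+ k * G x) = (fun x => k.+1%:R * (x ^+ k * G x)).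
  by apply/funext => x; rewrite mulrA.
have -> : (fun x : R => x ^+ k.+1 * (- (x / s ^+ 2) * G x)) =
    (fun x => - (s ^- 2) * (x ^+ k.+2 * G x)).
  by apply/funext => x; rewrite !exprS; ring.
rewrite !RintegralZl//; [|exact: int..].
rewrite -/(truncated_moment k n) -/(truncated_moment k.+2 n).
have -> : G (- n%:R) = G n%:R by rewrite !normal_pdfE// /normal_fun !subr0 sqrrN.
have -> : (- n%:R) ^+ k.+1 = - n%:R ^+ k.+1 :> R.
  by rewrite exprNn -signr_odd /= ek expr1 mulN1r.
move=> H; rewrite -[LHS](@mulKf _ (- s ^- 2)) ?H; last 1 first.
- by rewrite oppr_eq0 invr_neq0// expf_neq0.
- by rewrite invrN invrK; ring.
- apply: continuous_subspaceT => x; apply: cvgM; first exact: cvg_cst.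
  exact: cX.
- apply: derivable_LRcontinuous => x; exact: exprn_derivable.
- by move=> x _; rewrite exp_derive1.
- apply: continuous_subspaceT => x; apply: cvgM; last exact: continuous_normal_pdf0.
  apply: cvgN; apply: cvgM; [exact: cvg_id|exact: cvg_cst].
- apply: derivable_LRcontinuous => x.
  exact: (@ex_derive _ _ _ _ _ _ _ (is_derive_normal_pdf x)).
- by move=> x _; rewrite derive1_normal_pdf.
Qed.

(** Monotone convergence; evenness of [k] makes the integrand nonnegative. *)
Lemma cvg_truncated_moment k : ~~ odd k ->
  ((truncated_moment k n)%:E @[n --> \oo] -->
     \int[normal_prob 0 s]_x (x ^+ k)%:E)%E.
Proof.
move=> ek; have xk0 x : 0 <= x ^+ k :> R by rewrite exprn_even_ge0.
rewrite ge0_integral_normal_prob//; last first.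
  by apply/measurable_EFinP; exact: measurable_funX.
have cXG : continuous (fun x : R => x ^+ k * G x).
  by move=> x; apply: cvgM; [exact: exprn_continuous|exact: continuous_normal_pdf0].
pose I n : set R := `[- n%:R, n%:R]%classic.
have -> : (fun n => (truncated_moment k n)%:E) =
    (fun n => \int[leb]_(x in I n) (x ^+ k * G x)%R%:E)%E.
  apply/funext => n; rewrite /truncated_moment /Rintegral fineK//.
  apply: integrable_fin_num => //.
  apply: continuous_compact_integrable; first exact: segment_compact.
  exact: continuous_subspaceT.
have UT : \bigcup_n I n = setT.
  apply/seteqP; split => // x _; exists (Num.truncn `|x|).+1 => //.
  by rewrite /I /= in_itv/= -ler_norml ltW// truncnS_gt.
rewrite -UT; apply: ge0_nondecreasing_set_cvg_integral => //.
- move=> m n mn; apply/subsetPset => x; rewrite /I /= !in_itv/= => /andP[a b].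
  have : m%:R <= n%:R :> R by rewrite ler_nat.
  lra.
- by move=> n; exact: measurable_itv.
- move=> n; apply/measurable_EFinP; apply: measurable_funTS.
  exact: continuous_measurable_fun.
- by move=> n x _; rewrite lee_fin mulr_ge0// normal_pdf_ge0.
Qed.

(** With [u = n ^ 2 / (2 s ^ 2)], the inequality [expR u >= 1 + u] bounds the term by a constant
    over [n]. *)
Lemma cvg_boundary_term : n%:R * G n%:R @[n --> \oo] --> (0 : R).
Proof.
have s0 : s != 0 by rewrite gt_eqF.
pose c := normal_peak s * (s ^+ 2 *+ 2).
apply: (@squeeze_cvgr _ _ _ _ (fun=> 0) (fun n => c * n%:R^-1)).
- near=> n; rewrite mulr_ge0 ?normal_pdf_ge0//=.
  have n0 : (0 : R) < n%:R by rewrite ltr0n; near: n; exact: nbhs_infty_gt.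
  rewrite ler_pdivlMr// normal_pdfE// /normal_fun subr0 mulrAC.
  rewrite /c mulrCA ler_wpM2l ?normal_peak_ge0//.
  rewrite mulNr expRN ler_pdivrMr ?expR_gt0// -expr2.
  have s20 : 0 < s ^+ 2 *+ 2 by rewrite pmulrn_lgt0// exprn_gt0.
  rewrite mulrC -ler_pdivrMr//.
  by have := expR_ge1Dx (n%:R ^+ 2 / (s ^+ 2 *+ 2)); lra.
- exact: cvg_cst.
- rewrite -[X in _ --> X](mulr0 c); apply: cvgM; first exact: cvg_cst.
  apply/gtr0_cvgV0; last exact: cvgr_idn.
  by near do rewrite ltr0n; exact: nbhs_infty_gt.
Unshelve. all: by end_near. Qed.

Lemma integral_sqr_normal_prob : (\int[normal_prob 0 s]_x (x ^+ 2)%:E = (s ^+ 2)%:E)%E.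
Proof.
have I0 : (\int[normal_prob 0 s]_x (x ^+ 0)%:E = 1)%E.
  by under eq_integral do rewrite expr0; rewrite integral_cst//= probability_setT mule1.
apply/esym; have := cvg_truncated_moment (k := 2) isT; apply: cvg_unique => //.
have : truncated_moment 0 n @[n --> \oo] --> (1 : R).
  by have := cvg_truncated_moment (k := 0) isT; rewrite I0 => /fine_cvgP[].
move=> m0.
have -> : s ^+ 2 = s ^+ 2 * (1 * 1 - 2 * 0) :> R by ring.
apply: cvg_EFin; first exact: nearW.
have : s ^+ 2 * (1 * truncated_moment 0 n - 2 * (n%:R * G n%:R)) @[n --> \oo] -->
    (s ^+ 2 * (1 * 1 - 2 * 0) : R).
  apply: cvgM; first exact: cvg_cst.
  apply: cvgB; first by apply: cvgM => //; exact: cvg_cst.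
  by apply: cvgM; [exact: cvg_cst|exact: cvg_boundary_term].
apply: cvg_trans; apply: near_eq_cvg.
near=> n; rewrite /= truncated_moment_rec//; last by near: n; exact: nbhs_infty_gt.
by rewrite expr1 mulrA.
Unshelve. all: by end_near. Qed.

(** An upper bound is enough for Kolmogorov's estimate, so the boundary term, which enters with a
    minus sign, is simply dropped. *)
Lemma integral_exp4_normal_prob :
  (\int[normal_prob 0 s]_x (x ^+ 4)%:E <= (3 * s ^+ 4)%:E)%E.
Proof.
have c4 := cvg_truncated_moment (k := 4) isT.
have c2 := cvg_truncated_moment (k := 2) isT.
rewrite integral_sqr_normal_prob in c2.
have c2' : ((3 * s ^+ 2)%:E * (truncated_moment 2 n)%:E @[n --> \oo] -->
    (3 * s ^+ 2)%:E * (s ^+ 2)%:E)%E.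
  by apply: cvgeZl.
have -> : (3 * s ^+ 4)%:E = ((3 * s ^+ 2)%:E * (s ^+ 2)%:E)%E.
  by rewrite -EFinM; congr EFin; ring.
apply: (lee_cvg_to c4 c2'); near=> n.
rewrite -EFinM lee_fin truncated_moment_rec//; last by near: n; exact: nbhs_infty_gt.
rewrite mulrBr mulrA (mulrC (s ^+ 2)) lerBlDr lerDl.
by rewrite !mulr_ge0 ?normal_pdf_ge0 ?exprn_ge0// ltW.
Unshelve. all: by end_near. Qed.

End normal_moments.

Section gaussian_rv.
Context (R : realType).
Local Notation leb := (@lebesgue_measure R).

Lemma normal_law_shift (m v a : R) (U : set R) : measurable U ->
  0 <= v -> normal_law m v ((fun x => x + a) @^-1` U) = normal_law (m + a) v U.
Proof.
move=> mU v_ge0; rewrite /normal_law; case: ifPn => [_|v0]; first by rewrite !diracE.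
by rewrite normal_prob_shift// gt_eqF// sqrtr_gt0 lt_def v0.
Qed.

(** Variance [v = 0] stands for an almost surely zero variable, through the Dirac branch of
    [normal_law]. *)
Definition gaussian_rv d (T : measurableType d) (P : probability T R) (X : T -> R) (v : R) :=
  measurable_fun setT X /\ forall U, measurable U -> P (X @^-1` U) = normal_law 0 v U.

Context d (T : measurableType d) (P : probability T R).

Lemma ge0_integral_gaussian_rv (X : T -> R) (v : R) (f : R -> \bar R) :
  gaussian_rv P X v -> (forall x, (0 <= f x)%E) -> measurable_fun setT f ->
  (\int[P]_w f (X w) =
    if (v == 0)%R then f 0%R else \int[normal_prob 0%R (Num.sqrt v)]_x f x)%E.
Proof.
move=> [mX XP] f0 mf.
pose X' : T -> measurableTypeR R := X.
have mX' : measurable_fun setT X' := mX.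
have := @ge0_integral_pushforward _ _ _ (measurableTypeR R) _ _ mX' P setT
  f measurableT mf (fun y _ => f0 y).
rewrite preimage_setT /= => <-.
case: ifPn => [/eqP v0|v0].
  rewrite -(@eq_measure_integral _ _ _ _ _ (dirac (0 : measurableTypeR R))); last first.
    by move=> A mA _; transitivity (P (X @^-1` A)) => //; rewrite XP// /normal_law v0 eqxx.
  by rewrite integral_dirac// diracT mul1e.
apply: eq_measure_integral => A mA _.
by transitivity (P (X @^-1` A)) => //; rewrite XP// /normal_law (negbTE v0).
Qed.

Lemma gaussian_rv_sqr (X : T -> R) (v : R) : 0 <= v -> gaussian_rv P X v ->
  (\int[P]_w (X w ^+ 2)%:E = v%:E)%E.
Proof.
move=> v0 gX; rewrite (ge0_integral_gaussian_rv (f := fun x => (x ^+ 2)%:E) gX).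
- case: ifPn => [/eqP ->|v_neq0]; first by rewrite expr0n.
  by rewrite integral_sqr_normal_prob ?sqr_sqrtr// sqrtr_gt0 lt_def v_neq0.
- by move=> x; rewrite lee_fin sqr_ge0.
- by apply/measurable_EFinP; exact: measurable_funX.
Qed.

Lemma gaussian_rv_exp4 (X : T -> R) (v : R) : 0 <= v -> gaussian_rv P X v ->
  (\int[P]_w (X w ^+ 4)%:E <= (3 * v ^+ 2)%:E)%E.
Proof.
move=> v0 gX; rewrite (ge0_integral_gaussian_rv (f := fun x => (x ^+ 4)%:E) gX).
- case: ifPn => [/eqP ->|v_neq0]; first by rewrite !expr0n/= mulr0.
  rewrite (le_trans (integral_exp4_normal_prob _)) ?sqrtr_gt0 ?lt_def ?v_neq0//.
  by rewrite (exprM _ 2 2) sqr_sqrtr.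
- by move=> x; rewrite lee_fin exprn_even_ge0.
- by apply/measurable_EFinP; exact: measurable_funX.
Qed.

End gaussian_rv.

(** * Convolution of normal laws *)

Section normal_convolution.
Context (R : realType).
Local Notation leb := (@lebesgue_measure R).

Let mul_vars (F : realFieldType) (v w p : F) : v + w != 0 ->
  v * p *+ 2 * (w * p *+ 2) = (v + w) * p *+ 2 * (v * w / (v + w) * p *+ 2).
Proof.
by move=> vw; field.
Qed.

Let add_exponents (F : realFieldType) (v w y z : F) : v != 0 -> w != 0 -> v + w != 0 ->
  - (z - y) ^+ 2 / (v *+ 2) + - y ^+ 2 / (w *+ 2) =
  - z ^+ 2 / ((v + w) *+ 2) + - (y - z * w / (v + w)) ^+ 2 / (v * w / (v + w) *+ 2).
Proof.
by move=> v0 w0 vw; field; rewrite v0 w0 vw.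
Qed.

(** Completing the square in [y]. For independent centred normal variables of variances [v] and [w],
    the right-hand side is the density of their sum at [z] times the conditional density at [y] of
    the second variable given that sum. *)
Lemma normal_pdf_mul (v w z y : R) : 0 < v -> 0 < w ->
  normal_pdf 0 (Num.sqrt v) (z - y) * normal_pdf 0 (Num.sqrt w) y =
  normal_pdf 0 (Num.sqrt (v + w)) z *
    normal_pdf (z * w / (v + w)) (Num.sqrt (v * w / (v + w))) y.
Proof.
move=> v0 w0; have vw0 : 0 < v + w by exact: addr_gt0.
have c0 : 0 < v * w / (v + w) by rewrite divr_gt0// mulr_gt0.
rewrite !normal_pdfE ?gt_eqF ?sqrtr_gt0// /normal_fun /normal_peak !sqr_sqrtr ?ltW//.
rewrite mulrACA [RHS]mulrACA -!expRD -!invfM.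
congr (_^-1 * expR _).
  have p0 : 0 < (pi : R) by exact: pi_gt0.
  rewrite -!sqrtrM ?mulrn_wge0 ?mulr_ge0 ?ltW//; congr Num.sqrt.
  by apply: mul_vars; rewrite gt_eqF.
by rewrite !subr0; apply: add_exponents; rewrite gt_eqF.
Qed.

(** After Tonelli, the conditional density in [normal_pdf_mul] integrates to 1 and the density of
    the sum remains. *)
Lemma normal_prob_convolution (v w : R) (U : set R) : 0 < v -> 0 < w -> measurable U ->
  (\int[normal_prob 0%R (Num.sqrt v)]_a normal_prob a (Num.sqrt w) U =
   normal_prob 0%R (Num.sqrt (v + w)) U)%E.
Proof.
move=> v0 w0 mU.
have w0' : Num.sqrt w != 0 by rewrite gt_eqF// sqrtr_gt0.
pose f (az : R * R) : \bar R :=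
  ((\1_U az.2 * normal_pdf 0 (Num.sqrt w) (az.2 - az.1)) * normal_pdf 0 (Num.sqrt v) az.1)%:E.
have f0 az : (0 <= f az)%E by rewrite lee_fin !mulr_ge0 ?normal_pdf_ge0.
have mp s : measurable_fun setT (normal_pdf 0 s : R -> R) by exact: measurable_normal_pdf.
have mf : measurable_fun setT f.
  apply/measurable_EFinP; apply: measurable_funM.
    apply: measurable_funM.
      by apply: measurableT_comp; [exact: measurable_indic|exact: measurable_snd].
    apply: (measurableT_comp (mp _)).
    by apply: measurable_funB; [exact: measurable_snd|exact: measurable_fst].
  by apply: (measurableT_comp (mp _)); exact: measurable_fst.
have hE a : normal_prob a (Num.sqrt w) U =
    (\int[leb]_z (\1_U z * normal_pdf 0 (Num.sqrt w) (z - a))%:E)%E.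
  rewrite /normal_prob integral_mkcond; apply: eq_integral => z _.
  rewrite patchE indicE; case: ifPn => zU; last by rewrite mul0r.
  by rewrite mul1r (normal_pdf_shift 0 a)// add0r subrK.
have mfa a : measurable_fun setT (fun z : R => (\1_U z * normal_pdf 0 (Num.sqrt w) (z - a))%:E).
  apply/measurable_EFinP; apply: measurable_funM; first exact: measurable_indic.
  by apply: (measurableT_comp (mp _)); exact: measurable_funB.
have hf a : (normal_prob a (Num.sqrt w) U * (normal_pdf 0 (Num.sqrt v) a)%:E =
    \int[leb]_z f (a, z))%E.
  rewrite hE -ge0_integralZr//; first exact: mfa.
  - by move=> z ?; rewrite lee_fin mulr_ge0 ?normal_pdf_ge0.
  - by rewrite lee_fin normal_pdf_ge0.
have mh : measurable_fun setT (fun a : R => normal_prob a (Num.sqrt w) U).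
  under eq_fun do rewrite hE.
  pose f2 (az : R * R) := (\1_U az.2 * normal_pdf 0 (Num.sqrt w) (az.2 - az.1))%:E.
  have mf2 : measurable_fun setT f2.
    apply/measurable_EFinP; apply: measurable_funM.
      by apply: measurableT_comp; [exact: measurable_indic|exact: measurable_snd].
    apply: (measurableT_comp (mp _)).
    by apply: measurable_funB; [exact: measurable_snd|exact: measurable_fst].
  apply: (@measurable_fun_fubini_tonelli_F _ _ _ _ _ leb _ mf2) => x.
  by rewrite lee_fin mulr_ge0 ?normal_pdf_ge0.
rewrite ge0_integral_normal_prob//.
under eq_integral do rewrite hf.
rewrite (fubini_tonelli (m1 := leb) (m2 := leb) _ mf f0).
rewrite [RHS]/normal_prob [RHS]integral_mkcond; apply: eq_integral => z _.
rewrite patchE; case: ifPn => zU; last first.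
  by rewrite integral0_eq// => a _; rewrite /f indicE (negbTE zU) !mul0r.
under eq_integral do rewrite /f indicE zU mul1r /= normal_pdf_mul// EFinM.
rewrite ge0_integralZl ?integral_normal_pdf ?mule1//.
- by rewrite addrC.
- by apply/measurable_EFinP; exact: measurable_normal_pdf.
- by move=> x _; rewrite lee_fin normal_pdf_ge0.
- by rewrite lee_fin normal_pdf_ge0.
Qed.

Lemma gaussian_rv_add d1 d2 (T1 : measurableType d1) (T2 : measurableType d2)
    (P1 : probability T1 R) (P2 : probability T2 R) (X : T1 -> R) (Y : T2 -> R) (v w : R) :
  0 <= v -> 0 <= w -> gaussian_rv P1 X v -> gaussian_rv P2 Y w ->
  gaussian_rv (P1 \x P2)%E (fun z => X z.1 + Y z.2) (v + w).
Proof.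
move=> v0 w0 gX gY; have [mX XP] := gX; have [mY YP] := gY.
have mXY : measurable_fun setT (fun z : T1 * T2 => X z.1 + Y z.2).
  apply: measurable_funD.
    by apply: (measurableT_comp mX); exact: measurable_fst.
  by apply: (measurableT_comp mY); exact: measurable_snd.
split; first exact: mXY.
move=> U mU; have shiftU a : measurable ((fun x : R => x + a) @^-1` U).
  by rewrite -[X in measurable X]setTI; apply: measurable_funD.
pose h a := normal_law 0 w ((fun x => x + a) @^-1` U).
transitivity (\int[P1]_x h (X x))%E.
  apply: eq_integral => x _; rewrite /h -YP//=; congr (P2 _).
  by apply/seteqP; split=> y /=; rewrite /xsection/= inE/= addrC.
(* A zero variance gives a point mass, which has no density, so the convolution of densities only
   covers two positive variances. *)
have [w00|w_neq0] := eqVneq w 0.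
  rewrite {1}w00 addr0 -XP//; rewrite -[X in P1 X]setIT -integral_indic//; last first.
    by rewrite -[X in measurable X]setTI; apply: mX.
  apply: eq_integral => x _; rewrite /h w00 /normal_law eqxx diracE indicE.
  by congr ((nat_of_bool _)%:R%:E); apply/idP/idP; rewrite !inE/= add0r.
have w_gt0 : 0 < w by rewrite lt_def w_neq0.
have hE a : h a = normal_prob a (Num.sqrt w) U.
  rewrite /h /normal_law (negbTE w_neq0) normal_prob_shift ?add0r//.
  by rewrite gt_eqF// sqrtr_gt0.
have mh : measurable_fun setT h.
  have mA : measurable [set az : R * R | U (az.2 + az.1)].
    rewrite -[X in measurable X]setTI; apply: measurable_funD => //.
  have -> : h = fun a => normal_law 0 w (xsection [set az : R * R | U (az.2 + az.1)] a).
    apply/funext => a; rewrite /h; congr normal_law.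
    by apply/seteqP; split=> y /=; rewrite /xsection/= inE.
  rewrite /normal_law (negbTE w_neq0).
  exact: measurable_fun_xsection.
have h0 a : (0 <= h a)%E by rewrite hE.
rewrite (ge0_integral_gaussian_rv gX h0 mh); case: ifPn => [/eqP ->|v_neq0].
  by rewrite hE add0r /normal_law (negbTE w_neq0).
have v_gt0 : 0 < v by rewrite lt_def v_neq0.
under eq_integral do rewrite hE.
rewrite normal_prob_convolution// /normal_law gt_eqF//.
exact: addr_gt0.
Qed.

End normal_convolution.

(** * Gaussian fields *)

Section second_moments.
Context (R : realType) d (T : measurableType d) (P : probability T R).
Implicit Types X Y : T -> R.

Lemma integrable_sqr_mul X Y : measurable_fun setT X -> measurable_fun setT Y ->
  (\int[P]_w (X w ^+ 2)%:E < +oo)%E -> (\int[P]_w (Y w ^+ 2)%:E < +oo)%E ->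
  P.-integrable setT (fun w => (X w * Y w)%:E).
Proof.
move=> mX mY X2 Y2.
have m2 (Z : T -> R) : measurable_fun setT Z -> measurable_fun setT (fun w => (Z w ^+ 2)%:E).
  by move=> mZ; apply/measurable_EFinP; exact: measurable_funX.
have intX2 (Z : T -> R) : measurable_fun setT Z -> (\int[P]_w (Z w ^+ 2)%:E < +oo)%E ->
    P.-integrable setT (fun w => (Z w ^+ 2)%:E).
  move=> mZ Z2; apply/integrableP; split; first exact: m2.
  by under eq_integral do rewrite gee0_abs ?lee_fin ?sqr_ge0//.
apply: (@le_integrable _ _ _ _ _ measurableT _ (fun w => ((X w ^+ 2)%:E + (Y w ^+ 2)%:E)%E)).
- by apply/measurable_EFinP; exact: measurable_funM.
- move=> w _; rewrite -EFinD !abse_EFin lee_fin normrM.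
  rewrite [leRHS]ger0_norm ?addr_ge0 ?sqr_ge0//.
  rewrite -(real_normK (num_real (X w))) -(real_normK (num_real (Y w))).
  have := sqr_ge0 (`|X w| - `|Y w|); have := normr_ge0 (X w); have := normr_ge0 (Y w); nra.
- by apply: integrableD => //; exact: intX2.
Qed.

Lemma gaussian_rv_lty X v : 0 <= v -> gaussian_rv P X v ->
  (\int[P]_w (X w ^+ 2)%:E < +oo)%E.
Proof. by move=> v0 gX; rewrite (gaussian_rv_sqr v0 gX) ltry. Qed.

Lemma gaussian_rv_pos X v Y : gaussian_rv P X v -> gaussian_rv P Y v ->
  (\int[P]_w (maxe (X w)%:E 0) = \int[P]_w (maxe (Y w)%:E 0))%E.
Proof.
move=> gX gY; pose f (x : R) := maxe x%:E 0%E.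
have f0 x : (0 <= f x)%E by rewrite /f le_max lexx orbT.
have mf : measurable_fun setT f.
  by apply: measurable_maxe => //; exact/measurable_EFinP.
by rewrite (ge0_integral_gaussian_rv gX f0 mf) (ge0_integral_gaussian_rv gY f0 mf).
Qed.

End second_moments.

Definition combo (R : realType) (T J : Type) (W : J -> T -> R) n (c : 'I_n -> R)
    (j : 'I_n -> J) (w : T) : R :=
  \sum_(i < n) c i * W (j i) w.

Section gaussian_field.
Context (R : realType) d (T : measurableType d) (P : probability T R).
Context (J : Type) (W : J -> T -> R) (I : set J) (k : J -> J -> R).

Definition qform n (c : 'I_n -> R) (j : 'I_n -> J) : R :=
  \sum_(i < n) \sum_(l < n) c i * c l * k (j i) (j l).

(** Unlike in [centered_gaussian], the variance of each combination is tied to the kernel [k], so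
    that [k] determines the law of every finite combination. *)
Definition gaussian_field :=
  [/\ forall j, I j -> measurable_fun setT (W j),
      forall j l, I j -> I l -> (\int[P]_w (W j w * W l w)%:E = (k j l)%:E)%E &
      forall n (c : 'I_n -> R) (j : 'I_n -> J), (forall i, I (j i)) ->
        0 <= qform c j /\ gaussian_rv P (combo W c j) (qform c j)].

Hypothesis W_gaussian : centered_gaussian P W I.

Lemma combo_gaussian n (c : 'I_n -> R) (j : 'I_n -> J) : (forall i, I (j i)) ->
  exists2 v, 0 <= v & gaussian_rv P (combo W c j) v.
Proof.
move=> Ij; have [mW gW] := W_gaussian.
have [v v0 gv] := gW n c j Ij; exists v => //; split=> //.
by apply: measurable_sum => i; apply: measurable_funM => //; exact: mW.
Qed.

Lemma scaled_gaussian a j : I j -> exists2 v, 0 <= v & gaussian_rv P (fun w => a * W j w) v.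
Proof.
move=> Ij; have [v v0 gv] := @combo_gaussian 1 (fun=> a) (fun=> j) (fun=> Ij).
exists v => //; rewrite (_ : (fun w => _) = combo W (fun=> a) (fun _ : 'I_1 => j))//.
by apply/funext => w; rewrite /combo big_ord1.
Qed.

Lemma centered_gaussian_lty j : I j -> (\int[P]_w (W j w ^+ 2)%:E < +oo)%E.
Proof.
move=> Ij; have [v v0 gv] := scaled_gaussian 1 Ij.
by have := gaussian_rv_lty v0 gv; under eq_integral do rewrite mul1r.
Qed.

(** [W j] and [- W j] are normal with the same variance, namely the second moment of [W j]. Hence
    the positive and negative parts of [W j] have equal integrals, finite by square-integrability,
    and these cancel. *)
Lemma centered_gaussian_mean j : I j -> (\int[P]_w (W j w)%:E = 0)%E.
Proof.
move=> Ij; have [v v0 gv] := scaled_gaussian 1 Ij.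
have [v' v'0 gv'] := scaled_gaussian (-1) Ij.
have vv' : v = v'.
  apply: EFin_inj; rewrite -(gaussian_rv_sqr v0 gv) -(gaussian_rv_sqr v'0 gv').
  by apply: eq_integral => w _; rewrite mulN1r mul1r sqrrN.
rewrite -vv' in gv'.
have e := gaussian_rv_pos gv gv'.
rewrite integralE.
have -> : (\int[P]_w ((fun w => (W j w)%:E)^\+ w) = \int[P]_w (maxe (1 * W j w)%:E 0))%E.
  by apply: eq_integral => w _; rewrite funeposE mul1r.
have -> : (\int[P]_w ((fun w => (W j w)%:E)^\- w) = \int[P]_w (maxe (1 * W j w)%:E 0))%E.
  by rewrite e; apply: eq_integral => w _; rewrite funenegE mulN1r.
rewrite subee//.
have mW : measurable_fun setT (W j) by have [mW _] := W_gaussian; exact: mW.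
have m1 : (\int[P]_w ((cst 1 : T -> R) w ^+ 2)%:E < +oo)%E.
  by under eq_integral do rewrite expr1n; rewrite integral_cst//= probability_setT mule1 ltry.
have := integrable_sqr_mul mW (measurable_cst _) (centered_gaussian_lty Ij) m1.
move=> /integrable_funepos => /(_ measurableT) /integrable_fin_num => /(_ measurableT).
congr (_ \is a fin_num); apply: eq_integral => w _.
by rewrite funeposE/= mulr1 mul1r.
Qed.

Hypothesis W_cov : forall j l, I j -> I l -> covariance P (W j) (W l) = (k j l)%:E.

Lemma centered_gaussian_cov j l : I j -> I l -> (\int[P]_w (W j w * W l w)%:E = (k j l)%:E)%E.
Proof.
move=> Ij Il; rewrite -(W_cov Ij Il) covariance.unlock !expectation.unlock.
rewrite !centered_gaussian_mean//=.
by apply: eq_integral => w _; rewrite !fctE /= !subr0.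
Qed.

(** The unknown variance of a combination is its second moment; expanding the square gives the
    quadratic form. *)
Lemma centered_gaussian_field : gaussian_field.
Proof.
have [mW _] := W_gaussian; split => //; first exact: centered_gaussian_cov.
move=> n c j Ij; have [v v0 gv] := combo_gaussian c Ij.
suff -> : qform c j = v by [].
have int i l : P.-integrable setT (fun w => (W (j i) w * W (j l) w)%:E).
  by apply: integrable_sqr_mul; [exact: mW|exact: mW|exact: centered_gaussian_lty..].
apply: EFin_inj; rewrite -(gaussian_rv_sqr v0 gv).
transitivity (\int[P]_w (\sum_(i < n) \sum_(l < n) (c i * c l)%:E * (W (j i) w * W (j l) w)%:E))%E.
  rewrite integral_sum//; last first.
    move=> i; apply: integrable_sum => // l _; exact: integrableZl.
  rewrite /qform -sumEFin; apply: eq_bigr => i _.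
  rewrite integral_sum//; last by move=> l; exact: integrableZl.
  rewrite -sumEFin; apply: eq_bigr => l _.
  by rewrite integralZl// centered_gaussian_cov.
apply: eq_integral => w _; rewrite /combo expr2 mulr_suml -sumEFin.
apply: eq_bigr => i _; rewrite mulr_sumr -sumEFin; apply: eq_bigr => l _.
by rewrite -EFinM mulrACA.
Qed.

End gaussian_field.

(** * The Cramer-Wold device *)

Section sign_polynomials.
Context (R : realType).

Lemma bernoulli_inequality (x : R) n : -1 <= x -> 1 + n%:R * x <= (1 + x) ^+ n.
Proof.
move=> x1; elim: n => [|n IH]; first by rewrite mul0r addr0 expr0.
rewrite exprS (le_trans _ (ler_wpM2l _ IH)) ?subr_ge0//; last by lra.
rewrite -natr1 mulrDl mul1r -subr_ge0.
have -> : (1 + x) * (1 + n%:R * x) - (1 + (n%:R * x + x)) = n%:R * (x * x) by ring.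
by rewrite mulr_ge0// -expr2 sqr_ge0.
Qed.

(** The polynomials of the Brosowski-Deutsch proof of the Stone-Weierstrass theorem: on the unit
    interval they approach the indicator of [u < 1 / 2], the comparison of [(2 * u) ^+ n] with 1
    being decisive. *)
Definition step_poly (n : nat) (u : R) : R := (1 - u ^+ n) ^+ (2 ^ n).

Lemma step_poly_ge0_le1 n u : 0 <= u <= 1 -> 0 <= step_poly n u <= 1.
Proof.
move=> /andP[u0 u1].
have un0 : 0 <= u ^+ n by rewrite exprn_ge0.
have un1 : u ^+ n <= 1 by rewrite exprn_ile1.
by rewrite exprn_ge0 ?exprn_ile1//; lra.
Qed.

Lemma cvg_step_poly1 u : 0 <= u < 2^-1 -> step_poly n u @[n --> \oo] --> (1 : R).
Proof.
move=> /andP[u0 u2].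
apply: (@squeeze_cvgr _ _ _ _ (fun n => 1 - (2 * u) ^+ n) (fun=> 1)).
- apply: nearW => n; have /andP[_ ->] : 0 <= step_poly n u <= 1.
    by apply: step_poly_ge0_le1; lra.
  rewrite andbT exprMn -natrX.
  have := @bernoulli_inequality (- u ^+ n) (2 ^ n).
  rewrite mulrN; apply.
  by rewrite lerN2 exprn_ile1//; lra.
- rewrite -[X in _ --> X]subr0; apply: cvgB; first exact: cvg_cst.
  by apply: cvg_expr; rewrite ger0_norm; lra.
- exact: cvg_cst.
Qed.

(** Since [(1 - u ^+ n) * (1 + u ^+ n) <= 1], it is enough that [(1 + u ^+ n) ^+ (2 ^ n)] be large,
    and Bernoulli's inequality bounds it below by [(2 * u) ^+ n]. *)
Lemma cvg_step_poly0 u : 2^-1 < u <= 1 -> step_poly n u @[n --> \oo] --> (0 : R).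
Proof.
move=> /andP[u2 u1].
apply: (@squeeze_cvgr _ _ _ _ (fun=> 0) (fun n => ((2 * u)^-1) ^+ n)).
- apply: nearW => n; have /andP[-> _] : 0 <= step_poly n u <= 1.
    by apply: step_poly_ge0_le1; lra.
  have un0 : 0 <= u ^+ n by rewrite exprn_ge0; lra.
  have un1 : u ^+ n <= 1 by rewrite exprn_ile1; lra.
  have p0 : 0 < (2 * u) ^+ n by rewrite exprn_gt0; lra.
  rewrite /= exprVn -[leRHS]mul1r ler_pdivlMr//.
  have ple : (2 * u) ^+ n <= (1 + u ^+ n) ^+ (2 ^ n).
    rewrite exprMn -natrX (le_trans _ (bernoulli_inequality _ _)) ?lerDr//; lra.
  rewrite (le_trans (ler_wpM2l _ ple))//.
    by rewrite /step_poly exprn_ge0//; lra.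
  rewrite /step_poly -exprMn exprn_ile1//; nra.
- exact: cvg_cst.
- apply: cvg_expr; rewrite ger0_norm ?invr_ge0; last by lra.
  by rewrite invf_lt1; lra.
Qed.

(** The antisymmetric combination vanishes at [1 / 2], so the limit of [step_poly] at that point
    does not matter. *)
Lemma cvg_sign_poly u : 0 <= u <= 1 ->
  step_poly n u - step_poly n (1 - u) @[n --> \oo] --> Num.sg (2^-1 - u).
Proof.
move=> u01; have [u2|u2|->] := ltgtP u 2^-1.
- rewrite gtr0_sg ?subr_gt0// -[X in _ --> X]subr0; apply: cvgB.
    by apply: cvg_step_poly1; lra.
  by apply: cvg_step_poly0; lra.
- rewrite ltr0_sg ?subr_lt0// -[X in _ --> X]sub0r; apply: cvgB.
    by apply: cvg_step_poly0; lra.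
  by apply: cvg_step_poly1; lra.
- have -> : 1 - 2^-1 = 2^-1 :> R by field.
  rewrite subrr sgr0; under eq_fun do rewrite subrr.
  exact: cvg_cst.
Qed.

(** Division by a large integer brings [y] between [- pi] and [pi], where the sine has the sign of
    its argument. *)
Lemma cvg_sg_sin (y : R) : Num.sg (sin (n.+1%:R^-1 * y)) @[n --> \oo] --> Num.sg y.
Proof.
have pos (z : R) : 0 < z -> \forall n \near \oo, Num.sg (sin (n.+1%:R^-1 * z)) = 1.
  move=> z0; near=> n.
  rewrite gtr0_sg// sin2_gt0// mulr_gt0 ?invr_gt0//=.
  rewrite mulrC ltr_pdivrMr//.
  rewrite (@lt_le_trans _ _ n.+1%:R)//; last first.
    by rewrite ler_peMl// ler1n.
  rewrite (lt_trans (truncnS_gt _))// ltr_nat ltnS.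
  by near: n; exact: nbhs_infty_gt.
have [y0|y0|<-] := ltgtP 0 y.
- rewrite gtr0_sg//; apply: cvg_near_cst; exact: pos.
- rewrite ltr0_sg//; apply: cvg_near_cst; have := pos (- y).
  rewrite oppr_gt0 => /(_ y0); apply: filterS => n.
  by rewrite mulrN sinN sgrN => /eqP; rewrite eqr_oppLR => /eqP.
- rewrite sgr0; under eq_fun do rewrite mulr0 sin0 sgr0.
  exact: cvg_cst.
Unshelve. all: by end_near. Qed.

End sign_polynomials.

Section trig_closure.
Context (R : realType) (E : Type) (L : set (E -> R)).

(* The addition formulas make this class closed under products, and the sign of
   [l x + c] is a bounded limit of its members; so it contains the indicators of
   the sets generated by [L]. *)
Inductive trig_closure : (E -> R) -> Prop :=
| trig_cos l c : L l -> trig_closure (fun x => cos (l x + c))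
| trig_add f g : trig_closure f -> trig_closure g -> trig_closure (f \+ g)
| trig_scale a f : trig_closure f -> trig_closure (fun x => a * f x)
| trig_lim (f : nat -> E -> R) g M : (forall n, trig_closure (f n)) ->
    (forall n x, `|f n x| <= M) -> (forall x, f n x @[n --> \oo] --> g x) ->
    trig_closure g.

Hypothesis L0 : L (fun=> 0).
Hypothesis LD : forall (a : R) l m, L l -> L m -> L (fun x => a * l x + m x).

Lemma trig_bounded f : trig_closure f -> exists2 M, 0 <= M & forall x, `|f x| <= M.
Proof.
elim=> [l c _|{}f g _ [M M0 fM] _ [N N0 gN]|a {}f _ [M M0 fM]|{}f g M _ _ fM fg].
- by exists 1 => // x; rewrite ler_norml cos_geN1 cos_le1.
- exists (M + N) => [|x]; first exact: addr_ge0.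
  by rewrite (le_trans (ler_normD _ _))// lerD.
- exists (`|a| * M) => [|x]; first exact: mulr_ge0.
  by rewrite normrM ler_wpM2l.
- exists `|M| => // x; rewrite (le_trans _ (ler_norm M))//.
  have fgx : `|f n x| @[n --> \oo] --> `|g x| by apply: cvg_norm; exact: fg.
  by apply: (ler_cvg_to fgx (cvg_cst M)); apply: nearW => n; exact: fM.
Qed.

Lemma trig_cst a : trig_closure (fun=> a).
Proof.
have -> : (fun=> a) = (fun x : E => a * cos ((fun=> 0) x + 0)).
  by apply/funext => x; rewrite addr0 cos0 mulr1.
exact/trig_scale/trig_cos.
Qed.

(** Induction on both derivations. The base case is the product-to-sum formula, which uses that [L]
    is closed under sums and differences; in the limit cases the other factor is bounded. *)
Lemma trig_mul f g : trig_closure f -> trig_closure g -> trig_closure (f \* g).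
Proof.
move=> tf; elim: tf g => [l c Ll|f1 f2 _ IH1 _ IH2|a {}f _ IH|fn {}f M tfn IH fM ff] g tg.
- elim: tg => [m b Lm|g1 g2 _ IH1 _ IH2|a {}g _ IH|gn {}g M tgn IH gM gg].
  + have -> : (fun x => cos (l x + c)) \* (fun x => cos (m x + b)) =
        (fun x => 2^-1 * (cos ((1 * l x + m x) + (c + b)) + cos ((-1 * m x + l x) + (c - b)))).
      apply/funext => x /=.
      have -> : 1 * l x + m x + (c + b) = (l x + c) + (m x + b) by ring.
      have -> : -1 * m x + l x + (c - b) = (l x + c) - (m x + b) by ring.
      by rewrite (cosD (l x + c)) (cosB (l x + c)); field.
    apply: trig_scale; apply: trig_add.
      by apply: (trig_cos (l := fun x => 1 * l x + m x)); exact: LD.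
    by apply: (trig_cos (l := fun x => -1 * m x + l x)); exact: LD.
  + have -> : (fun x => cos (l x + c)) \* (g1 \+ g2) =
        ((fun x => cos (l x + c)) \* g1) \+ ((fun x => cos (l x + c)) \* g2).
      by apply/funext => x /=; rewrite mulrDr.
    exact: trig_add.
  + have -> : (fun x => cos (l x + c)) \* (fun x => a * g x) =
        (fun x => a * ((fun x => cos (l x + c)) \* g) x).
      by apply/funext => x /=; rewrite mulrCA.
    exact: trig_scale.
  + apply: (trig_lim (M := M) IH) => [n x|x] /=.
      rewrite normrM (le_trans _ (gM n x))// ler_piMl//.
      by rewrite ler_norml cos_geN1 cos_le1.
    by apply: cvgM => //; exact: cvg_cst.
- have -> : (f1 \+ f2) \* g = (f1 \* g) \+ (f2 \* g).
    by apply/funext => x /=; rewrite mulrDl.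
  by apply: trig_add; [exact: IH1|exact: IH2].
- have -> : (fun x => a * f x) \* g = (fun x => a * (f \* g) x).
    by apply/funext => x /=; rewrite mulrA.
  by apply: trig_scale; exact: IH.
- have [N N0 gN] := trig_bounded tg.
  apply: (trig_lim (M := M * N) (fun n => IH n _ tg)) => [n x|x] /=.
    by rewrite normrM ler_pM.
  by apply: cvgM => //; exact: cvg_cst.
Qed.

Lemma trig_exp f n : trig_closure f -> trig_closure (fun x => f x ^+ n).
Proof.
move=> tf; elim: n => [|n IH].
  by under eq_fun do rewrite expr0; exact: trig_cst.
by under eq_fun do rewrite exprS; exact: trig_mul.
Qed.

Lemma trig_sub f g : trig_closure f -> trig_closure g -> trig_closure (fun x => f x - g x).
Proof.
move=> tf tg; have -> : (fun x => f x - g x) = f \+ (fun x => -1 * g x).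
  by apply/funext => x /=; rewrite mulN1r.
by apply: trig_add => //; exact: trig_scale.
Qed.

Lemma trig_step_poly n f : trig_closure f -> trig_closure (fun x => step_poly n (f x)).
Proof.
by move=> tf; apply: trig_exp; apply: trig_sub; [exact: trig_cst|exact: trig_exp].
Qed.

(** The cosine shifted by [pi / 2] yields [u = (1 - sin (l x + c)) / 2], which lies in the unit
    interval and satisfies [1 / 2 - u = sin (l x + c) / 2]; the sign polynomials of [u] then
    converge to the required sign. *)
Lemma trig_sg_sin l c : L l -> trig_closure (fun x => Num.sg (sin (l x + c))).
Proof.
move=> Ll.
pose u x := 2^-1 * (1 + cos (l x + (c + pi / 2))).
have uE x : u x = 2^-1 * (1 - sin (l x + c)) by rewrite /u addrA cosDpihalf.
have tu : trig_closure u.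
  by apply: trig_scale; apply: trig_add; [exact: trig_cst|exact: trig_cos].
have u01 x : 0 <= u x <= 1.
  by rewrite uE; have := sin_le1 (l x + c); have := sin_geN1 (l x + c); lra.
apply: (trig_lim (f := fun n x => step_poly n (u x) - step_poly n (1 - u x)) (M := 1)).
- move=> n; apply: trig_sub; apply: trig_step_poly => //.
  by apply: trig_sub => //; exact: trig_cst.
- move=> n x; have := step_poly_ge0_le1 n (u01 x).
  have : 0 <= step_poly n (1 - u x) <= 1.
    by apply: step_poly_ge0_le1; have := u01 x; lra.
  by rewrite ler_norml; lra.
- move=> x; have -> : Num.sg (sin (l x + c)) = Num.sg (2^-1 - u x).
    rewrite (_ : 2^-1 - u x = 2^-1 * sin (l x + c)); last by rewrite uE; ring.
    by rewrite sgrM [X in _ = X * _]gtr0_sg ?mul1r// invr_gt0.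
  exact: cvg_sign_poly.
Qed.

Lemma trig_sg l c : L l -> trig_closure (fun x => Num.sg (l x + c)).
Proof.
move=> Ll; apply: (trig_lim (M := 1)
  (f := fun n x => Num.sg (sin (n.+1%:R^-1 * (l x + c))))).
- move=> n; under eq_fun do rewrite mulrDr -[_ * l _]addr0.
  apply: (trig_sg_sin (l := fun x => n.+1%:R^-1 * l x + (fun=> 0) x)).
  exact: LD.
- by move=> n x; case: sgrP; rewrite ?normr0 ?normrN ?normr1.
- by move=> x; exact: cvg_sg_sin.
Qed.

Definition trig_sets : set (set E) := [set A | trig_closure (\1_A : E -> R)].

Lemma trig_setsC A : trig_sets A -> trig_sets (~` A).
Proof.
move=> tA; rewrite /trig_sets/=.
have -> : (\1_(~` A) : E -> R) = (fun x => 1 - \1_A x).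
  by apply/funext => x; rewrite !indicE in_setC; case: (x \in A); rewrite ?subrr ?subr0.
by apply: trig_sub => //; exact: trig_cst.
Qed.

Lemma trig_setsI A B : trig_sets A -> trig_sets B -> trig_sets (A `&` B).
Proof. by move=> tA tB; rewrite /trig_sets/= indicI; exact: trig_mul. Qed.

(** Complements come from differences, intersections from products, and countable unions from
    bounded limits of finite unions. *)
Lemma trig_sigma_algebra : sigma_algebra setT trig_sets.
Proof.
split.
- by rewrite /trig_sets/= indic0; exact: trig_cst.
- by move=> A tA; rewrite setTD; exact: trig_setsC.
- move=> A tA; pose B n := \big[setU/set0]_(i < n) A i.
  have tB n : trig_sets (B n).
    elim: n => [|n IH]; first by rewrite /B big_ord0 /trig_sets/= indic0; exact: trig_cst.
    rewrite /B big_ord_recr/= -[_ `|` _]setCK setCU.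
    by apply: trig_setsC; apply: trig_setsI; apply: trig_setsC.
  apply: (trig_lim (f := fun n => \1_(B n)) (M := 1)) => //.
    by move=> n x; rewrite indicE; case: (_ \in _); rewrite ?normr1 ?normr0.
  move=> x; rewrite indicE; case: (asboolP ((\bigcup_n A n) x)) => [[n _ Anx]|nAx].
    rewrite mem_set; last by exists n.
    apply: cvg_near_cst; near=> m; rewrite indicE mem_set//.
    rewrite /B -bigcup_mkord; exists n => //=.
    by near: m; exact: nbhs_infty_gt.
  rewrite memNset//; under eq_fun => m.
    rewrite indicE memNset; first over.
    by rewrite /B -bigcup_mkord => -[i _ Ai]; apply: nAx; exists i.
  exact: cvg_cst.
Unshelve. all: by end_near. Qed.

Lemma trig_sets_preimage l (U : set R) : L l -> measurable U -> trig_sets (l @^-1` U).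
Proof.
move=> Ll mU.
have {mU} : (@RGenOInfty.G R).-sigma.-measurable U by rewrite -RGenOInfty.measurableE.
move: U; have [t0 tD tU] := trig_sigma_algebra.
apply: (smallest_sub (X := [set V | trig_sets (l @^-1` V)])).
  split => /=; first by rewrite preimage_set0.
  - by move=> V tV; rewrite setTD preimage_setC; exact: trig_setsC.
  - by move=> V tV; rewrite preimage_bigcup; exact: tU.
move=> _ [a ->] /=; rewrite /trig_sets/=.
(* For a sign [s] in [{-1, 0, 1}], the polynomial [(s ^+ 2 + s) / 2] is 1 when [s = 1] and 0
   otherwise. *)
have -> : (\1_(l @^-1` `]a, +oo[) : E -> R) =
    (fun x => 2^-1 * (Num.sg (l x + - a) ^+ 2 + Num.sg (l x + - a))).
  apply/funext => x; rewrite indicE.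
  have [la|la|la] := ltgtP a (l x).
  - rewrite mem_set ?gtr0_sg ?subr_gt0//=; last by rewrite in_itv/= la.
    by field.
  - rewrite memNset/= ?in_itv/= ?ltNge ?ltW// ltr0_sg ?subr_lt0//; by field.
  - by rewrite la subrr sgr0 memNset/= ?in_itv/= -?la ?ltxx//; field.
apply: trig_scale; apply: trig_add; first exact/trig_exp/trig_sg.
exact: trig_sg.
Qed.

Context d1 d2 (T1 : measurableType d1) (T2 : measurableType d2).
Context (P1 : probability T1 R) (P2 : probability T2 R) (xi1 : T1 -> E) (xi2 : T2 -> E).
Hypothesis measurable1 : forall l, L l -> measurable_fun setT (l \o xi1).
Hypothesis measurable2 : forall l, L l -> measurable_fun setT (l \o xi2).
Hypothesis same_law : forall l (U : set R), L l -> measurable U ->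
  P1 (xi1 @^-1` (l @^-1` U)) = P2 (xi2 @^-1` (l @^-1` U)).

(** For a cosine, both integrals are taken against the common law of the linear form; sums and
    multiples are immediate, and bounded limits pass by dominated convergence. *)
Lemma trig_integral f : trig_closure f ->
  [/\ measurable_fun setT (f \o xi1), measurable_fun setT (f \o xi2) &
      (\int[P1]_w (f (xi1 w))%:E = \int[P2]_w (f (xi2 w))%:E)%E].
Proof.
have int d (T : measurableType d) (P : probability T R) (xi : T -> E) g :
    trig_closure g -> measurable_fun setT (g \o xi) ->
    P.-integrable setT (EFin \o (g \o xi)).
  move=> tg mg; have [M M0 gM] := trig_bounded tg.
  apply: (@le_integrable _ _ _ _ _ _ _ (cst M%:E)) => //; first exact/measurable_EFinP.
    by move=> x _; rewrite /= lee_fin (le_trans (gM _))// ler_norm.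
  exact: finite_measure_integrable_cst.
elim=> {f}[l c Ll|f g tf [mf1 mf2 ef] tg [mg1 mg2 eg]|a f tf [mf1 mf2 ef]|
  f g M tf IH fM fg].
- have mcos : measurable_fun setT (fun y : R => cos (y + c)).
    apply: measurableT_comp; last exact: measurable_funD.
    by apply: continuous_measurable_fun; exact: continuous_cos.
  have tl := trig_cos c Ll.
  have m1 : measurable_fun setT ((fun x => cos (l x + c)) \o xi1).
    exact: (measurableT_comp mcos (measurable1 Ll)).
  have m2 : measurable_fun setT ((fun x => cos (l x + c)) \o xi2).
    exact: (measurableT_comp mcos (measurable2 Ll)).
  split => //.
  have mE : measurable_fun setT (EFin \o (fun y : R => cos (y + c))) by exact/measurable_EFinP.
  have p1 := @integral_pushforward _ _ _ _ _ _ (measurable1 Ll) P1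
    setT _ mE (int _ _ _ _ _ tl m1) measurableT.
  have p2 := @integral_pushforward _ _ _ _ _ _ (measurable2 Ll) P2
    setT _ mE (int _ _ _ _ _ tl m2) measurableT.
  rewrite preimage_setT in p1; rewrite preimage_setT in p2.
  rewrite [LHS](esym p1) [RHS](esym p2).
  apply: eq_measure_integral; [exact: measurable2|exact: measurable1|].
  by move=> ? ? U mU _; exact: (same_law Ll mU).
- have mfg1 : measurable_fun setT ((f \+ g) \o xi1) by exact: measurable_funD.
  have mfg2 : measurable_fun setT ((f \+ g) \o xi2) by exact: measurable_funD.
  split => //; under eq_integral do rewrite EFinD.
  under [RHS]eq_integral do rewrite EFinD.
  rewrite !integralD ?ef ?eg//; exact: int.
- have mf1' : measurable_fun setT ((fun x => a * f x) \o xi1) by exact: measurable_funM.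
  have mf2' : measurable_fun setT ((fun x => a * f x) \o xi2) by exact: measurable_funM.
  split => //; under eq_integral do rewrite EFinM.
  under [RHS]eq_integral do rewrite EFinM.
  rewrite !integralZl ?ef//; exact: int.
- have m1 : measurable_fun setT (g \o xi1).
    apply: (@measurable_fun_cvg _ _ _ _ (fun n => f n \o xi1)) => [n|x _].
      by have [] := IH n.
    exact: fg.
  have m2 : measurable_fun setT (g \o xi2).
    apply: (@measurable_fun_cvg _ _ _ _ (fun n => f n \o xi2)) => [n|x _].
      by have [] := IH n.
    exact: fg.
  split => //.
  have lim d (T : measurableType d) (P : probability T R) (xi : T -> E) :
      (forall n, measurable_fun setT (f n \o xi)) ->
      (\int[P]_w (f n (xi w))%:E @[n --> \oo] --> \int[P]_w (g (xi w))%:E)%E.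
    move=> mf; apply: (@dominated_cvg _ _ _ _ _ measurableT _ _ (cst M%:E)) => //.
    + by move=> n; apply/measurable_EFinP; exact: mf.
    + by move=> x _; apply: cvg_EFin; [exact: nearW|exact: fg].
    + exact: finite_measure_integrable_cst.
    + by move=> n x _ /=; rewrite lee_fin.
  have l1 := lim _ _ P1 xi1 (fun n => let: And3 h _ _ := IH n in h).
  have l2 := lim _ _ P2 xi2 (fun n => let: And3 _ h _ := IH n in h).
  have e12 : (fun n => \int[P1]_w (f n (xi1 w))%:E)%E = (fun n => \int[P2]_w (f n (xi2 w))%:E)%E.
    by apply/funext => n; have [] := IH n.
  rewrite e12 in l1; exact: (cvg_unique _ l1 l2).
Qed.

Lemma cramer_wold (G : set (set E)) A :
  (forall B, G B -> exists2 l, L l & exists2 U : set R, measurable U & B = l @^-1` U) ->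
  <<s G >> A -> P1 (xi1 @^-1` A) = P2 (xi2 @^-1` A).
Proof.
move=> GL GA.
have tA : trig_sets A.
  move: A GA; apply: smallest_sub; first exact: trig_sigma_algebra.
  by move=> B /GL[l Ll [U mU ->]]; exact: trig_sets_preimage.
have [m1 m2] := trig_integral tA.
have mA d (T : measurableType d) (xi : T -> E) : measurable_fun setT ((\1_A : E -> R) \o xi) ->
    measurable (xi @^-1` A).
  move=> mxi; apply/(@measurable_indicP _ T R).
  by apply: eq_measurable_fun mxi => x _; rewrite /= !indicE.
have ind d (T : measurableType d) (P : probability T R) (xi : T -> E) :
    measurable_fun setT ((\1_A : E -> R) \o xi) ->
    (\int[P]_w (\1_A (xi w))%:E)%E = P (xi @^-1` A).
  move=> mxi; transitivity (\int[P]_w (\1_(xi @^-1` A) w)%:E)%E.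
    by apply: eq_integral => w _; rewrite !indicE.
  by rewrite integral_indic ?setIT//; exact: mA.
by rewrite !ind.
Qed.

End trig_closure.

(** * Inner product spaces and their duals *)

Section inner_product.
Context (R : realType) (V : lmodType R) (E : set V) (q : V -> V -> R).
Hypothesis Eq : inner_product_on E q.
Implicit Types f g h : V.

Lemma sub0 : E 0. Proof. by have [[]] := Eq. Qed.

Lemma subDZ a f g : E f -> E g -> E (a *: f + g).
Proof. by have [[_ +] _ _ _ _] := Eq; apply. Qed.

Lemma subD f g : E f -> E g -> E (f + g).
Proof. by move=> Ef Eg; rewrite -[f]scale1r; exact: subDZ. Qed.

Lemma subZ a f : E f -> E (a *: f).
Proof. by move=> Ef; rewrite -[_ *: _]addr0; apply: subDZ => //; exact: sub0. Qed.

Lemma subB f g : E f -> E g -> E (f - g).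
Proof. by move=> Ef Eg; rewrite addrC -scaleN1r; exact: subDZ. Qed.

Lemma sub_sum n (F : nat -> V) : (forall i, E (F i)) -> E (\sum_(i < n) F i).
Proof.
move=> EF; elim: n => [|n IH]; first by rewrite big_ord0; exact: sub0.
by rewrite big_ord_recr; exact: subD.
Qed.

Lemma qC f g : E f -> E g -> q f g = q g f.
Proof. by have [_ + _ _ _] := Eq; apply. Qed.

Lemma qDZl a f g h : E f -> E g -> E h -> q (a *: f + g) h = a * q f h + q g h.
Proof. by have [_ _ + _ _] := Eq; apply. Qed.

Lemma q_ge0 f : E f -> 0 <= q f f.
Proof. by have [_ _ _ + _] := Eq; apply. Qed.

Lemma q_eq0 f : E f -> q f f = 0 -> f = 0.
Proof. by have [_ _ _ _] := Eq; apply. Qed.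

Lemma qDl f g h : E f -> E g -> E h -> q (f + g) h = q f h + q g h.
Proof. by move=> Ef Eg Eh; rewrite -{1}[f]scale1r qDZl// mul1r. Qed.

Lemma q0l h : E h -> q 0 h = 0.
Proof. by move=> Eh; apply: (@addrI _ (q 0 h)); rewrite -qDl ?addr0//; exact: sub0. Qed.

Lemma qZl a f h : E f -> E h -> q (a *: f) h = a * q f h.
Proof. by move=> Ef Eh; rewrite -{1}[_ *: _]addr0 qDZl ?q0l ?addr0//; exact: sub0. Qed.

Lemma qBl f g h : E f -> E g -> E h -> q (f - g) h = q f h - q g h.
Proof.
by move=> Ef Eg Eh; rewrite addrC -scaleN1r qDZl// mulN1r addrC.
Qed.

Lemma q_suml n (F : nat -> V) h : (forall i, E (F i)) -> E h ->
  q (\sum_(i < n) F i) h = \sum_(i < n) q (F i) h.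
Proof.
move=> EF Eh; elim: n => [|n IH]; first by rewrite !big_ord0 q0l.
by rewrite !big_ord_recr qDl ?IH//; exact: sub_sum.
Qed.

Lemma qBr f g h : E f -> E g -> E h -> q h (f - g) = q h f - q h g.
Proof. by move=> Ef Eg Eh; rewrite qC ?qBl ?(qC Eh)//; exact: subB. Qed.

Lemma qDZr a f g h : E f -> E g -> E h -> q h (a *: f + g) = a * q h f + q h g.
Proof. by move=> Ef Eg Eh; rewrite qC ?qDZl ?(qC Eh)//; exact: subDZ. Qed.

Lemma q_sub_sym f g : E f -> E g -> q (f - g) (f - g) = q (g - f) (g - f).
Proof.
move=> Ef Eg; have Efg := subB Ef Eg; have Egf := subB Eg Ef.
rewrite (qBl Ef Eg Efg) (qBl Eg Ef Egf) (qBr Ef Eg Ef) (qBr Ef Eg Eg).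
by rewrite (qBr Eg Ef Ef) (qBr Eg Ef Eg); ring.
Qed.

Lemma qnorm_ge0 f : 0 <= qnorm q f. Proof. exact: sqrtr_ge0. Qed.

Lemma qnorm_sqr f : E f -> qnorm q f ^+ 2 = q f f.
Proof. by move=> Ef; rewrite sqr_sqrtr// q_ge0. Qed.

Lemma cauchy_schwarz f g : E f -> E g -> `|q f g| <= qnorm q f * qnorm q g.
Proof.
move=> Ef Eg; have [g0|g_neq0] := eqVneq (q g g) 0.
  by rewrite (q_eq0 Eg g0) (qC Ef sub0) q0l// normr0 mulr_ge0 ?qnorm_ge0.
have gg_gt0 : 0 < q g g by rewrite lt_def g_neq0 q_ge0.
have : 0 <= q (- (q f g / q g g) *: g + f) (- (q f g / q g g) *: g + f).
  by apply: q_ge0; exact: subDZ.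
rewrite qDZl ?qDZr//; [|exact: subDZ..].
rewrite (qC Eg Ef) => H.
have {}H : 0 <= q f f - q f g ^+ 2 / q g g.
  by move: H; congr (0 <= _); field; exact: g_neq0.
have {H} fg2 : q f g ^+ 2 <= q f f * q g g.
  by move: H; rewrite subr_ge0 ler_pdivrMr.
rewrite -(@ler_pXn2r _ 2) ?nnegrE ?mulr_ge0 ?qnorm_ge0//.
by rewrite real_normK ?num_real// exprMn !qnorm_sqr.
Qed.

Lemma q_cvg_pairing u l g : (forall n, E (u n)) -> E l -> E g -> q_cvg q u l ->
  q (u n) g @[n --> \oo] --> q l g.
Proof.
move=> Eu El Eg ul; apply/cvgrPdist_le => e e0.
have c0 : 0 < qnorm q g + 1 by rewrite ltr_wpDl ?qnorm_ge0.
have := ul; move/cvgrPdist_le => /(_ (e / (qnorm q g + 1))).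
rewrite divr_gt0// => /(_ isT); apply: filterS => n.
rewrite sub0r normrN ger0_norm ?qnorm_ge0// => une.
rewrite distrC -qBl// (le_trans (cauchy_schwarz _ _))//; first exact: subB.
have := ler_wpM2r (qnorm_ge0 g) une => /le_trans; apply.
rewrite mulrAC ler_pdivrMr// ler_wpM2l ?ltW//.
by rewrite ltrDl.
Qed.

Lemma q_cvg_unique u l l' : (forall n, E (u n)) -> E l -> E l' ->
  q_cvg q u l -> q_cvg q u l' -> l = l'.
Proof.
move=> Eu El El' ul ul'.
have Ell : E (l - l') by exact: subB.
apply/eqP; rewrite -subr_eq0; apply/eqP; apply: q_eq0 => //.
rewrite qBl//; apply/eqP; rewrite subr_eq0; apply/eqP.
exact: (cvg_unique _ (q_cvg_pairing Eu El Ell ul) (q_cvg_pairing Eu El' Ell ul')).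
Qed.

(** * Coordinates on an orthonormal basis; the dual as a space of square-summable sequences *)

Section basis.
Context (I : set nat) (b : nat -> V).
Hypothesis b_basis : orthonormal_basis E q I b.

Lemma basis_sub n : E (b n). Proof. by have [+ _ _ _] := b_basis; apply. Qed.

Lemma basis_out n : ~ I n -> b n = 0. Proof. by have [_ _ + _] := b_basis; apply. Qed.

Lemma basis_q m n : q (b m) (b n) = ((m == n) && (n \in I))%:R.
Proof. by have [_ + _ _] := b_basis; apply. Qed.

Definition bsum (c : nat -> R) (N : nat) : V := \sum_(n < N) c n *: b n.

Lemma bsum_sub c N : E (bsum c N).
Proof. by apply: (@sub_sum _ (fun n => c n *: b n)) => i; apply: subZ; exact: basis_sub. Qed.

Lemma q_bsum c N f : E f -> q (bsum c N) f = \sum_(n < N) c n * q (b n) f.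
Proof.
move=> Ef; rewrite (@q_suml _ (fun n => c n *: b n))//; last first.
  by move=> i; apply: subZ; exact: basis_sub.
by apply: eq_bigr => i _; rewrite qZl//; exact: basis_sub.
Qed.

Lemma q_basis_bsum c N m : q (b m) (bsum c N) = if (m < N)%N && (m \in I) then c m else 0.
Proof.
have Eb := basis_sub.
rewrite (qC (Eb m) (bsum_sub c N)) q_bsum//.
under eq_bigr do rewrite basis_q.
case: (boolP (m \in I)) => mI; last first.
  by rewrite andbF big1// => i _; rewrite andbF mulr0.
rewrite andbT; case: ltnP => mN; last first.
  rewrite big1// => i _; rewrite (_ : (_ == m) = false) ?mulr0//.
  by apply/negbTE; rewrite neq_ltn (leq_trans (ltn_ord i) mN).
rewrite (bigD1 (Ordinal mN))//= eqxx mulr1 big1 ?addr0// => i im.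
by rewrite (_ : (_ == m) = false) ?mulr0//; apply/negbTE.
Qed.

(** Equality can fail: a coefficient outside [I] multiplies the zero vector. *)
Lemma q_bsum_le c N : q (bsum c N) (bsum c N) <= \sum_(n < N) c n ^+ 2.
Proof.
rewrite q_bsum; last exact: bsum_sub.
apply: ler_sum => i _; rewrite q_basis_bsum ltn_ord/=; case: ifP => _.
  by rewrite expr2.
by rewrite mulr0 sqr_ge0.
Qed.

Lemma basis_cvg f : E f -> q_cvg q (bsum (fun n => q (b n) f)) f.
Proof. by have [_ _ _] := b_basis; exact. Qed.

Lemma q_parseval_partial f N : E f ->
  q (f - bsum (fun n => q (b n) f) N) (f - bsum (fun n => q (b n) f) N) =
  q f f - \sum_(n < N) q (b n) f ^+ 2.
Proof.
move=> Ef; set s := bsum _ N.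
have Es : E s by exact: bsum_sub.
have fs : q s f = \sum_(n < N) q (b n) f ^+ 2.
  by rewrite q_bsum//; apply: eq_bigr => i _; rewrite expr2.
have ss : q s s = q s f.
  rewrite q_bsum// q_bsum//; apply: eq_bigr => i _.
  rewrite q_basis_bsum ltn_ord/=; case: ifPn => // iI.
  by rewrite basis_out ?q0l ?mulr0// => /mem_set; apply/negP.
by rewrite qBl ?qBr ?(qC Ef Es) ?ss ?fs//; [ring|exact: subB].
Qed.

Lemma q_bessel f N : E f -> \sum_(n < N) q (b n) f ^+ 2 <= q f f.
Proof.
move=> Ef; rewrite -subr_ge0 -q_parseval_partial//; apply: q_ge0.
by apply: subB => //; exact: bsum_sub.
Qed.

Local Notation H := (dual E q).
Implicit Types y z : H.

Lemma pairing_DZ y a f g : E f -> E g ->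
  pairing y (a *: f + g) = a * pairing y f + pairing y g.
Proof. by have := dual_funP y; rewrite inE => -[+ _ _]; apply. Qed.

Lemma pairing0 y : pairing y 0 = 0.
Proof.
have := pairing_DZ y (-1) sub0 sub0.
by rewrite scaler0 addr0 mulN1r addNr.
Qed.

Lemma pairing_sum y n (F : nat -> V) : (forall i, E (F i)) ->
  pairing y (\sum_(i < n) F i) = \sum_(i < n) pairing y (F i).
Proof.
move=> EF; elim: n => [|n IH]; first by rewrite !big_ord0 pairing0.
rewrite !big_ord_recr/= addrC -{1}[F n]scale1r pairing_DZ//; last exact: sub_sum.
by rewrite mul1r IH addrC.
Qed.

Lemma pairingZ y a f : E f -> pairing y (a *: f) = a * pairing y f.
Proof. by move=> Ef; rewrite -[_ *: _]addr0 pairing_DZ ?pairing0 ?addr0//; exact: sub0. Qed.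

Lemma pairing_subr y f g : E f -> E g -> pairing y (f - g) = pairing y f - pairing y g.
Proof.
by move=> Ef Eg; rewrite [f - g]addrC -scaleN1r (pairing_DZ y _ Eg Ef) mulN1r addrC.
Qed.

Lemma pairing_subl y z f : pairing (y - z) f = pairing y f - pairing z f. Proof. by []. Qed.

Lemma pairing_le y f : E f -> `|pairing y f| <= `|y| * qnorm q f.
Proof. by have [_] := dual_norm_bound y; exact. Qed.

Lemma pairing_basis_out y n : ~ I n -> pairing y (b n) = 0.
Proof. by move=> nI; rewrite basis_out// pairing0. Qed.

Lemma pairing_bsum y c N : pairing y (bsum c N) = \sum_(n < N) c n * pairing y (b n).
Proof.
rewrite (@pairing_sum _ _ (fun n => c n *: b n)); last first.
  by move=> i; apply: subZ; exact: basis_sub.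
by apply: eq_bigr => i _; rewrite pairingZ//; exact: basis_sub.
Qed.

Lemma cvg_pairing y f : E f ->
  \sum_(n < N) q (b n) f * pairing y (b n) @[N --> \oo] --> pairing y f.
Proof.
move=> Ef; have -> : (fun N => \sum_(n < N) q (b n) f * pairing y (b n)) =
    (fun N => pairing y (bsum (fun n => q (b n) f) N)).
  by apply/funext => N; rewrite pairing_bsum.
apply/cvgrPdist_le => e e0.
have c0 : 0 < `|y| + 1 by rewrite ltr_wpDl.
have := basis_cvg Ef; move/cvgrPdist_le => /(_ (e / (`|y| + 1))).
rewrite divr_gt0// => /(_ isT); apply: filterS => n.
rewrite sub0r normrN ger0_norm ?qnorm_ge0// => une.
have Es := bsum_sub (fun n => q (b n) f) n.
rewrite distrC (_ : _ - _ = pairing y (bsum (fun n => q (b n) f) n - f)); last first.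
  by rewrite pairing_subr.
rewrite (le_trans (pairing_le _ _))//; first exact: subB.
have := ler_wpM2l (normr_ge0 y) une => /le_trans; apply.
by rewrite mulrCA -[leRHS]mulr1 ler_wpM2l ?ltW// ltr_pdivrMr// mul1r ltrDl.
Qed.

(** Testing [y] on the vector whose coefficients are the [pairing y (b n)] gives
    [s <= |y| * Num.sqrt s] for the sum [s]. *)
Lemma dual_bessel y N : \sum_(n < N) pairing y (b n) ^+ 2 <= `|y| ^+ 2.
Proof.
set s := \sum_(n < N) _; have s0 : 0 <= s by apply: sumr_ge0 => i _; exact: sqr_ge0.
have := pairing_le y (bsum_sub (fun n => pairing y (b n)) N).
rewrite pairing_bsum; under eq_bigr do rewrite -expr2.
rewrite -/s ger0_norm// => H.
have {}H : s <= `|y| * Num.sqrt s.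
  by rewrite (le_trans H)// ler_wpM2l// ler_wsqrtr// q_bsum_le.
have [->|s_neq0] := eqVneq s 0; first exact: sqr_ge0.
have ss : 0 < Num.sqrt s by rewrite sqrtr_gt0 lt_def s_neq0.
rewrite -[leLHS]sqr_sqrtr// ler_pXn2r ?nnegrE ?sqrtr_ge0 ?normr_ge0//.
by rewrite -(ler_pM2r ss) -expr2 sqr_sqrtr.
Qed.

Lemma pairing_partial_le (y : nat -> R) M N f : E f -> 0 <= M ->
  \sum_(n < N) y n ^+ 2 <= M ^+ 2 ->
  `|\sum_(n < N) q (b n) f * y n| <= M * qnorm q f.
Proof.
move=> Ef M0 yM; under eq_bigr do rewrite mulrC.
rewrite -q_bsum// (le_trans (cauchy_schwarz (bsum_sub _ _) Ef))//.
rewrite ler_wpM2r ?qnorm_ge0// -[leRHS](ger0_norm M0) -sqrtr_sqr.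
by apply: ler_wsqrtr; rewrite (le_trans (q_bsum_le _ _)).
Qed.

(** Together with [dual_bessel], this makes the norm of the dual the l2 norm of the coordinates on
    [b]. *)
Lemma dual_norm_le_sum y M : 0 <= M ->
  (forall N, \sum_(n < N) pairing y (b n) ^+ 2 <= M ^+ 2) -> `|y| <= M.
Proof.
move=> M0 yM; apply: dual_norm_le; split => // f Ef.
have c : `|\sum_(n < N) q (b n) f * pairing y (b n)| @[N --> \oo] --> `|pairing y f|.
  by apply: cvg_norm; exact: cvg_pairing.
apply: (ler_cvg_to c (cvg_cst (M * qnorm q f))); apply: nearW => N.
exact: (@pairing_partial_le (fun n => pairing y (b n)) M N f Ef M0 (yM N)).
Qed.

Lemma cvg_coefficients (c : nat -> R) M f : E f ->
  (forall N, \sum_(n < N) c n ^+ 2 <= M) ->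
  cvgn (fun N => \sum_(n < N) q (b n) f * c n).
Proof.
move=> Ef cM.
have -> : (fun N => \sum_(n < N) q (b n) f * c n) = series (fun n => q (b n) f * c n).
  by apply/funext => N; rewrite /series/= big_mkord.
apply: normed_cvg; apply: nondecreasing_is_cvgn.
  by apply/nondecreasing_seqP => n; rewrite [leRHS]/series/= big_nat_recr//= lerDl.
exists (q f f + M) => _ [N _ <-].
rewrite [_ N]/series/= big_mkord.
apply: (le_trans _ (lerD (q_bessel N Ef) (cM N))).
rewrite -big_split/=; apply: ler_sum => i _.
rewrite normrM -(real_normK (num_real (q _ _))) -(real_normK (num_real (c i))).
have := sqr_ge0 (`|q (b i) f| - `|c i|).
have := normr_ge0 (q (b i) f); have := normr_ge0 (c i); nra.
Qed.

Definition coefficient_fun (c : nat -> R) (f : V) : R^o :=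
  if asbool (E f) then limn (fun N => \sum_(n < N) q (b n) f * c n) else 0.

Lemma coefficient_fun_bounded (c : nat -> R) M : 0 <= M ->
  (forall N, \sum_(n < N) c n ^+ 2 <= M ^+ 2) ->
  coefficient_fun c \in bounded_functional E q.
Proof.
move=> M0 cM; rewrite inE; split.
- move=> a f g Ef Eg; rewrite /coefficient_fun !asboolT//; last exact: subDZ.
  have cf := cvg_coefficients Ef cM; have cg := cvg_coefficients Eg cM.
  apply/cvg_lim => //.
  have -> : (fun N => \sum_(n < N) q (b n) (a *: f + g) * c n) =
      (fun N => a * (\sum_(n < N) q (b n) f * c n) + \sum_(n < N) q (b n) g * c n).
    apply/funext => N; rewrite mulr_sumr -big_split/=; apply: eq_bigr => i _.
    by rewrite qDZr//; [ring|exact: basis_sub].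
  by apply: cvgD => //; apply: cvgM => //; exact: cvg_cst.
- exists M; split => // f Ef; rewrite /coefficient_fun asboolT//.
  have cf := cvg_norm (cvg_coefficients Ef cM).
  apply: (ler_cvg_to (cf _) (cvg_cst (M * qnorm q f))); apply: nearW => N.
  exact: pairing_partial_le.
- by move=> f nEf; rewrite /coefficient_fun asboolF.
Qed.

(** The restriction to [I] is forced: any functional vanishes on the zero vectors [b n] outside
    [I]. *)
Lemma dual_of_coefficients (c : nat -> R) M : 0 <= M ->
  (forall N, \sum_(n < N) c n ^+ 2 <= M ^+ 2) ->
  exists y : H, forall n, I n -> pairing y (b n) = c n.
Proof.
move=> M0 cM; exists (Dual (coefficient_fun_bounded M0 cM)) => m Im.
rewrite /pairing/= /coefficient_fun asboolT; last exact: basis_sub.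
apply/cvg_lim => //; apply: cvg_near_cst.
near=> N; have mN : (m < N)%N by near: N; exact: nbhs_infty_gt.
rewrite (bigD1 (Ordinal mN))//= basis_q eqxx mem_set// mul1r big1 ?addr0// => i im.
by rewrite basis_q (_ : (_ == m) = false) ?mul0r//; apply/negbTE.
Unshelve. all: by end_near. Qed.


Lemma pairing_continuous f : E f -> continuous (fun y : H => pairing y f).
Proof.
move=> Ef y; have F := nbhs_filter y.
apply/(@cvgrPdist_le _ _ _ (nbhs y) F) => e e0.
have c0 : 0 < qnorm q f + 1 by rewrite ltr_wpDl ?qnorm_ge0.
near=> z; rewrite -pairing_subl (le_trans (pairing_le _ Ef))//.
have : `|y - z| <= e / (qnorm q f + 1).
  near: z; apply: cvgr_dist_le; first exact: cvg_id.
  by rewrite divr_gt0.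
rewrite ler_pdivlMr// => /(le_trans _); apply.
by rewrite ler_wpM2l// lerDl.
Unshelve. all: by end_near. Qed.

Lemma measurable_pairing f : E f ->
  measurable_fun setT (fun y : borel H => pairing y f).
Proof.
move=> Ef; apply: (measurability _ (RGenOpens.measurableE R)) => //.
move=> _ [_ [a [c ->] <-]]; rewrite setTI.
apply: sub_sigma_algebra.
by apply: open_comp; [move=> y _; exact: pairing_continuous|exact: interval_open].
Qed.

(** These elements have finitely many nonzero coordinates, all rational. They are dense, and
    indexing them by [seq rat] makes them countable. *)
Definition rational_dual (s : seq rat) : H :=
  xget 0 [set y | forall n, I n -> pairing y (b n) = ratr (nth 0 s n)].

Lemma rational_dualE s n : I n -> pairing (rational_dual s) (b n) = ratr (nth 0 s n).
Proof.
move: n; rewrite /rational_dual; case: xgetP => [y -> //|nex].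
exfalso; pose c n : R := ratr (nth 0 s n).
pose M := \sum_(n < size s) c n ^+ 2.
have M0 : 0 <= M by apply: sumr_ge0 => i _; exact: sqr_ge0.
have cM N : \sum_(n < N) c n ^+ 2 <= Num.sqrt M ^+ 2.
  rewrite sqr_sqrtr//; have [Ns|sN] := leqP N (size s).
    rewrite /M -!(big_mkord predT (fun n => c n ^+ 2)) (big_cat_nat (leq0n _) Ns)//= lerDl.
    by apply: sumr_ge0 => i _; exact: sqr_ge0.
  rewrite /M -!(big_mkord predT (fun n => c n ^+ 2)) (big_cat_nat (leq0n _) (ltnW sN))//=.
  rewrite gerDl big_nat_cond big1// => i /andP[/andP[si _] _].
  by rewrite /c nth_default// rmorph0 expr0n.
have [y yc] := dual_of_coefficients (sqrtr_ge0 M) cM.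
exact: (nex y yc).
Qed.

(** Half of [e ^+ 2] pays for the tail of the coordinates of [y], the other half for the rounding of
    the first [N] of them. *)
Lemma rational_dual_dense (y : H) (e : R) : 0 < e -> exists s, `|y - rational_dual s| <= e.
Proof.
move=> e0; pose u N := \sum_(n < N) pairing y (b n) ^+ 2.
have cu : cvgn u.
  apply: nondecreasing_is_cvgn.
    by apply/nondecreasing_seqP => n; rewrite /u big_ord_recr/= lerDl sqr_ge0.
  by exists (`|y| ^+ 2) => _ [N _ <-]; exact: dual_bessel.
have ule N : u N <= limn u.
  apply: nondecreasing_cvgn_le => //.
  by apply/nondecreasing_seqP => n; rewrite /u big_ord_recr/= lerDl sqr_ge0.
have e2 : 0 < e ^+ 2 / 2 by rewrite divr_gt0// exprn_gt0.
have [N uN] : exists N, limn u - e ^+ 2 / 2 <= u N.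
  have /cvgrPdist_le/(_ _ e2)[N _ /(_ N (leqnn N))] := cu.
  by rewrite ler_norml => /andP[_ H]; exists N; move: H; rewrite /=; lra.
(* The error allowed on each squared coordinate; [N.+1] in place of [N] keeps it positive when
   [N = 0]. *)
pose d := e ^+ 2 / 2 / N.+1%:R.
have d0 : 0 < d by rewrite divr_gt0.
have /choice[r yr] : forall n, exists r : rat, (pairing y (b n) - ratr r) ^+ 2 <= d.
  move=> n.
  have [r /itvP rd] : exists r : rat, ratr r \in `]pairing y (b n), (pairing y (b n) + Num.sqrt d)[.
    by apply: rat_in_itvoo; rewrite ltrDl sqrtr_gt0.
  exists r; rewrite -sqrrN -[leRHS]sqr_sqrtr ?(ltW d0)// ler_pXn2r ?nnegrE ?sqrtr_ge0//.
    by rewrite opprB lerBlDl rd.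
  by rewrite oppr_ge0 subr_le0 rd.
pose s := mkseq r N.
exists s; apply: dual_norm_le_sum; first exact: ltW.
have term n : (pairing (y - rational_dual s) (b n)) ^+ 2 <=
    if (n < N)%N then d else pairing y (b n) ^+ 2.
  have [In|nIn] := pselect (I n).
    rewrite pairing_subl rational_dualE//; case: ltnP => nN.
      by rewrite nth_mkseq.
    by rewrite nth_default ?size_mkseq// rmorph0 subr0.
  rewrite pairing_basis_out// expr0n/=; case: ifP => _; first exact: ltW.
  exact: sqr_ge0.
move=> M; pose M' := maxn M N.
have MM' : (M <= M')%N by rewrite leq_maxl.
have NM' : (N <= M')%N by rewrite leq_maxr.
apply: (@le_trans _ _ (\sum_(n < M') pairing (y - rational_dual s) (b n) ^+ 2)).
  rewrite -!(big_mkord predT (fun n => pairing (y - rational_dual s) (b n) ^+ 2)).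
  rewrite [leRHS](big_cat_nat (leq0n _) MM')//= lerDl.
  by apply: sumr_ge0 => i _; exact: sqr_ge0.
apply: (le_trans (ler_sum _ (fun (i : 'I_M') _ => term i))).
rewrite -(big_mkord predT (fun n => if (n < N)%N then d else pairing y (b n) ^+ 2)).
rewrite (big_cat_nat (leq0n _) NM')//=.
have -> : \sum_(0 <= i < N) (if (i < N)%N then d else pairing y (b i) ^+ 2) = N%:R * d.
  rewrite big_nat_cond (eq_bigr (fun=> d)); last by move=> i /andP[/andP[_ ->]].
  by rewrite -big_nat_cond big_const_nat subn0 iter_addr_0 mulr_natl.
have -> : \sum_(N <= i < M') (if (i < N)%N then d else pairing y (b i) ^+ 2) = u M' - u N.
  rewrite /u -!(big_mkord predT (fun n => pairing y (b n) ^+ 2)) (big_cat_nat (leq0n _) NM')//=.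
  rewrite addrAC subrr add0r big_nat_cond [RHS]big_nat_cond.
  by apply: eq_bigr => i /andP[/andP[Ni _] _]; rewrite ltnNge Ni.
have : N%:R * d <= e ^+ 2 / 2.
  rewrite /d mulrCA -[leRHS]mulr1 ler_wpM2l ?(ltW e2)//.
  by rewrite ler_pdivrMr// mul1r ler_nat.
have := ule M'; lra.
Qed.

Definition coordinate_sets : set (set (borel H)) :=
  [set A | exists n, exists2 U : set R, measurable U & A = (fun y => pairing y (b n)) @^-1` U].

(** The norm being the l2 norm of the coordinates, a closed ball is a countable intersection of
    conditions on finitely many coordinates. *)
Lemma coordinate_closed_ball (x : H) (r : R) : 0 <= r ->
  <<s coordinate_sets >> [set y : borel H | `|(y : H) - x| <= r].
Proof.
move=> r0; pose C : measurableType _ := g_sigma_algebraType coordinate_sets.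
have mb n : measurable_fun setT (fun y : C => pairing (y : H) (b n)).
  move=> _ U mU; rewrite setTI; apply: sub_sigma_algebra.
  by exists n, U.
have -> : [set y : borel H | `|(y : H) - x| <= r] =
    \bigcap_N [set y : C | \sum_(n < N) pairing ((y : H) - x) (b n) ^+ 2 <= r ^+ 2].
  apply/seteqP; split => [y yr N _|y yr /=].
    by apply: (le_trans (dual_bessel ((y : H) - x) N)); rewrite ler_pXn2r ?nnegrE.
  by apply: dual_norm_le_sum => // N; exact: yr.
have mN N : measurable [set y : C | \sum_(n < N) pairing ((y : H) - x) (b n) ^+ 2 <= r ^+ 2].
  have mf : measurable_fun setT (fun y : C => \sum_(n < N) pairing ((y : H) - x) (b n) ^+ 2).
    apply: measurable_sum => i; apply: measurable_funX.
    by apply: measurable_funB => //; exact: mb.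
  rewrite -[X in measurable X]setTI.
  have -> : [set y : C | \sum_(n < N) pairing ((y : H) - x) (b n) ^+ 2 <= r ^+ 2] =
      (fun y : C => \sum_(n < N) pairing ((y : H) - x) (b n) ^+ 2) @^-1` `]-oo, r ^+ 2].
    by apply/seteqP; split => y /=; rewrite in_itv.
  by apply: mf => //; exact: measurable_itv.
have : measurable (\bigcap_N [set y : C | \sum_(n < N) pairing ((y : H) - x) (b n) ^+ 2 <= r ^+ 2]).
  exact: bigcapT_measurable.
by [].
Qed.

(** By separability, an open set is the countable union of the closed balls it contains whose
    centres are some [rational_dual s] and whose radii are inverses of integers. The sets [B i]
    enumerate these, with [set0] for a ball that is not contained in [U]. *)
Lemma borel_dual_coordinates (U : set (borel H)) : measurable U -> <<s coordinate_sets >> U.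
Proof.
move: U; apply: smallest_sub; first exact: smallest_sigma_algebra.
move=> U oU; pose C : measurableType _ := g_sigma_algebraType coordinate_sets.
pose B (i : seq rat * nat) : set H :=
  if `[< forall y : H, `|y - rational_dual i.1| <= i.2.+1%:R^-1 -> U y >]
  then [set y | `|y - rational_dual i.1| <= i.2.+1%:R^-1] else set0.
have UE : U = \bigcup_i B i.
  apply/seteqP; split => [y Uy|y [i _]]; last first.
    by rewrite /B; case: asboolP => // Bi; exact: Bi.
  have /nbhs_ballP[e /= e0 eU] := open_nbhs_nbhs (conj oU Uy).
  have [k _ /(_ k (leqnn k)) ke] : \forall k \near \oo, k.+1%:R^-1 < e / 2.
    by apply: (near_infty_natSinv_lt (PosNum (divr_gt0 e0 (ltr0n _ 2)))).
  have k0 : 0 < k.+1%:R^-1 :> R by rewrite invr_gt0.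
  have [s ys] := rational_dual_dense y k0.
  exists (s, k) => //; rewrite /B/= asboolT// => z zs.
  apply: eU; rewrite -ball_normE/=.
  rewrite (_ : y - z = (y - rational_dual s) - (z - rational_dual s)); last first.
    by rewrite opprB addrA subrK.
  rewrite (le_lt_trans (ler_normB _ _))// (le_lt_trans (lerD ys zs))//.
  by rewrite [ltRHS](splitr e) ltrD.
rewrite UE.
have : measurable (\bigcup_i B i : set C).
  apply: countable_bigcupT_measurable => // i.
  rewrite /B; case: ifP => _; last exact: measurable0.
  by apply: coordinate_closed_ball; rewrite invr_ge0.
by [].
Qed.

Lemma measurable_dual d (T : measurableType d) (Y : T -> borel H) :
  (forall n, measurable_fun setT (fun w => pairing (Y w) (b n))) -> measurable_fun setT Y.
Proof.
move=> mY _ U mU; rewrite setTI.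
have [s0 sC sU] : sigma_algebra setT [set A : set (borel H) | measurable (Y @^-1` A)].
  split => /=; first by rewrite preimage_set0.
  - by move=> A mA; rewrite setTD preimage_setC; exact: measurableC.
  - by move=> A mA; rewrite preimage_bigcup; exact: bigcupT_measurable.
have := borel_dual_coordinates mU; move: U {mU}; apply: smallest_sub; first by split.
move=> _ [n [U mU ->]] /=.
by have := mY n measurableT U mU; rewrite setTI.
Qed.

End basis.
End inner_product.

(** * Dyadic approximation of paths *)

Section dyadic_steps.
Context (R : realType).
Implicit Types (x : R -> R) (s t a g : R).

Let int_consecutive (m l : int) : m - 1 < l -> l < m + 2 -> l = m \/ l = m + 1.
Proof. lia. Qed.

Definition dyadic_floor (k : nat) (t : R) : int := Num.floor (2 ^+ k * t).

Definition dyadic_step (k : nat) (t : R) : R := (dyadic_floor k t)%:~R / 2 ^+ k.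

Lemma dyadic_floor_itv k t :
  (dyadic_floor k t)%:~R <= 2 ^+ k * t < (dyadic_floor k t)%:~R + (1 : R).
Proof. by have := floor_itv (2 ^+ k * t); rewrite rmorphD. Qed.

Lemma dyadic_floorS k t :
  dyadic_floor k.+1 t = 2 * dyadic_floor k t \/ dyadic_floor k.+1 t = 2 * dyadic_floor k t + 1.
Proof.
have /andP[a1 a2] := dyadic_floor_itv k t; have /andP[b1 b2] := dyadic_floor_itv k.+1 t.
move: a1 a2 b1 b2; rewrite exprS -mulrA.
set m := dyadic_floor k t; set l := dyadic_floor k.+1 t => a1 a2 b1 b2.
have l1 : (2 * m - 1 < l)%R.
  rewrite -(ltr_int R) rmorphB rmorphM/=; lra.
have l2 : (l < 2 * m + 2)%R.
  rewrite -(ltr_int R) rmorphD rmorphM/=; lra.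
lia.
Qed.

Lemma dyadic_step_itv k t : dyadic_step k t <= t < dyadic_step k t + 2 ^- k.
Proof.
have p : 0 < 2 ^+ k :> R by rewrite exprn_gt0.
have /andP[a1 a2] := dyadic_floor_itv k t.
rewrite /dyadic_step -[X in _ < _ + X]mul1r -mulrDl.
by rewrite ler_pdivrMr// ltr_pdivlMr// mulrC a1.
Qed.

Lemma dyadic_floor_bounds k (N : nat) t : - N%:R <= t < N%:R ->
  - (N * 2 ^ k)%:Z <= dyadic_floor k t < (N * 2 ^ k)%:Z.
Proof.
move=> /andP[Nt tN]; have p : 0 < 2 ^+ k :> R by rewrite exprn_gt0.
have NE : (N * 2 ^ k)%:Z%:~R = 2 ^+ k * N%:R :> R.
  by rewrite -pmulrn natrM natrX mulrC.
apply/andP; split.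
  by rewrite floor_ge_int rmorphN/= NE -mulrN ler_pM2l.
by rewrite -(ltr_int R) (le_lt_trans (floor_le _))// NE ltr_pM2l.
Qed.

Section modulus.
Variables (x : R -> R) (a g : R) (N : nat).
Hypothesis a0 : 0 < a.
Hypothesis a1 : a < 1.
Hypothesis g0 : 0 <= g.
Hypothesis x_inc : forall k (j : int), - (N * 2 ^ k)%:Z <= j < (N * 2 ^ k)%:Z ->
  `|x ((j%:~R + 1) / 2 ^+ k) - x (j%:~R / 2 ^+ k)| <= g * a ^+ k.

Let c := (1 - a)^-1.

Let c_gt0 : 0 < c. Proof. by rewrite invr_gt0 subr_gt0. Qed.

(** Refining the level either leaves the dyadic approximation of [t] in place or moves it by one
    interval of level [k.+1]. *)
Lemma dyadic_step_next k t : - N%:R <= t < N%:R ->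
  `|x (dyadic_step k.+1 t) - x (dyadic_step k t)| <= g * a ^+ k.+1.
Proof.
move=> tN; have := dyadic_floor_bounds k tN; rewrite /dyadic_step.
set m := dyadic_floor k t => mb.
have p : 2 ^+ k != 0 :> R by rewrite expf_neq0.
have mE : m%:~R / 2 ^+ k = (2 * m)%:~R / 2 ^+ k.+1 :> R.
  by rewrite rmorphM/= exprS; field.
have mb' : - (N * 2 ^ k.+1)%:Z <= 2 * m < (N * 2 ^ k.+1)%:Z.
  by rewrite expnS; move: mb; set q := (2 ^ k)%N; lia.
have ga : 0 <= g * a ^+ k.+1 by rewrite mulr_ge0// exprn_ge0// ltW.
have [->|->] := dyadic_floorS k t; first by rewrite -/m -mE subrr normr0.
by rewrite -/m mE rmorphD/=; exact: x_inc.
Qed.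

(** The geometric sum is kept in the telescoped form [a ^+ k - a ^+ l]: it makes
    [x (dyadic_step k t) + g * c * a ^+ k] nonincreasing in [k], from which convergence follows. *)
Lemma dyadic_step_dist k l t : - N%:R <= t < N%:R -> (k <= l)%N ->
  `|x (dyadic_step l t) - x (dyadic_step k t)| <= g * c * (a ^+ k - a ^+ l).
Proof.
move=> tN kl; rewrite -(subnKC kl); elim: (l - k)%N => [|n IH].
  by rewrite addn0 !subrr normr0 mulr0.
rewrite addnS; set j := (k + n)%N in IH *.
have -> : x (dyadic_step j.+1 t) - x (dyadic_step k t) =
    (x (dyadic_step j.+1 t) - x (dyadic_step j t)) + (x (dyadic_step j t) - x (dyadic_step k t)).
  by ring.
rewrite (le_trans (ler_normD _ _))//.
rewrite (le_trans (lerD (dyadic_step_next j tN) IH))//.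
have -> : g * c * (a ^+ k - a ^+ j.+1) = g * (c * (1 - a)) * a ^+ j + g * c * (a ^+ k - a ^+ j).
  by rewrite exprS; ring.
rewrite lerD2r mulVf ?mulr1; last by rewrite gt_eqF// subr_gt0.
rewrite ler_wpM2l// exprS ler_piMl ?exprn_ge0//; exact: ltW.
Qed.

Let dist_le k l t : - N%:R <= t < N%:R -> (k <= l)%N ->
  `|x (dyadic_step l t) - x (dyadic_step k t)| <= g * c * a ^+ k.
Proof.
move=> tN kl; rewrite (le_trans (dyadic_step_dist tN kl))//.
by rewrite ler_wpM2l ?mulr_ge0 ?(ltW c_gt0)// gerBl exprn_ge0//; exact: ltW.
Qed.

Lemma dyadic_step_cvgn t : - N%:R <= t < N%:R -> cvgn (fun k => x (dyadic_step k t)).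
Proof.
move=> tN; pose u k := x (dyadic_step k t) + g * c * a ^+ k.
have -> : (fun k => x (dyadic_step k t)) = (fun k => u k - g * c * a ^+ k).
  by apply/funext => k; rewrite /u addrK.
apply: is_cvgB.
  apply: nonincreasing_is_cvgn.
    apply/nonincreasing_seqP => k; have := dyadic_step_dist tN (leqnSn k).
    rewrite ler_norml => /andP[_]; rewrite /u mulrBr; lra.
  exists (x (dyadic_step 0 t) - g * c) => _ [k _ <-].
  have := dist_le tN (leq0n k); rewrite expr0 mulr1 ler_norml => /andP[+ _].
  have : 0 <= g * c * a ^+ k by rewrite !mulr_ge0 ?exprn_ge0 ?(ltW a0) ?(ltW c_gt0).
  rewrite /u; lra.
apply: is_cvgM; first exact: is_cvg_cst.
apply/cvg_ex; exists 0; apply: cvg_expr; by rewrite gtr0_norm.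
Qed.

Lemma dyadic_limit_dist k t : - N%:R <= t < N%:R ->
  `|limn (fun k => x (dyadic_step k t)) - x (dyadic_step k t)| <= g * c * a ^+ k.
Proof.
move=> tN; have cx := dyadic_step_cvgn tN.
have cx' : `|x (dyadic_step l t) - x (dyadic_step k t)| @[l --> \oo] -->
    `|limn (fun k => x (dyadic_step k t)) - x (dyadic_step k t)|.
  by apply: cvg_norm; apply: cvgB => //; exact: cvg_cst.
apply: (ler_cvg_to cx' (cvg_cst (g * c * a ^+ k))).
near=> l; apply: dist_le => //; near: l; exact: nbhs_infty_ge.
Unshelve. all: by end_near. Qed.

(** At distance less than [2 ^- k], the approximations of level [k] coincide or are neighbours. The
    constant [2 * c + 1] counts the two tails beyond level [k] and the one increment between
    them. *)
Lemma dyadic_limit_modulus k s t : - N%:R <= s < N%:R -> - N%:R <= t < N%:R ->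
  `|t - s| < 2 ^- k ->
  `|limn (fun k => x (dyadic_step k t)) - limn (fun k => x (dyadic_step k s))| <=
  (2 * c + 1) * g * a ^+ k.
Proof.
wlog st : s t / s <= t.
  move=> H sN tN; have [st|/ltW ts] := leP s t; first exact: H.
  by rewrite distrC [leLHS]distrC; exact: H.
move=> sN tN; rewrite ger0_norm ?subr_ge0// => tsk.
have p : 0 < 2 ^+ k :> R by rewrite exprn_gt0.
have step : `|x (dyadic_step k t) - x (dyadic_step k s)| <= g * a ^+ k.
  have ga : 0 <= g * a ^+ k by rewrite mulr_ge0// exprn_ge0// ltW.
  have /andP[s1 s2] := dyadic_floor_itv k s; have /andP[t1 t2] := dyadic_floor_itv k t.
  have sb := dyadic_floor_bounds k sN.
  rewrite /dyadic_step; move: s1 s2 t1 t2 sb.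
  set m := dyadic_floor k s; set l := dyadic_floor k t => s1 s2 t1 t2 sb.
  have ml : 2 ^+ k * s <= 2 ^+ k * t by rewrite ler_pM2l.
  have lm : 2 ^+ k * t < 2 ^+ k * s + 1.
    by rewrite -ltrBlDl -mulrBr mulrC -ltr_pdivlMr// mul1r.
  have l1 : m - 1 < l by rewrite -(ltr_int R) rmorphB/=; lra.
  have l2 : l < m + 2 by rewrite -(ltr_int R) rmorphD/=; lra.
  have [->|->] : l = m \/ l = m + 1 by exact: int_consecutive.
    by rewrite subrr normr0.
  by rewrite rmorphD/=; exact: x_inc.
have dt := dyadic_limit_dist k tN; have ds := dyadic_limit_dist k sN.
move: dt ds step; set zt := limn _; set zs := limn _.
set xt := x (dyadic_step k t); set xs := x (dyadic_step k s) => dt ds step.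
have -> : zt - zs = (zt - xt) + (xt - xs) - (zs - xs) by ring.
rewrite (le_trans (ler_normB _ _))// (le_trans (lerD (ler_normD _ _) (lexx _)))//.
rewrite (le_trans (lerD (lerD dt step) ds))//.
by rewrite le_eqVlt; apply/orP; left; apply/eqP; ring.
Qed.

End modulus.
End dyadic_steps.

(** * Continuous versions of a sequence of processes *)

Section almost_everywhere.
Context (R : realType) d (T : measurableType d) (P : probability T R).

Lemma ge0_integral_lty_ae (f : T -> \bar R) : measurable_fun setT f ->
  (forall w, (0 <= f w)%E) -> (\int[P]_w f w < +oo)%E -> \forall w \ae P, (f w < +oo)%E.
Proof.
move=> mf f0 fy; have intf : P.-integrable setT f.
  by apply/integrableP; split => //; under eq_integral do rewrite gee0_abs//.
apply: filterS (integrable_ae measurableT intf) => w /(_ I).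
by rewrite ge0_fin_numE.
Qed.

(** By Fatou's lemma, the integral of [(W - V) ^+ 2] is at most the limit of those of
    [(U n - V) ^+ 2], which is 0. *)
Lemma cvg_L2_ae_eq (U : nat -> T -> R) (V W : T -> R) :
  (forall n, measurable_fun setT (U n)) -> measurable_fun setT V -> measurable_fun setT W ->
  (forall w, U n w @[n --> \oo] --> W w) ->
  (\int[P]_w ((U n w - V w) ^+ 2)%:E @[n --> \oo] --> 0)%E ->
  \forall w \ae P, W w = V w.
Proof.
move=> mU mV mW UW UV.
have m2 (f g : T -> R) : measurable_fun setT f -> measurable_fun setT g ->
    measurable_fun setT (fun w => ((f w - g w) ^+ 2)%:E).
  move=> mf mg; apply/measurable_EFinP; apply: measurable_funX.
  exact: measurable_funB.
have F := @fatou _ _ _ P _ measurableT (fun n w => ((U n w - V w) ^+ 2)%:E)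
  (fun n => m2 _ _ (mU n) mV) (fun n w _ => sqr_ge0 _).
have limE w : limn_einf (fun n => ((U n w - V w) ^+ 2)%:E) = ((W w - V w) ^+ 2)%:E.
  have : ((U n w - V w) ^+ 2)%:E @[n --> \oo] --> ((W w - V w) ^+ 2)%:E.
    apply: cvg_EFin; first exact: nearW.
    have c : U n w - V w @[n --> \oo] --> W w - V w.
      by apply: cvgB => //; exact: cvg_cst.
    by under eq_fun do rewrite /= expr2; rewrite expr2; exact: cvgM.
  by move/cvg_limn_einf_sup => [].
have {F} : (\int[P]_w ((W w - V w) ^+ 2)%:E <= 0)%E.
  move: F; under eq_integral do rewrite limE.
  by have [-> _] := cvg_limn_einf_sup UV.
move=> H; have {}H : (\int[P]_w `|((W w - V w) ^+ 2)%:E| = 0)%E.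
  under eq_integral do rewrite gee0_abs ?lee_fin ?sqr_ge0//.
  apply/eqP; rewrite eq_le H/=; apply: integral_ge0 => w _.
  by rewrite lee_fin sqr_ge0.
have /(ae_eq_integral_abs _ measurableT (m2 _ _ mW mV)) := H.
apply: filterS => w /(_ I) /= [/eqP].
by rewrite sqrf_eq0 subr_eq0 => /eqP.
Qed.

End almost_everywhere.

Section geometric.
Context (R : realType).

Lemma nneseries_geometric_le (c r : R) : 0 <= c -> 0 <= r -> r < 1 ->
  (\sum_(0 <= k <oo) (c * r ^+ k)%:E <= (c / (1 - r))%:E)%E.
Proof.
move=> c0 r0 r1; apply: lime_le.
  by apply: is_cvg_nneseries => n _ _; rewrite lee_fin mulr_ge0// exprn_ge0.
apply: nearW => n; rewrite sumEFin lee_fin big_mkord.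
rewrite ler_pdivlMr ?subr_gt0//.
have -> : (\sum_(i < n) c * r ^+ i) * (1 - r) = c - c * r ^+ n.
  elim: n => [|n IH]; first by rewrite big_ord0 mul0r expr0 mulr1 subrr.
  by rewrite big_ord_recr/= mulrDl IH exprS; ring.
by rewrite gerBl mulr_ge0// exprn_ge0.
Qed.

End geometric.

Section kolmogorov.
Context (R : realType) d (T : measurableType d) (P : probability T R).
Variables (X : nat -> R -> T -> R) (lambda : nat -> R) (Lambda K : R).
Hypothesis mX : forall n t, measurable_fun setT (X n t).
Hypothesis K0 : 0 <= K.
Hypothesis X2 : forall n t, (\int[P]_w (X n t w ^+ 2)%:E <= K%:E)%E.
Hypothesis Xinc2 : forall n s t,
  (\int[P]_w ((X n t w - X n s w) ^+ 2)%:E <= (K * `|t - s|)%:E)%E.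
Hypothesis Xinc4 : forall n s t,
  (\int[P]_w ((X n t w - X n s w) ^+ 4)%:E <= (K * (t - s) ^+ 2)%:E)%E.
Hypothesis lambda_gt0 : forall n, 0 < lambda n.
Hypothesis lambda_le : forall N, \sum_(n < N) lambda n ^+ 2 <= Lambda.

(** Any value with [1 / 2 < a ^+ 4 < 1] would do; here [a ^+ 4] is about 0.656. *)
Let a : R := 9 / 10.
Let a0 : 0 < a. Proof. by rewrite /a; lra. Qed.
Let a1 : a < 1. Proof. by rewrite /a; lra. Qed.

(** Numbers the dyadic intervals of level [k] between [- N] and [N] by the naturals below
    [2 * (N * 2 ^ k)]. *)
Let j_of (N k i : nat) : int := i%:Z - (N * 2 ^ k)%:Z.

Definition level_energy n N k w : R := \sum_(i < 2 * (N * 2 ^ k))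
  (X n (((j_of N k i)%:~R + 1) / 2 ^+ k) w - X n ((j_of N k i)%:~R / 2 ^+ k) w) ^+ 4.

(* The weights [a ^- (4 * k)] grow more slowly than the expectations of the
   level energies decay, because [a ^+ 4 > 1 / 2]. *)
Definition energy n N w : \bar R :=
  (\sum_(0 <= k <oo) (a ^- (4 * k) * level_energy n N k w)%:E)%E.

Lemma level_energy_ge0 n N k w : 0 <= level_energy n N k w.
Proof. by apply: sumr_ge0 => i _; rewrite exprn_even_ge0. Qed.

Lemma measurable_level_energy n N k : measurable_fun setT (level_energy n N k).
Proof.
by apply: measurable_sum => i; apply: measurable_funX; exact: measurable_funB.
Qed.

Let a4k k : 0 < a ^- (4 * k). Proof. by rewrite invr_gt0 exprn_gt0. Qed.

Lemma energy_ge0 n N w : (0 <= energy n N w)%E.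
Proof.
apply: nneseries_ge0 => k _ _; rewrite lee_fin mulr_ge0 ?level_energy_ge0//.
exact: ltW.
Qed.

Lemma measurable_energy n N : measurable_fun setT (energy n N).
Proof.
apply: ge0_emeasurable_sum => [k w _ _|k _].
  by rewrite lee_fin mulr_ge0 ?level_energy_ge0// ltW.
apply/measurable_EFinP; apply: measurable_funM => //.
exact: measurable_level_energy.
Qed.

(** There are [2 * N * 2 ^ k] increments, each of fourth moment at most [K * 4 ^- k]. *)
Lemma integral_level_energy n N k :
  (\int[P]_w (level_energy n N k w)%:E <= (2 * N%:R * K * (2^-1) ^+ k)%:E)%E.
Proof.
rewrite /level_energy; under eq_integral do rewrite -sumEFin.
rewrite ge0_integral_sum//; last 2 first.
- by move=> i; apply/measurable_EFinP; apply: measurable_funX; exact: measurable_funB.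
- by move=> i w _; rewrite lee_fin exprn_even_ge0.
apply: (@le_trans _ _ (\sum_(i < 2 * (N * 2 ^ k)) (K * (2 ^- k) ^+ 2)%:E)%E).
  apply: lee_sum => i _; apply: (le_trans (Xinc4 _ _ _)).
  by rewrite -mulrBl addrAC subrr add0r mul1r.
rewrite sumEFin lee_fin sumr_const card_ord -[leLHS]mulr_natl !natrM natrX.
rewrite le_eqVlt; apply/orP; left; apply/eqP.
rewrite !exprVn; have : 2 ^+ k != 0 :> R by rewrite expf_neq0.
move: ((2 : R) ^+ k) => p p0; field.
exact: p0.
Qed.

Let ratio : R := a ^- 4 * 2^-1.
Let exprV4M (b h : R) k : (b ^- 4 * h) ^+ k = b ^- (4 * k) * h ^+ k.
Proof. by rewrite exprMn exprVn -exprM. Qed.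

Let ratio0 : 0 <= ratio. Proof. by rewrite mulr_ge0// invr_ge0 exprn_ge0// ltW. Qed.
Let ratio1 : ratio < 1.
Proof. by rewrite /ratio /a ltr_pdivrMr// mul1r -exprVn invf_div; lra. Qed.

Lemma integral_energy n N : (\int[P]_w energy n N w <= (2 * N%:R * K / (1 - ratio))%:E)%E.
Proof.
rewrite integral_nneseries//; last 2 first.
- move=> k; apply/measurable_EFinP; apply: measurable_funM => //.
  exact: measurable_level_energy.
- by move=> k w _; rewrite lee_fin mulr_ge0 ?level_energy_ge0// ltW.
apply: le_trans (nneseries_geometric_le _ ratio0 ratio1); last by rewrite !mulr_ge0.
apply: lee_nneseries => [k _ _|k _].
  by apply: integral_ge0 => w _; rewrite lee_fin mulr_ge0 ?level_energy_ge0// ltW.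
under eq_integral do rewrite EFinM.
rewrite ge0_integralZl//; last 3 first.
- by apply/measurable_EFinP; exact: measurable_level_energy.
- by move=> w _; rewrite lee_fin level_energy_ge0.
- by rewrite lee_fin ltW.
apply: (le_trans (lee_wpmul2l _ (integral_level_energy n N k))).
  by rewrite lee_fin ltW.
have -> : ratio ^+ k = a ^- (4 * k) * 2^-1 ^+ k by exact: exprV4M.
by rewrite -EFinM lee_fin mulrCA.
Qed.

Definition weighted_energy N w : \bar R :=
  (\sum_(0 <= n <oo) ((lambda n ^+ 2)%:E * (1 + energy n N w)))%E.

(** Integer times suffice as starting points: [dyadic_step 0 t] is an integer, and the energy
    controls the path from there. *)
Definition weighted_square (j : int) w : \bar R :=
  (\sum_(0 <= n <oo) (lambda n ^+ 2 * X n j%:~R w ^+ 2)%:E)%E.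

Let lambda2 n : 0 < lambda n ^+ 2. Proof. by rewrite exprn_gt0. Qed.

Let we_ge0 n N w : (0 <= (lambda n ^+ 2)%:E * (1 + energy n N w))%E.
Proof.
apply: mule_ge0; first by rewrite lee_fin ltW.
by apply: adde_ge0 => //; exact: energy_ge0.
Qed.

Let m_we n N : measurable_fun setT (fun w => (lambda n ^+ 2)%:E * (1 + energy n N w))%E.
Proof.
by apply: measurable_funeM; apply: emeasurable_funD => //; exact: measurable_energy.
Qed.

Lemma weighted_energy_ae N : \forall w \ae P, (weighted_energy N w < +oo)%E.
Proof.
apply: ge0_integral_lty_ae.
- by apply: ge0_emeasurable_sum => [k w _ _|k _].
- by move=> w; apply: nneseries_ge0 => n _ _.
pose C := 1 + 2 * N%:R * K / (1 - ratio).
have C0 : 0 <= C by rewrite addr_ge0// divr_ge0 ?mulr_ge0// subr_ge0 ltW.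
rewrite integral_nneseries//.
apply: (@le_lt_trans _ _ (Lambda * C)%:E); last exact: ltry.
apply: lime_le.
  by apply: is_cvg_nneseries => n _ _; apply: integral_ge0 => w _.
apply: nearW => m; apply: (@le_trans _ _ (\sum_(0 <= n < m) (lambda n ^+ 2 * C)%:E)%E).
  apply: lee_sum => n _.
  rewrite ge0_integralZl//; last 3 first.
  - by apply: emeasurable_funD => //; exact: measurable_energy.
  - by move=> w _; rewrite adde_ge0// energy_ge0.
  - by rewrite lee_fin ltW.
  rewrite [leRHS]EFinM lee_wpmul2l//; first by rewrite lee_fin ltW.
  rewrite ge0_integralD//; last 2 first.
  - by move=> w _; exact: energy_ge0.
  - exact: measurable_energy.
  rewrite integral_cst//= probability_setT mule1 /C EFinD leeD2l//.
  exact: integral_energy.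
by rewrite sumEFin lee_fin -mulr_suml big_mkord ler_wpM2r.
Qed.

Lemma weighted_square_ae j : \forall w \ae P, (weighted_square j w < +oo)%E.
Proof.
have ge0 n w : (0 <= (lambda n ^+ 2 * X n j%:~R w ^+ 2)%:E)%E.
  by rewrite lee_fin mulr_ge0 ?sqr_ge0.
have m n : measurable_fun setT (fun w => (lambda n ^+ 2 * X n j%:~R w ^+ 2)%:E).
  by apply/measurable_EFinP; apply: measurable_funM => //; exact: measurable_funX.
apply: ge0_integral_lty_ae.
- by apply: ge0_emeasurable_sum => [k w _ _|k _].
- by move=> w; apply: nneseries_ge0 => n _ _.
rewrite integral_nneseries//.
apply: (@le_lt_trans _ _ (Lambda * K)%:E); last exact: ltry.
apply: lime_le.
  by apply: is_cvg_nneseries => n _ _; apply: integral_ge0 => w _.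
apply: nearW => p; apply: (@le_trans _ _ (\sum_(0 <= n < p) (lambda n ^+ 2 * K)%:E)%E).
  apply: lee_sum => n _; under eq_integral do rewrite EFinM.
  rewrite ge0_integralZl//; last 3 first.
  - by apply/measurable_EFinP; exact: measurable_funX.
  - by move=> w _; rewrite lee_fin sqr_ge0.
  - by rewrite lee_fin ltW.
  rewrite [leRHS]EFinM lee_wpmul2l//; first by rewrite lee_fin ltW.
by rewrite sumEFin lee_fin -mulr_suml big_mkord ler_wpM2r.
Qed.

(** Countably many conditions, so that a single event of probability one serves all times and all
    coordinates. *)
Definition regular_set : set T := \bigcap_N ([set w | (weighted_energy N w < +oo)%E] `&`
  ([set w | (weighted_square N%:Z w < +oo)%E] `&` [set w | (weighted_square (- N%:Z) w < +oo)%E])).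

Lemma measurable_regular_set : measurable regular_set.
Proof.
have me N : measurable_fun setT (weighted_energy N).
  by apply: ge0_emeasurable_sum => [k w _ _|k _].
have ms j : measurable_fun setT (weighted_square j).
  apply: ge0_emeasurable_sum => [k w _ _|k _]; first by rewrite lee_fin mulr_ge0 ?sqr_ge0.
  by apply/measurable_EFinP; apply: measurable_funM => //; exact: measurable_funX.
have lty (f : T -> \bar R) : measurable_fun setT f -> measurable [set w | (f w < +oo)%E].
  by move=> mf; rewrite -[X in measurable X]setTI; exact: emeasurable_fun_infty_o.
apply: bigcapT_measurable => N; apply: measurableI; first exact: lty.
by apply: measurableI; exact: lty.
Qed.

Lemma regular_set_ae : \forall w \ae P, regular_set w.
Proof.
have : \forall w \ae P, forall N : nat, (weighted_energy N w < +oo)%E /\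
    (weighted_square N%:Z w < +oo)%E /\ (weighted_square (- N%:Z) w < +oo)%E.
  apply: ae_foralln => N.
  apply: filterS3 (weighted_energy_ae N) (weighted_square_ae N%:Z) (weighted_square_ae (- N%:Z)).
  by move=> w h1 h2 h3.
by apply: filterS => w H N _; exact: H.
Qed.

Lemma regular_energy w n N : regular_set w -> (energy n N w < +oo)%E.
Proof.
move=> /(_ N I)[/= H _]; rewrite ltNge leye_eq; apply/negP => /eqP e.
have : (weighted_energy N w = +oo)%E.
  apply/eqP; rewrite -leye_eq.
  apply: le_trans (nneseries_lim_ge n.+1 (fun k _ _ => we_ge0 k N w)).
  rewrite big_nat_recr//= e addey// mulry gtr0_sg// mul1e addey ?leey//.
  by rewrite gt_eqF// (lt_le_trans (ltNyr 0))// sume_ge0.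
by move=> E; rewrite E ltxx in H.
Qed.

(** The natural constant is the fourth root of the energy. Its upper bound [Num.sqrt (1 + energy)]
    has a square that is affine in the energy, so the first-moment bound [integral_energy] is enough
    to sum the squares against [lambda n ^+ 2]. *)
Definition holder_constant n N w : R := Num.sqrt (1 + fine (energy n N w)).

Let one_energy n N w : 0 <= 1 + fine (energy n N w).
Proof. by rewrite addr_ge0// fine_ge0// energy_ge0. Qed.

Let increment_bound (D e A G : R) : 0 <= A -> 0 <= G -> D ^+ 4 <= e -> e <= A ^+ 4 * G ->
  `|D| <= Num.sqrt (1 + G) * A.
Proof.
move=> A0 G0 De eA.
have D2 : D ^+ 2 <= A ^+ 2 * (1 + G).
  rewrite -(@ler_pXn2r _ 2) ?nnegrE ?sqr_ge0 ?mulr_ge0 ?sqr_ge0 ?addr_ge0//.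
  rewrite -exprM exprMn -exprM; apply: (le_trans De); apply: (le_trans eA).
  rewrite ler_wpM2l ?exprn_ge0//; nra.
rewrite -(@ler_pXn2r _ 2) ?nnegrE ?mulr_ge0 ?sqrtr_ge0//.
by rewrite real_normK ?num_real// exprMn sqr_sqrtr ?addr_ge0// mulrC.
Qed.

Lemma regular_increment w n N k (j : int) : regular_set w ->
  - (N * 2 ^ k)%:Z <= j < (N * 2 ^ k)%:Z ->
  `|X n ((j%:~R + 1) / 2 ^+ k) w - X n (j%:~R / 2 ^+ k) w| <= holder_constant n N w * a ^+ k.
Proof.
move=> rw jb; have ey := regular_energy n N rw.
set D := X n _ w - X n _ w; set G := fine (energy n N w).
have GE : energy n N w = G%:E by rewrite /G fineK// ge0_fin_numE// energy_ge0.
pose i := absz (j + (N * 2 ^ k)%:Z)%R.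
have iE : j_of N k i = j by rewrite /j_of /i; move: jb; lia.
have ib : (i < 2 * (N * 2 ^ k))%N by rewrite /i; move: jb; lia.
have D4 : D ^+ 4 <= level_energy n N k w.
  rewrite /level_energy (bigD1 (Ordinal ib))//= iE -/D lerDl.
  by apply: sumr_ge0 => l _; rewrite exprn_even_ge0.
have DG : level_energy n N k w <= a ^+ (4 * k) * G.
  have : ((a ^- (4 * k) * level_energy n N k w)%:E <= G%:E)%E.
    rewrite -GE; apply: le_trans (nneseries_lim_ge k.+1 _); last first.
      by move=> l _ _; rewrite lee_fin mulr_ge0 ?level_energy_ge0// ltW.
    rewrite big_nat_recr//= leeDr// sume_ge0// => l _.
    by rewrite lee_fin mulr_ge0 ?level_energy_ge0// ltW.
  by rewrite lee_fin ler_pdivrMl ?exprn_gt0.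
have G0 : 0 <= G by rewrite fine_ge0// energy_ge0.
apply: (increment_bound _ G0 D4); first by rewrite exprn_ge0// ltW.
by rewrite -exprM mulnC.
Qed.

Lemma regular_holder_sum w N : regular_set w ->
  exists2 M, 0 <= M & forall m, \sum_(n < m) lambda n ^+ 2 * holder_constant n N w ^+ 2 <= M.
Proof.
move=> rw; have /(_ N I)[/= wy _] := rw.
have w0 : (0 <= weighted_energy N w)%E by apply: nneseries_ge0 => n _ _.
exists (fine (weighted_energy N w)); first exact: fine_ge0.
move=> m; rewrite -lee_fin fineK; last by rewrite ge0_fin_numE.
apply: le_trans (nneseries_lim_ge m (fun k _ _ => we_ge0 k N w)).
rewrite -sumEFin big_mkord; apply: lee_sum => n _.
rewrite EFinM sqr_sqrtr; last exact: one_energy.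
by rewrite EFinD fineK// ge0_fin_numE ?energy_ge0//; exact: regular_energy.
Qed.

Lemma regular_square_sum w (j : int) : regular_set w ->
  exists2 M, 0 <= M & forall m, \sum_(n < m) lambda n ^+ 2 * X n j%:~R w ^+ 2 <= M.
Proof.
move=> rw; have wy : (weighted_square j w < +oo)%E.
  have /(_ `|j|%N I)[_ /= [h1 h2]] := rw.
  by have [->|->] : j = `|j|%N%:Z \/ j = - `|j|%N%:Z by lia.
have ge0 n : (0 <= (lambda n ^+ 2 * X n j%:~R w ^+ 2)%:E)%E.
  by rewrite lee_fin mulr_ge0 ?sqr_ge0.
have w0 : (0 <= weighted_square j w)%E by apply: nneseries_ge0 => n _ _.
exists (fine (weighted_square j w)); first exact: fine_ge0.
move=> m; rewrite -lee_fin fineK; last by rewrite ge0_fin_numE.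
apply: le_trans (nneseries_lim_ge m (fun k _ _ => ge0 k)).
by rewrite -sumEFin big_mkord.
Qed.

(** The indicator replaces irregular paths by the zero path: sample continuity is required at every
    sample point, not only almost surely. *)
Definition cont_version n t w : R :=
  limn (fun k => \1_regular_set w * X n (dyadic_step k t) w).

Lemma time_bound (t : R) : exists N : nat, - N%:R <= t < N%:R.
Proof.
exists (Num.truncn `|t|).+1; have := truncnS_gt `|t|.
by rewrite ltr_norml => /andP[/ltW -> ->].
Qed.

Lemma regular_versionE n t w : regular_set w ->
  cont_version n t w = limn (fun k => X n (dyadic_step k t) w).
Proof.
by move=> rw; rewrite /cont_version indicE mem_set//; under eq_fun do rewrite mul1r.
Qed.

Lemma irregular_version0 n t w : ~ regular_set w -> cont_version n t w = 0.
Proof.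
move=> rw; rewrite /cont_version indicE memNset//; under eq_fun do rewrite mul0r.
exact: lim_cst.
Qed.

Lemma cvg_cont_version n t w :
  \1_regular_set w * X n (dyadic_step k t) w @[k --> \oo] --> cont_version n t w.
Proof.
rewrite /cont_version indicE; have [rw|rw] := pselect (regular_set w); last first.
  by rewrite memNset//; under eq_fun do rewrite mul0r; exact: is_cvg_cst.
rewrite mem_set//; under eq_fun do rewrite mul1r.
have [N tN] := time_bound t.
exact: (@dyadic_step_cvgn R (X n ^~ w) a (holder_constant n N w) N a0 a1
  (sqrtr_ge0 _) (fun k j => @regular_increment w n N k j rw) t tN).
Qed.

Lemma measurable_cont_version n t : measurable_fun setT (cont_version n t).
Proof.
apply: (@measurable_fun_cvg _ _ _ _ (fun k w => \1_regular_set w * X n (dyadic_step k t) w)).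
  by move=> k; apply: measurable_funM => //; apply: measurable_indic; exact: measurable_regular_set.
by move=> w _; exact: cvg_cont_version.
Qed.

(** The values at the dyadic approximations of [t] converge pointwise to the version and, by the
    second-moment bound on increments, in mean square to [X n t]. *)
Lemma cont_version_ae n t : \forall w \ae P, cont_version n t w = X n t w.
Proof.
have m1 : measurable_fun setT (\1_regular_set : T -> R).
  by apply: measurable_indic; exact: measurable_regular_set.
suff : \forall w \ae P, cont_version n t w = \1_regular_set w * X n t w.
  apply: filterS2 regular_set_ae => w rw ->.
  by rewrite indicE mem_set// mul1r.
apply: (cvg_L2_ae_eq (U := fun k w => \1_regular_set w * X n (dyadic_step k t) w)).
- by move=> k; exact: measurable_funM.
- exact: measurable_funM.
- exact: measurable_cont_version.
- by move=> w; exact: cvg_cont_version.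
apply: (@squeeze_cvge _ _ _ _ (fun=> 0%E) _ (fun k => (K * 2 ^- k)%:E)).
- apply: nearW => k; apply/andP; split.
    by apply: integral_ge0 => w _; rewrite lee_fin sqr_ge0.
  apply: (@le_trans _ _ (\int[P]_w ((X n (dyadic_step k t) w - X n t w) ^+ 2)%:E)%E).
    apply: ge0_le_integral => //.
    + by move=> w _; rewrite lee_fin sqr_ge0.
    + apply/measurable_EFinP; apply: measurable_funX.
      by apply: measurable_funB; exact: measurable_funM.
    + by apply/measurable_EFinP; apply: measurable_funX; exact: measurable_funB.
    + move=> w _; rewrite lee_fin -mulrBr exprMn indicE; case: (_ \in _).
        by rewrite expr1n mul1r.
      by rewrite expr0n mul0r sqr_ge0.
  apply: (le_trans (Xinc2 _ _ _)); rewrite lee_fin ler_wpM2l//.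
  have /andP[h1 h2] := dyadic_step_itv k t.
  by rewrite ler0_norm ?subr_le0// opprB lerBlDl ltW.
- exact: cvg_cst.
- apply: cvg_EFin; first exact: nearW.
  rewrite /= -[X in _ --> X](mulr0 K); apply: cvgM; first exact: cvg_cst.
  under eq_fun do rewrite -exprVn.
  by apply: cvg_expr; rewrite gtr0_norm ?invr_gt0// invf_lt1// ltr1n.
Qed.

Let c : R := (1 - a)^-1.

(** The weighted sum of squares is the squared norm of an increment in the dual, the coordinates
    there being [lambda n] times those of the version; [M] must therefore not depend on the number
    of coordinates. *)
Lemma cont_version_modulus w N : exists2 M, 0 <= M & forall k s t,
  - N%:R <= s < N%:R -> - N%:R <= t < N%:R -> `|t - s| < 2 ^- k ->
  forall m, \sum_(n < m) (lambda n * (cont_version n t w - cont_version n s w)) ^+ 2 <=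
    (M * a ^+ k) ^+ 2.
Proof.
have [rw|rw] := pselect (regular_set w); last first.
  exists 0 => // k s t sN tN ts m.
  by rewrite mul0r expr0n big1// => n _; rewrite !irregular_version0// subrr mulr0 expr0n.
have [M M0 HM] := regular_holder_sum N rw.
have c0 : 0 < c by rewrite invr_gt0 subr_gt0.
exists ((2 * c + 1) * Num.sqrt M); first by rewrite mulr_ge0 ?sqrtr_ge0// addr_ge0// mulr_ge0// ltW.
move=> k s t sN tN ts m.
have [A A0 AE] : exists2 A : R, 0 <= A & A = a ^+ k by exists (a ^+ k) => //; rewrite exprn_ge0// ltW.
have [C C0 CE] : exists2 C : R, 0 <= C & C = 2 * c + 1.
  by exists (2 * c + 1) => //; rewrite addr_ge0// mulr_ge0// ltW.
rewrite -AE -CE !exprMn sqr_sqrtr//.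
apply: (@le_trans _ _ (\sum_(n < m) C ^+ 2 * A ^+ 2 *
    (lambda n ^+ 2 * holder_constant n N w ^+ 2))); last first.
  have -> : C ^+ 2 * M * A ^+ 2 = C ^+ 2 * A ^+ 2 * M by rewrite mulrAC.
  by rewrite -mulr_sumr ler_wpM2l ?mulr_ge0 ?sqr_ge0.
apply: ler_sum => n _.
have -> : C ^+ 2 * A ^+ 2 * (lambda n ^+ 2 * holder_constant n N w ^+ 2) =
  lambda n ^+ 2 * (C * A * holder_constant n N w) ^+ 2 by ring.
rewrite exprMn ler_wpM2l ?sqr_ge0//.
rewrite !regular_versionE// -real_normK ?num_real//.
rewrite ler_pXn2r ?nnegrE ?normr_ge0 ?mulr_ge0 ?sqrtr_ge0//.
have := @dyadic_limit_modulus R (X n ^~ w) a (holder_constant n N w) N a0 a1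
  (sqrtr_ge0 _) (fun k j => @regular_increment w n N k j rw) k s t sN tN ts.
by rewrite -/c -AE -CE mulrAC.
Qed.

Lemma cont_version_square w t : exists2 M, 0 <= M &
  forall m, \sum_(n < m) (lambda n * cont_version n t w) ^+ 2 <= M.
Proof.
have [rw|rw] := pselect (regular_set w); last first.
  exists 0 => // m.
  by rewrite big1// => n _; rewrite !irregular_version0// mulr0 expr0n.
have [N tN] := time_bound t.
have [M M0 HM] := regular_holder_sum N rw.
have [L L0 HL] := regular_square_sum (dyadic_floor 0 t) rw.
have c0 : 0 < c by rewrite invr_gt0 subr_gt0.
have [C C0 CE] : exists2 C : R, 0 <= C & C = c by exists c => //; exact: ltW.
exists (2 * C ^+ 2 * M + 2 * L); first by rewrite addr_ge0 ?mulr_ge0 ?sqr_ge0.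
move=> m; apply: (@le_trans _ _ (2 * C ^+ 2 * (\sum_(n < m) lambda n ^+ 2 * holder_constant n N w ^+ 2) +
   2 * (\sum_(n < m) lambda n ^+ 2 * X n (dyadic_floor 0 t)%:~R w ^+ 2))); last first.
  by rewrite lerD// ler_wpM2l ?mulr_ge0 ?sqr_ge0.
rewrite !mulr_sumr -big_split/=; apply: ler_sum => n _.
rewrite exprMn regular_versionE//.
have := @dyadic_limit_dist R (X n ^~ w) a (holder_constant n N w) N a0 a1
  (sqrtr_ge0 _) (fun k j => @regular_increment w n N k j rw) 0 t tN.
rewrite [a ^+ 0]expr0 mulr1 -[(1 - a)^-1]/c -CE.
have -> : dyadic_step 0 t = (dyadic_floor 0 t)%:~R by rewrite /dyadic_step expr0 divr1.
set z := limn _; set x := X _ _ _; set h := holder_constant _ _ _ => zx.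
have hc : 0 <= h * C by rewrite mulr_ge0 ?sqrtr_ge0.
have {}zx : (z - x) ^+ 2 <= (h * C) ^+ 2.
  by rewrite -real_normK ?num_real// ler_pXn2r ?nnegrE.
have -> : 2 * C ^+ 2 * (lambda n ^+ 2 * h ^+ 2) + 2 * (lambda n ^+ 2 * x ^+ 2) =
  lambda n ^+ 2 * (2 * (h * C) ^+ 2 + 2 * x ^+ 2) by ring.
rewrite ler_wpM2l ?sqr_ge0//.
(* This square is nonnegative exactly when [z ^+ 2 <= 2 * (z - x) ^+ 2 + 2 * x ^+ 2]. *)
have : 0 <= (z - 2 * x) ^+ 2 by exact: sqr_ge0.
have -> : (z - 2 * x) ^+ 2 = 2 * (z - x) ^+ 2 + 2 * x ^+ 2 - z ^+ 2 by ring.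
move: zx; set u := (z - x) ^+ 2; set v := (h * C) ^+ 2; lra.
Qed.

End kolmogorov.

(** * The operators of the rigged Hilbert space *)

Section diagonal_operator.
Context (R : realType) (V : lmodType R) (E : set V) (q : V -> V -> R).
Hypothesis Eq : inner_product_on E q.
Hypothesis E_complete : complete_on E q.
Context (I : set nat) (e : nat -> V).
Hypothesis e_basis : orthonormal_basis E q I e.

Let Ee n : E (e n). Proof. exact: (basis_sub e_basis). Qed.

(** The squared norm of a block of the series is at most the corresponding block of the sums of
    [c n ^+ 2]; the partial sums are thus Cauchy, and completeness gives the limit. *)
Lemma riesz_fischer (c : nat -> R) M : (forall N, \sum_(n < N) c n ^+ 2 <= M) ->
  exists2 g, E g & q_cvg q (bsum e c) g.
Proof.
move=> cM; pose u N := \sum_(n < N) c n ^+ 2.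
have nu : nondecreasing_seq u.
  by apply/nondecreasing_seqP => n; rewrite /u big_ord_recr/= lerDl sqr_ge0.
have cu : cvgn u.
  by apply: nondecreasing_is_cvgn; [exact: nu|exists M => _ [N _ <-]; exact: cM].
have diff m n : (m <= n)%N -> qnorm q (bsum e c n - bsum e c m) ^+ 2 <= u n - u m.
  move=> mn.
  have -> : bsum e c n - bsum e c m = bsum e (fun i => if (i < m)%N then 0 else c i) n.
    rewrite /bsum -!(big_mkord predT (fun i => c i *: e i)).
    rewrite -(big_mkord predT (fun i => (if (i < m)%N then 0 else c i) *: e i)).
    rewrite (big_cat_nat (leq0n m) mn)/= [in RHS](big_cat_nat (leq0n m) mn)/=.
    rewrite addrAC subrr add0r [X in _ = X + _]big_nat_cond [X in _ = X + _]big1; last first.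
      by move=> i /andP[/andP[_ ->] _]; rewrite scale0r.
    rewrite add0r big_nat_cond [RHS]big_nat_cond; apply: eq_bigr => i /andP[/andP[mi _] _].
    by rewrite ltnNge mi.
  rewrite (qnorm_sqr Eq); last exact: (bsum_sub Eq e_basis).
  rewrite (le_trans (q_bsum_le Eq e_basis _ _))//.
  rewrite -(big_mkord predT (fun i => (if (i < m)%N then 0 else c i) ^+ 2)).
  rewrite /u -!(big_mkord predT (fun i => c i ^+ 2)).
  rewrite (big_cat_nat (leq0n m) mn)/= [in leRHS](big_cat_nat (leq0n m) mn)/=.
  rewrite [leRHS]addrAC subrr add0r big_nat_cond big1; last first.
    by move=> i /andP[/andP[_ ->] _]; rewrite expr0n.
  rewrite add0r big_nat_cond [leRHS]big_nat_cond le_eqVlt; apply/orP; left; apply/eqP.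
  by apply: eq_bigr => i /andP[/andP[mi _] _]; rewrite ltnNge mi.
apply: E_complete; first by move=> N; exact: (bsum_sub Eq e_basis).
move=> d d0; have d2 : 0 < d ^+ 2 / 2 by rewrite divr_gt0 ?exprn_gt0.
have /cvgrPdist_lt/(_ _ d2)[N _ HN] := cu.
exists N.
wlog mn : / forall m n, (N <= m)%N -> (N <= n)%N -> (n <= m)%N ->
    qnorm q (bsum e c m - bsum e c n) < d.
  apply => m n Nm Nn nm; rewrite -(@ltr_pXn2r _ 2) ?nnegrE ?sqrtr_ge0 ?(ltW d0)//.
  rewrite (le_lt_trans (diff _ _ nm))//.
  have := HN n Nn; have := HN m Nm; rewrite /= !ltr_norml => /andP[h1 _] /andP[_ h2].
  have := nu _ _ nm; have := exprn_gt0 2 d0; lra.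
move=> m n Nm Nn; have [nm|/ltnW nm] := leqP n m; first exact: mn.
rewrite /qnorm (q_sub_sym Eq); [exact: mn|exact: (bsum_sub Eq e_basis)..].
Qed.

Lemma bsum_limit_coefficient (c : nat -> R) g m : E g -> q_cvg q (bsum e c) g -> I m ->
  q (e m) g = c m.
Proof.
move=> Eg cg Im.
have := q_cvg_pairing Eq (bsum_sub Eq e_basis c) Eg (Ee m) cg.
rewrite (qC Eq (Ee m) Eg) => H.
suff H' : q (bsum e c N) (e m) @[N --> \oo] --> c m by exact: (cvg_unique _ H H').
apply: cvg_near_cst; near=> N; rewrite (qC Eq (bsum_sub Eq e_basis c N) (Ee m)).
rewrite (q_basis_bsum Eq e_basis) mem_set// andbT.
have -> // : (m < N)%N by near: N; exact: nbhs_infty_gt.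
Unshelve. all: by end_near. Qed.

Lemma q_basis_out f m : E f -> ~ I m -> q (e m) f = 0.
Proof. by move=> Ef nIm; rewrite (basis_out e_basis nIm) (q0l Eq Ef). Qed.

Lemma coefficient_inj f g : E f -> E g -> (forall m, q (e m) f = q (e m) g) -> f = g.
Proof.
move=> Ef Eg fg; apply: (q_cvg_unique Eq (bsum_sub Eq e_basis (fun n => q (e n) f)) Ef Eg).
  exact: (basis_cvg e_basis).
by rewrite (funext fg); exact: (basis_cvg e_basis).
Qed.

Variable lambda : nat -> R.
Hypothesis lambda_gt0 : forall n, 0 < lambda n.
Variable Lambda : R.
Hypothesis lambda_le : forall N, \sum_(n < N) lambda n ^+ 2 <= Lambda.

(* [diag_op], [diag_inv], [diag_range] and [diag_q] are [K_op], [Kinv], [D_K] and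
   [r_K] on an abstract Hilbert space. *)
Definition diag_op (f : V) : V :=
  xget 0 [set g | E g /\ q_cvg q (bsum e (fun n => lambda n * q (e n) f)) g].

Local Notation K := diag_op.

Lemma diag_opP f : E f -> E (K f) /\ q_cvg q (bsum e (fun n => lambda n * q (e n) f)) (K f).
Proof.
move=> Ef; rewrite /K; case: xgetP => [g -> //|nex]; exfalso.
have [] := @riesz_fischer (fun n => lambda n * q (e n) f) (Lambda * q f f); last first.
  by move=> g Eg cg; exact: (nex g).
move=> N; have L0 : 0 <= Lambda by have := lambda_le 0; rewrite big_ord0.
apply: (@le_trans _ _ (\sum_(n < N) Lambda * q (e n) f ^+ 2)); last first.
  by rewrite -mulr_sumr ler_wpM2l// (q_bessel Eq e_basis).
apply: ler_sum => n _; rewrite exprMn ler_wpM2r ?sqr_ge0//.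
apply: le_trans (lambda_le n.+1); rewrite big_ord_recr/= lerDr.
by apply: sumr_ge0 => i _; exact: sqr_ge0.
Qed.

Lemma diag_op_sub f : E f -> E (K f). Proof. by move=> /diag_opP[]. Qed.

Lemma diag_op_coefficient f m : E f -> q (e m) (K f) = lambda m * q (e m) f.
Proof.
move=> Ef; have [EK cK] := diag_opP Ef.
have [Im|nIm] := pselect (I m); first exact: (bsum_limit_coefficient EK cK Im).
by rewrite !q_basis_out// mulr0.
Qed.

Lemma diag_opDZ a f g : E f -> E g -> K (a *: f + g) = a *: K f + K g.
Proof.
move=> Ef Eg; have EKf := diag_op_sub Ef; have EKg := diag_op_sub Eg.
have Eafg := subDZ Eq a Ef Eg.
apply: coefficient_inj; [exact: diag_op_sub|exact: (subDZ Eq)|move=> m].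
rewrite diag_op_coefficient// !(qDZr Eq)// ?diag_op_coefficient//.
by ring.
Qed.

Lemma diag_op_inj f g : E f -> E g -> K f = K g -> f = g.
Proof.
move=> Ef Eg fg; apply: coefficient_inj => // m.
have : q (e m) (K f) = q (e m) (K g) by rewrite fg.
by rewrite !diag_op_coefficient// => /(mulfI (lt0r_neq0 (lambda_gt0 m))).
Qed.

Definition diag_inv (f : V) : V := xget 0 [set g | E g /\ K g = f].

Lemma diag_opK f : E f -> diag_inv (K f) = f.
Proof.
move=> Ef; rewrite /diag_inv; case: xgetP => [g -> [Eg]|nex].
  exact: diag_op_inj.
by exfalso; exact: (nex f).
Qed.

Definition diag_range : set V := K @` E.
Definition diag_q (f g : V) : R := q (diag_inv f) (diag_inv g).

Lemma diag_qE f g : E f -> E g -> diag_q (K f) (K g) = q f g.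
Proof. by move=> Ef Eg; rewrite /diag_q !diag_opK. Qed.

Lemma diag_op0 : K 0 = 0.
Proof.
have E0 := sub0 Eq; have := diag_opDZ (-1) E0 E0.
by rewrite scaler0 addr0 scaleN1r addNr.
Qed.

Lemma diag_range_sub f : diag_range f -> E f.
Proof. by move=> [g Eg <-]; exact: diag_op_sub. Qed.

Lemma diag_inner_product : inner_product_on diag_range diag_q.
Proof.
split.
- split; first by exists 0; [exact: (sub0 Eq)|exact: diag_op0].
  move=> a _ _ [f Ef <-] [g Eg <-]; exists (a *: f + g); first exact: (subDZ Eq).
  exact: diag_opDZ.
- by move=> _ _ [f Ef <-] [g Eg <-]; rewrite !diag_qE// (qC Eq).
- move=> a _ _ _ [f Ef <-] [g Eg <-] [h Eh <-].
  rewrite -diag_opDZ// !diag_qE//; last exact: (subDZ Eq).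
  exact: (qDZl Eq).
- by move=> _ [f Ef <-]; rewrite diag_qE//; exact: (q_ge0 Eq).
- move=> _ [f Ef <-]; rewrite diag_qE// => /(q_eq0 Eq Ef) ->.
  exact: diag_op0.
Qed.

(** The image of [e n] under the operator, by [diag_basisE]. Pairing with it brings the factor
    [lambda n] into the coordinates of the dual-valued process. *)
Definition diag_basis (n : nat) : V := lambda n *: e n.

Lemma diag_basisE n : diag_basis n = K (e n).
Proof.
apply: coefficient_inj; [exact: (subZ Eq)|exact: diag_op_sub|move=> m].
by rewrite diag_op_coefficient// (qC Eq (Ee m)) ?(qZl Eq) ?(qC Eq (Ee n))//;
  [rewrite (basis_q e_basis); case: eqVneq => [->//|_]; rewrite !mulr0|exact: (subZ Eq)].
Qed.

Lemma diag_orthonormal_basis : orthonormal_basis diag_range diag_q I diag_basis.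
Proof.
split.
- by move=> n; rewrite diag_basisE; exists (e n).
- by move=> m n; rewrite !diag_basisE diag_qE// (basis_q e_basis).
- by move=> n nIn; rewrite /diag_basis (basis_out e_basis nIn) scaler0.
- move=> _ [f Ef <-]; rewrite /q_cvg.
  have KE N : \sum_(n < N) diag_q (diag_basis n) (K f) *: diag_basis n =
      K (bsum e (fun n => q (e n) f) N).
    elim: N => [|N IH]; first by rewrite /bsum !big_ord0 diag_op0.
    rewrite big_ord_recr/= IH /bsum big_ord_recr/= [in RHS]addrC diag_opDZ//; last first.
      exact: (bsum_sub Eq e_basis (fun n => q (e n) f) N).
    by rewrite diag_basisE diag_qE// addrC.
  under eq_fun do rewrite KE.
  have nE N : qnorm diag_q (K (bsum e (fun n => q (e n) f) N) - K f) =
      qnorm q (bsum e (fun n => q (e n) f) N - f).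
    have Es := bsum_sub Eq e_basis (fun n => q (e n) f) N.
    rewrite /qnorm addrC -scaleN1r -diag_opDZ// scaleN1r [- f + _]addrC diag_qE//; exact: (subB Eq).
  under eq_fun do rewrite nE.
  exact: (basis_cvg e_basis).
Qed.

End diagonal_operator.

(** * Inverse of a self-adjoint operator whose range is the orthogonal of a unit vector *)

Section self_adjoint_inverse.
Context (R : realType) (V : lmodType R) (q : V -> V -> R) (one : V).
Hypothesis qT : inner_product_on setT q.
Hypothesis q_one : q one one = 1.
Context (DA : set V) (A : V -> V).
Hypothesis A_selfadjoint : self_adjoint q DA A.
Hypothesis A_range : A @` DA = [set f | q f one = 0].

Let qDZ a f g h : q (a *: f + g) h = a * q f h + q g h. Proof. exact: (qDZl qT). Qed.
Let qS f g : q f g = q g f. Proof. exact: (qC qT). Qed.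
Let q_def f : q f f = 0 -> f = 0. Proof. exact: (q_eq0 qT). Qed.

Lemma range_perp g : DA g -> q (A g) one = 0.
Proof.
move=> Dg; have : (A @` DA) (A g) by exists g.
by rewrite A_range.
Qed.

(** Linearity of the operator is derived from self-adjointness, because the condition that defines
    the graph of the adjoint is linear in the pair. *)
Lemma self_adjointDZ a f g : DA f -> DA g -> DA (a *: f + g) /\ A (a *: f + g) = a *: A f + A g.
Proof.
move=> Df Dg; apply/(A_selfadjoint _ _) => h Dh.
have /A_selfadjoint/(_ h Dh) ef := conj Df (erefl (A f)).
have /A_selfadjoint/(_ h Dh) eg := conj Dg (erefl (A g)).
by rewrite qS qDZ qS ef (qS _ (A h)) eg qS (qS h) -qDZ qS.
Qed.

(** The range is orthogonal to [one], so the pair [(one, 0)] lies in the graph of the adjoint, which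
    is that of [A]. *)
Lemma null_space_one : null_space DA A one.
Proof.
apply/(A_selfadjoint _ _) => g Dg; rewrite range_perp//.
by rewrite qS (q0l qT).
Qed.

Lemma null_space_perp f h : q f one = 0 -> null_space DA A h -> q f h = 0.
Proof.
move=> f1 [Dh Ah].
have hperp g : q g one = 0 -> q g h = 0.
  move=> g1; have : (A @` DA) g by rewrite A_range.
  move=> [k Dk <-].
  have /A_selfadjoint/(_ k Dk) -> := conj Dh Ah.
  by rewrite qS (q0l qT).
exact: hperp.
Qed.

(** A preimage given by the range hypothesis becomes orthogonal to [one] after subtraction of its
    component along [one], which [A] kills. *)
Lemma op_inv_exists g : q g one = 0 -> exists f, [/\ DA f, q f one = 0 & A f = g].
Proof.
move=> g1; have : (A @` DA) g by rewrite A_range.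
move=> [f Df <-]; have [D1 A1] := null_space_one.
have [D2 A2] := self_adjointDZ (- q f one) D1 Df.
exists (- q f one *: one + f); split => //.
  by rewrite qDZ q_one mulr1 addNr.
by rewrite A2 A1 scaler0 add0r.
Qed.

Lemma op_inv_unique f f' : DA f -> DA f' -> q f one = 0 -> q f' one = 0 -> A f = A f' -> f = f'.
Proof.
move=> Df Df' f1 f'1 ff'; have [D2 A2] := self_adjointDZ (-1) Df' Df.
have n : null_space DA A (-1 *: f' + f) by split => //; rewrite A2 ff' scaleN1r addNr.
have n1 : q (-1 *: f' + f) one = 0 by rewrite qDZ f1 f'1 mulr0 addr0.
have /q_def/eqP := null_space_perp n1 n; rewrite scaleN1r addrC subr_eq0.
by move/eqP.
Qed.

Lemma op_invP g : q g one = 0 ->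
  [/\ DA (op_inv q DA A g), q (op_inv q DA A g) one = 0 & A (op_inv q DA A g) = g].
Proof.
move=> g1; rewrite /op_inv; case: xgetP => [f -> [Df fN Af]|nex].
  by split => //; apply: fN; exact: null_space_one.
exfalso; have [f [Df f1 Af]] := op_inv_exists g1.
by apply: (nex f); split => // h; exact: null_space_perp.
Qed.

(** Reconciles the two inverses in use: [A^-1] in the covariance of the Brownian field and [(-A)^-1]
    in the inner product [r_D] and in [C_op]. *)
Lemma op_inv_opp g : q g one = 0 ->
  op_inv q DA (fun f => - A f) g = - op_inv q DA A g.
Proof.
move=> g1; have [Dk k1 Ak] := op_invP g1.
have nN h : null_space DA (fun f => - A f) h <-> null_space DA A h.
  rewrite /null_space/=; split=> -[? /eqP]; rewrite ?oppr_eq0 => /eqP H; split => //.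
  by rewrite H oppr0.
have [D1 A1] := null_space_one.
have D0 : DA 0 /\ A 0 = 0.
  by apply/(A_selfadjoint _ _) => h _; rewrite qS (q0l qT)// qS (q0l qT).
have [DN AN] := self_adjointDZ (-1) Dk D0.1.
rewrite !scaleN1r !addr0 D0.2 addr0 in DN AN.
have N1 : q (- op_inv q DA A g) one = 0.
  by have := qDZ (-1) (op_inv q DA A g) 0 one; rewrite scaleN1r addr0 k1 (q0l qT)// mulr0 addr0.
rewrite {1}/op_inv; case: xgetP => [f _ [Df fN Af]|nex].
  apply: op_inv_unique => //; first by apply: fN; apply/nN; exact: null_space_one.
  by rewrite AN Ak -Af opprK.
exfalso; apply: (nex (- op_inv q DA A g)); split => //.
  by move=> h /nN; exact: null_space_perp.
by rewrite AN opprK.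
Qed.

End self_adjoint_inverse.

(** * The inner product on square-integrable classes *)

Section L2_inner_product.
Context d (T : measurableType d) (R : realType) (mu : probability T R).
Local Notation L2 := (LspaceType2 mu).

Lemma ip_integrable (u v : L2) : mu.-integrable setT (EFin \o (fun x => u x * v x)).
Proof.
apply/(Lfun1_integrable mu); apply: Lfun2_mul_Lfun1; exact: Lspace_rep_in.
Qed.

Lemma L2addE (u v : L2) : ((u + v : L2) : T -> R) = (fun x => u x + v x) %[ae mu].
Proof. exact: (LclassE (Lrep u + Lrep v)). Qed.

Lemma L2scaleE a (u : L2) : ((a *: u : L2) : T -> R) = (fun x => a * u x) %[ae mu].
Proof. exact: (LclassE (a *: Lrep u)). Qed.

Lemma L2zeroE : ((0 : L2) : T -> R) = (fun=> 0) %[ae mu].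
Proof. exact: (LclassE (0 : LfunType mu (lee1n 2))). Qed.

Lemma ip_ae (u v : L2) (f : T -> R) : mu.-integrable setT (EFin \o f) ->
  (\forall x \ae mu, u x * v x = f x) -> ip mu u v = \int[mu]_x f x.
Proof.
move=> intf uvf; rewrite /ip /Rintegral; congr fine.
apply: ae_eq_integral => //.
- exact: measurable_int (ip_integrable u v).
- exact: measurable_int intf.
by apply: filterS uvf => x e _ /=; rewrite e.
Qed.

Lemma L2_inner_product : inner_product_on setT (ip mu).
Proof.
split => //.
- by move=> f g _ _; rewrite /ip; apply: eq_Rintegral => x _; rewrite mulrC.
- move=> a f g h _ _ _.
  have i1 := ip_integrable f h; have i2 := ip_integrable g h.
  have i3 : mu.-integrable setT (EFin \o (fun x => a * (f x * h x))).
    by apply: eq_integrable (integrableZl measurableT a i1) => // x _; rewrite /= EFinM.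
  rewrite (@ip_ae _ _ (fun x => a * (f x * h x) + g x * h x)).
  + rewrite (@RintegralD _ _ _ mu setT (fun x => a * (f x * h x)) (fun x => g x * h x))//.
    by rewrite RintegralZl.
  + by apply: eq_integrable (integrableD measurableT i3 i2).
  + have := L2scaleE a f; have := L2addE (a *: f) g.
    apply: filterS2 => x e1 e2; rewrite e1// e2//; ring.
- by move=> f _; apply: Rintegral_ge0 => x _; rewrite -expr2 sqr_ge0.
- move=> f _ ff0; apply: L2_eq.
  have : (\int[mu]_x `|(f x * f x)%:E| = 0)%E.
    under eq_integral do rewrite gee0_abs ?lee_fin -?expr2 ?sqr_ge0//.
    have := ff0; rewrite /ip /Rintegral.
    have : (\int[mu]_x (f x * f x)%:E \is a fin_num)%E.
      by apply: integrable_fin_num => //; exact: ip_integrable.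
    by move=> /fineK e h; rewrite -[LHS]e h.
  move/(ae_eq_integral_abs mu measurableT (measurable_int _ (ip_integrable f f))).
  have := L2zeroE; apply: filterS2 => x z0 /(_ I)/= [/eqP].
  by rewrite mulf_eq0 orbb => /eqP e _; rewrite e z0.
Qed.

Lemma ip_one_one : ip mu (L2one mu) (L2one mu) = 1.
Proof.
have i1 : mu.-integrable setT (EFin \o (fun=> 1 : R)) by exact: finite_measure_integrable_cst.
rewrite (ip_ae i1); first by rewrite Rintegral_cst//= probability_setT mulr1.
have := LclassE (Lfun_Sub (lee1n 2) (Lfun_cst mu 1 2%:R)).
by apply: filterS => x e; rewrite e// mulr1.
Qed.

End L2_inner_product.

Section covariance_operator.
Context d (T : measurableType d) (R : realType) (mu : probability T R).
Local Notation L2 := (LspaceType2 mu).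
Context (DA : set L2) (A : L2 -> L2) (gamma : R).
Hypothesis gamma_lt0 : gamma < 0.
Hypothesis A_selfadjoint : self_adjoint (ip mu) DA A.
Hypothesis A_range : A @` DA = one_perp mu.

Let qT := L2_inner_product mu.
Let q1 := ip_one_one mu.

Lemma negAinvE f : one_perp mu f -> negAinv DA A f = - op_inv (ip mu) DA A f.
Proof. exact: (op_inv_opp qT q1 A_selfadjoint A_range). Qed.

Let ipZr a f g : ip mu f (a *: g) = a * ip mu f g.
Proof. by rewrite (qC qT)// (qZl qT)// (qC qT). Qed.

Lemma negAinv_perp f : one_perp mu f -> one_perp mu (negAinv DA A f).
Proof.
move=> f1; rewrite negAinvE//; have [_ h _] := op_invP qT q1 A_selfadjoint A_range f1.
by rewrite /one_perp/= -scaleN1r (qZl qT)// h mulr0.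
Qed.

Let g_gt0 : 0 < `|gamma|. Proof. by rewrite normr_gt0 lt_eqF. Qed.

Lemma GammainvE f : one_perp mu f -> Gammainv gamma f = - `|gamma|^-1 *: f.
Proof.
move=> f1; have g0 : `|gamma| != 0 by rewrite gt_eqF.
have G (h : L2) : - `|gamma| *: (- `|gamma|^-1 *: h) = h by rewrite scalerA mulrNN mulfV// scale1r.
have G' (h : L2) : - `|gamma|^-1 *: (- `|gamma| *: h) = h by rewrite scalerA mulrNN mulVf// scale1r.
rewrite /Gammainv /op_inv; case: xgetP => [h _ [_ _ <-]|nex]; first by rewrite /Gamma_op G'.
exfalso; apply: (nex (- `|gamma|^-1 *: f)); split; last by rewrite /Gamma_op G.
  by rewrite /one_perp/= (qZl qT)// f1 mulr0.
move=> h [_ h0]; have -> : h = 0 by rewrite -(G' h) -/(Gamma_op gamma h) h0 scaler0.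
by rewrite (qC qT)// (q0l qT).
Qed.

Lemma Sigma_opE f : one_perp mu f -> Sigma_op DA A gamma f = `|gamma|^-1 *: negAinv DA A f.
Proof.
move=> f1; have n1 := negAinv_perp f1.
rewrite /Sigma_op /C_op GammainvE ?scalerA; last first.
  by rewrite /one_perp/= (qZl qT)// n1 mulr0.
by congr (_ *: _); field; rewrite gt_eqF.
Qed.

(** The covariance of [Z] at a fixed time is a multiple of the inner product of the rigged space, so
    convergence in [(D, r)] gives mean-square convergence of the field. *)
Lemma ip_Sigma f g : one_perp mu g ->
  ip mu f (Sigma_op DA A gamma g) = (1 + `|gamma|) ^- 2 * r_D DA A gamma f g.
Proof.
move=> g1; rewrite Sigma_opE// ipZr /r_D; field.
by rewrite !gt_eqF//= addr_gt0.
Qed.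

Lemma brownian_covarianceE f g : one_perp mu g ->
  - 2 * ip mu f (op_inv (ip mu) DA A g) = 2 * `|gamma| * ip mu f (Sigma_op DA A gamma g).
Proof.
move=> g1; rewrite Sigma_opE// ipZr negAinvE// -scaleN1r ipZr; field.
by rewrite gt_eqF.
Qed.

End covariance_operator.

(** * Laws of dual-valued Gaussian families *)

Lemma generated_preimage (T1 T2 : Type) (f : T1 -> T2) (F : set (set T1)) (G : set (set T2)) A :
  sigma_algebra setT F -> (forall B, G B -> F (f @^-1` B)) -> <<s G >> A -> F (f @^-1` A).
Proof.
move=> [F0 FC FU] GF; move: A; apply: smallest_sub => //; split => /=.
- by rewrite preimage_set0.
- by move=> A FA; rewrite setTD preimage_setC -setTD; exact: FC.
- by move=> A FA; rewrite preimage_bigcup; exact: FU.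
Qed.

Section gaussian_system.
Context (R : realType).

(** The part of [gaussian_field] that concerns laws of finite combinations, which is all that a
    comparison of laws uses. *)
Definition gaussian_system d (T : measurableType d) (P : probability T R) (J : Type)
    (W : J -> T -> R) (I : set J) (k : J -> J -> R) :=
  forall n (c : 'I_n -> R) (j : 'I_n -> J), (forall i, I (j i)) ->
    0 <= qform k c j /\ gaussian_rv P (combo W c j) (qform k c j).

Lemma gaussian_system1 d (T : measurableType d) (P : probability T R) (J : Type)
    (W : J -> T -> R) (I : set J) k j : gaussian_system P W I k -> I j ->
  0 <= k j j /\ gaussian_rv P (W j) (k j j).
Proof.
move=> gW Ij; have := gW 1 (fun=> 1) (fun=> j) (fun=> Ij).
rewrite /qform !big_ord1 !mul1r.
have -> // : combo W (fun=> 1) (fun _ : 'I_1 => j) = W j.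
by apply/funext => w; rewrite /combo big_ord1 mul1r.
Qed.

Lemma gaussian_system_eq d (T : measurableType d) (P : probability T R) (J : Type)
    (W W' : J -> T -> R) (I : set J) (k k' : J -> J -> R) :
  (forall j w, I j -> W' j w = W j w) -> (forall j l, I j -> I l -> k' j l = k j l) ->
  gaussian_system P W I k -> gaussian_system P W' I k'.
Proof.
move=> WW' kk' gW n c j Ij.
have -> : qform k' c j = qform k c j.
  by apply: eq_bigr => i _; apply: eq_bigr => l _; rewrite kk'.
have -> : combo W' c j = combo W c j; last exact: gW.
by apply/funext => w; apply: eq_bigr => i _; rewrite WW'.
Qed.

Lemma gaussian_system_scale d (T : measurableType d) (P : probability T R) (J J' : Type)
    (W : J -> T -> R) (I : set J) k (I' : set J') (a : J' -> R) (phi : J' -> J) :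
  gaussian_system P W I k -> (forall j, I' j -> I (phi j)) ->
  gaussian_system P (fun j w => a j * W (phi j) w) I'
    (fun j l => a j * a l * k (phi j) (phi l)).
Proof.
move=> gW I'I n c j I'j.
have := gW n (fun i => c i * a (j i)) (phi \o j) (fun i => I'I _ (I'j i)).
have -> : qform k (fun i => c i * a (j i)) (phi \o j) =
    qform (fun j l => a j * a l * k (phi j) (phi l)) c j.
  by apply: eq_bigr => i _; apply: eq_bigr => l _ /=; ring.
have -> // : combo W (fun i => c i * a (j i)) (phi \o j) =
    combo (fun j w => a j * W (phi j) w) c j.
by apply/funext => w; apply: eq_bigr => i _; rewrite /= mulrA.
Qed.

Lemma gaussian_system_reindex d (T : measurableType d) (P : probability T R) (J J' : Type)
    (W : J -> T -> R) (I : set J) k (I' : set J') (phi : J' -> J) :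
  gaussian_system P W I k -> (forall j, I' j -> I (phi j)) ->
  gaussian_system P (fun j w => W (phi j) w) I' (fun j l => k (phi j) (phi l)).
Proof.
move=> gW I'I; apply: gaussian_system_eq (gaussian_system_scale (fun=> 1) gW I'I).
  by move=> j w _; rewrite mul1r.
by move=> j l _ _; rewrite !mul1r.
Qed.

(** The product measure makes the two families independent, so variances of combinations add up, and
    with them the kernels. *)
Lemma gaussian_system_add d1 d2 (T1 : measurableType d1) (T2 : measurableType d2)
    (P1 : probability T1 R) (P2 : probability T2 R) (J : Type)
    (W1 : J -> T1 -> R) (W2 : J -> T2 -> R) (I : set J) k1 k2 :
  gaussian_system P1 W1 I k1 -> gaussian_system P2 W2 I k2 ->
  gaussian_system (P1 \x P2)%E (fun j z => W1 j z.1 + W2 j z.2) I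
    (fun j l => k1 j l + k2 j l).
Proof.
move=> g1 g2 n c j Ij; have [v0 h1] := g1 n c j Ij; have [w0 h2] := g2 n c j Ij.
have -> : qform (fun j l => k1 j l + k2 j l) c j = qform k1 c j + qform k2 c j.
  rewrite /qform -big_split/=; apply: eq_bigr => i _.
  by rewrite -big_split/=; apply: eq_bigr => l _; rewrite mulrDr.
split; first exact: addr_ge0.
have -> : combo (fun j z => W1 j z.1 + W2 j z.2) c j =
    (fun z => combo W1 c j z.1 + combo W2 c j z.2).
  by apply/funext => z; rewrite /combo -big_split/=; apply: eq_bigr => i _; rewrite mulrDr.
exact: gaussian_rv_add.
Qed.

Lemma gaussian_system_ae d (T : measurableType d) (P : probability T R) (J : Type)
    (W W' : J -> T -> R) (I : set J) k :
  (forall j, I j -> measurable_fun setT (W' j)) ->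
  (forall j, I j -> \forall w \ae P, W' j w = W j w) ->
  gaussian_system P W I k -> gaussian_system P W' I k.
Proof.
move=> mW' WW' gW n c j Ij; have [v0 [mX lX]] := gW n c j Ij; split => //.
have mX' : measurable_fun setT (combo W' c j).
  by apply: measurable_sum => i; apply: measurable_funM => //; exact: mW'.
split => // U mU; rewrite -lX//.
have ae : \forall w \ae P, combo W' c j w = combo W c j w.
  have : \forall w \ae P, forall i, W' (j i) w = W (j i) w.
    by apply: filter_forall => i; exact: WW'.
  by apply: filterS => w h; apply: eq_bigr => i _; rewrite h.
transitivity (\int[P]_w (\1_U (combo W' c j w))%:E)%E.
  have -> : (\int[P]_w (\1_U (combo W' c j w))%:E = \int[P]_w (\1_(combo W' c j @^-1` U) w)%:E)%E.
    by apply: eq_integral => w _; rewrite !indicE.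
  by rewrite integral_indic ?setIT// -[X in measurable X]setTI; exact: mX'.
transitivity (\int[P]_w (\1_U (combo W c j w))%:E)%E.
  apply: ae_eq_integral => //.
  - apply/measurable_EFinP; apply: (measurableT_comp _ mX').
    by have /(measurable_indicP) := mU.
  - apply/measurable_EFinP; apply: (measurableT_comp _ mX).
    by have /(measurable_indicP) := mU.
  - by apply: filterS ae => w h _; rewrite h.
have -> : (\int[P]_w (\1_U (combo W c j w))%:E = \int[P]_w (\1_(combo W c j @^-1` U) w)%:E)%E.
  by apply: eq_integral => w _; rewrite !indicE.
by rewrite integral_indic ?setIT// -[X in measurable X]setTI; exact: mX.
Qed.

End gaussian_system.

Section dual_valued_laws.
Context (R : realType) (V : lmodType R) (E : set V) (q : V -> V -> R).
Hypothesis Eq : inner_product_on E q.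
Context (I : set nat) (b : nat -> V).
Hypothesis b_basis : orthonormal_basis E q I b.
Local Notation H := (dual E q).

Context (X J : Type) (chi : J -> X -> H).

(** Points of [X] are observed through the [H]-valued maps [chi j]; these are the finite linear
    functionals of the observations. The index type is a single point for one law, ['I_n] for
    finite-dimensional laws, and the past plus one future time for the Markov property. *)
Definition chi_forms : set (X -> R) := [set l |
  exists n (c : 'I_n -> R) (fj : 'I_n -> V * J), (forall i, E (fj i).1) /\
    l = combo (fun fj x => pairing (chi fj.2 x) fj.1) c fj].

Lemma chi_forms0 : chi_forms (fun=> 0).
Proof.
have fj : 'I_0 -> V * J by case.
exists 0%N, (fun=> 0), fj; split; first by case.
by apply/funext => x; rewrite /combo big_ord0.
Qed.

Lemma chi_formsDZ a l m : chi_forms l -> chi_forms m -> chi_forms (fun x => a * l x + m x).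
Proof.
move=> [n [c [fj [Efj ->]]]] [n' [c' [fj' [Efj' ->]]]].
exists (n + n')%N, (fun i => match fintype.split i with inl i => a * c i | inr i => c' i end),
  (fun i => match fintype.split i with inl i => fj i | inr i => fj' i end); split.
  by move=> i; case: fintype.split.
apply/funext => x; rewrite /combo big_split_ord/= mulr_sumr; congr (_ + _).
  by apply: eq_bigr => i _; case: split_ordP => k; [move=> /lshift_inj <-; rewrite mulrA|
    move=> /eqP; rewrite eq_lrshift].
by apply: eq_bigr => i _; case: split_ordP => k; [move=> /eqP; rewrite eq_rlshift|
   move=> /rshift_inj <-].
Qed.

Definition chi_sets : set (set X) := [set A | exists j, exists2 U : set (borel H),
  measurable U & A = chi j @^-1` U].

(** Equal kernels give equal laws to every form in [chi_forms]. Borel sets of the dual being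
    generated by coordinates, preimages under these forms generate all events observable through
    [chi]. *)
Lemma same_law d1 d2 (T1 : measurableType d1) (T2 : measurableType d2)
    (P1 : probability T1 R) (P2 : probability T2 R) (xi1 : T1 -> X) (xi2 : T2 -> X) k A :
  gaussian_system P1 (fun fj w => pairing (chi fj.2 (xi1 w)) fj.1)
    [set fj | E fj.1] k ->
  gaussian_system P2 (fun fj w => pairing (chi fj.2 (xi2 w)) fj.1)
    [set fj | E fj.1] k ->
  <<s chi_sets >> A -> P1 (xi1 @^-1` A) = P2 (xi2 @^-1` A).
Proof.
move=> g1 g2 CA.
have m d (T : measurableType d) (P : probability T R) (xi : T -> X) :
    gaussian_system P (fun fj w => pairing (chi fj.2 (xi w)) fj.1) [set fj | E fj.1] k ->
    forall l, chi_forms l -> measurable_fun setT (l \o xi).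
  by move=> g _ [n [c [fj [Efj ->]]]]; have [_ []] := g n c fj Efj.
pose G : set (set X) := [set A | exists2 l, chi_forms l &
  exists2 U : set R, measurable U & A = l @^-1` U].
apply: (@cramer_wold _ _ _ chi_forms0 chi_formsDZ _ _ _ _ P1 P2 xi1 xi2
  (m _ _ _ _ g1) (m _ _ _ _ g2) _ G).
- move=> _ U [n [c [fj [Efj ->]]]] mU.
  have [_ [_ e1]] := g1 n c fj Efj; have [_ [_ e2]] := g2 n c fj Efj.
  by have := e1 U mU; rewrite -(e2 U mU).
- by [].
have sG : sigma_algebra setT <<s G >> by exact: smallest_sigma_algebra.
move: A CA; apply: smallest_sub => // _ [j [U mU ->]].
apply: (generated_preimage sG _ (borel_dual_coordinates Eq b_basis mU)).
move=> _ [n [W mW ->]]; apply: sub_gen_smallest.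
exists (fun x => pairing (chi j x) (b n)); last by exists W.
exists 1%N, (fun=> 1), (fun=> (b n, j)); split; first by move=> _; exact: (basis_sub b_basis).
by apply/funext => x; rewrite /combo big_ord1 mul1r.
Qed.

End dual_valued_laws.

(** * Stationary Gaussian Markov processes with values in a dual *)

Section gaussian_markov.
Context (R : realType) (V : lmodType R) (E : set V) (q : V -> V -> R).
Hypothesis Eq : inner_product_on E q.
Context (I : set nat) (b : nat -> V).
Hypothesis b_basis : orthonormal_basis E q I b.
Local Notation H := (dual E q).

Lemma same_law_dual d1 d2 (T1 : measurableType d1) (T2 : measurableType d2)
    (P1 : probability T1 R) (P2 : probability T2 R) (xi1 : T1 -> H) (xi2 : T2 -> H)
    (k : V -> V -> R) (U : set (borel H)) :
  gaussian_system P1 (fun f w => pairing (xi1 w) f) E k ->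
  gaussian_system P2 (fun f w => pairing (xi2 w) f) E k ->
  measurable U -> P1 (xi1 @^-1` U) = P2 (xi2 @^-1` U).
Proof.
move=> g1 g2 mU.
apply: (@same_law _ _ _ _ Eq _ _ b_basis H unit (fun=> id) _ _ _ _ P1 P2 xi1 xi2
  (fun x y => k x.1 y.1) U).
- exact: gaussian_system_reindex g1 _.
- exact: gaussian_system_reindex g2 _.
- by apply: sub_gen_smallest; exists tt, U.
Qed.

Lemma measurable_affine d (T : measurableType d) (X Y : T -> borel H) (a c : R) :
  measurable_fun setT X -> measurable_fun setT Y ->
  measurable_fun setT (fun w => a *: (X w : H) + c *: (Y w : H) : borel H).
Proof.
move=> mX mY; apply: (measurable_dual Eq b_basis) => n.
have mp (Z : T -> borel H) : measurable_fun setT Z ->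
    measurable_fun setT (fun w => pairing (Z w) (b n)).
  by move=> mZ; exact: (measurableT_comp (measurable_pairing (basis_sub b_basis n)) mZ).
rewrite (_ : (fun w => _) = (fun w => a * pairing (X w) (b n) + c * pairing (Y w) (b n)))//.
by apply: measurable_funD; apply: measurable_funM => //; exact: mp.
Qed.

Section kernel.
Context (nu : probability (borel H) R) (a c : R).

Definition affine_step (y z : borel H) : borel H := a *: (y : H) + c *: (z : H).

Lemma measurable_affine_step y : measurable_fun setT (affine_step y).
Proof. by apply: measurable_affine => //; exact: measurable_cst. Qed.

HB.instance Definition _ y := isMeasurableFun.Build _ _ _ _ (affine_step y)
  (measurable_affine_step y).

Definition affine_kernel (y : borel H) : {measure set (borel H) -> \bar R} :=
  distribution nu (affine_step y).

(** The affine map is jointly measurable, and the kernel is the [nu]-measure of the sections of a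
    measurable subset of the product. *)
Lemma measurable_affine_kernel U : measurable U -> measurable_fun setT (affine_kernel ^~ U).
Proof.
move=> mU.
have mA : measurable ((fun z => affine_step z.1 z.2) @^-1` U).
  rewrite -[X in measurable X]setTI.
  by apply: (measurable_affine _ _ measurable_fst measurable_snd).
apply: eq_measurable_fun (measurable_fun_xsection nu mA) => y _.
by rewrite /affine_kernel/= /distribution/= /pushforward xsectionE.
Qed.

HB.instance Definition _ := isKernel.Build _ _ _ _ _ affine_kernel measurable_affine_kernel.

Lemma affine_kernelT y : affine_kernel y setT = 1%E.
Proof. exact: probability_setT. Qed.

HB.instance Definition _ := Kernel_isProbability.Build _ _ _ _ _ affine_kernel affine_kernelT.

End kernel.

Context d (T : measurableType d) (P : probability T R) (Y : R -> {RV P >-> borel H}).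
Context (g : R) (s : V -> V -> R).
Hypothesis g_ge0 : 0 <= g.
Hypothesis Y_gaussian : gaussian_system P (fun ft w => pairing (Y ft.2 w) ft.1)
  [set ft | E ft.1] (fun x y => expR (- g * `|x.2 - y.2|) * s x.1 y.1).

Definition invariant_law : probability (borel H) R := distribution P (Y 0).
Local Notation nu := invariant_law.

Lemma invariant_gaussian : gaussian_system nu (fun f y => pairing y f) E s.
Proof.
have g0 : gaussian_system P (fun f w => pairing (Y 0 w) f) E s.
  apply: gaussian_system_eq (gaussian_system_reindex Y_gaussian (phi := fun f => (f, 0)) _) => //.
  by move=> f h _ _ /=; rewrite subrr normr0 mulr0 expR0 mul1r.
move=> n c f Ef; have [v0 [mX lX]] := g0 n c f Ef; split => //; split.
  apply: measurable_sum => i; apply: measurable_funM => //.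
  exact: (measurable_pairing (Ef i)).
exact: lX.
Qed.

Lemma law_at t U : measurable U -> P (Y t @^-1` U) = nu U.
Proof.
move=> mU; apply: (@same_law_dual _ _ _ _ P P (Y t) (Y 0) s U) => //.
  apply: gaussian_system_eq (gaussian_system_reindex Y_gaussian (phi := fun f => (f, t)) _) => //.
  by move=> f h _ _ /=; rewrite subrr normr0 mulr0 expR0 mul1r.
apply: gaussian_system_eq (gaussian_system_reindex Y_gaussian (phi := fun f => (f, 0)) _) => //.
by move=> f h _ _ /=; rewrite subrr normr0 mulr0 expR0 mul1r.
Qed.

(** The kernel depends on two times only through their distance, so a time shift leaves it
    unchanged. *)
Lemma gaussian_stationary : stationary P Y.
Proof.
move=> n t h U mU.
pose X : Type := 'I_n -> H; pose chi (i : 'I_n) (x : X) := x i.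
pose A : set X := \bigcap_i (chi i @^-1` U i).
apply: (@same_law _ _ _ _ Eq _ _ b_basis X 'I_n chi _ _ _ _ P P
  (fun w i => Y (t i + h) w) (fun w i => Y (t i) w)
  (fun x y => expR (- g * `|t x.2 - t y.2|) * s x.1 y.1) A).
- apply: gaussian_system_eq (gaussian_system_reindex Y_gaussian
    (phi := fun fj : V * 'I_n => (fj.1, t fj.2 + h)) _) => // x y _ _ /=.
  by rewrite opprD addrACA subrr addr0.
- exact: gaussian_system_eq (gaussian_system_reindex Y_gaussian
    (phi := fun fj : V * 'I_n => (fj.1, t fj.2)) _).
pose C := g_sigma_algebraType (chi_sets chi).
have : measurable (\bigcap_i (chi i @^-1` U i) : set C).
  apply: fin_bigcap_measurable => // i _; apply: sub_gen_smallest.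
  by exists i, (U i).
by [].
Qed.

Definition decay (t : R) : R := expR (- g * t).
Definition noise (t : R) : R := Num.sqrt (1 - decay t ^+ 2).

Lemma noise_sqr t : 0 <= t -> noise t ^+ 2 = 1 - decay t ^+ 2.
Proof.
move=> t0; rewrite /noise sqr_sqrtr// subr_ge0 expr_le1 ?expR_ge0//.
by rewrite -expR0 ler_expR mulNr oppr_le0 mulr_ge0.
Qed.

Lemma decayD r t : decay (r + t) = decay r * decay t.
Proof. by rewrite /decay mulrDr expRD. Qed.

Lemma decay_sqr t : decay t ^+ 2 = expR (- 2 * g * t).
Proof. by rewrite expr2 /decay -expRD; congr expR; ring. Qed.

Definition ou_kernel (t : R) : R.-pker borel H ~> borel H := affine_kernel nu (decay t) (noise t).

Lemma ou_kernelE t x (U : set (borel H)) :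
  ou_kernel t x U = nu ((fun z => decay t *: (x : H) + noise t *: (z : H)) @^-1` U).
Proof. by []. Qed.

(** Averaging over the starting point becomes a probability for a product measure; identities
    between kernels thereby turn into equalities of Gaussian laws. *)
Lemma product_lawE d1 (T1 : measurableType d1) (P1 : probability T1 R)
    (f : T1 * borel H -> borel H) (U : set (borel H)) :
  (\int[P1]_w nu ((fun z => f (w, z)) @^-1` U) = (P1 \x nu)%E (f @^-1` U))%E.
Proof. by apply: eq_integral => w _; rewrite /= xsectionE. Qed.

Lemma measurable_translate (x : H) (U : set (borel H)) : measurable U ->
  measurable ((fun z : borel H => x + (z : H) : borel H) @^-1` U).
Proof.
move=> mU; rewrite -[X in measurable X]setTI.
have := @measurable_affine _ _ (fun=> x) id 1 1 (measurable_cst _) (@measurable_id _ _ _).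
by under eq_fun do rewrite !scale1r; exact.
Qed.

Lemma ou_kernel_gaussian t x f U : 0 <= t -> E f -> measurable U ->
  ou_kernel t x ((fun y => pairing y f) @^-1` U) =
  normal_law (decay t * pairing x f) ((1 - decay t ^+ 2) * s f f) U.
Proof.
move=> t0 Ef mU.
have [v0 [_ lf]] := gaussian_system1 (gaussian_system_scale (I' := E) (phi := id)
  (fun=> noise t) invariant_gaussian (fun _ => id)) Ef.
rewrite -[decay t * _]add0r -noise_sqr// expr2 -normal_law_shift//; last first.
rewrite -lf.
- rewrite ou_kernelE; congr (nu _); apply/funext => z /=.
  by congr (U _); exact: addrC.
- rewrite -[X in measurable X]setTI.
  by apply: measurable_funD => //; exact: measurable_id.
Qed.

Lemma invariant_sqr f : E f -> (\int[nu]_y (pairing y f ^+ 2)%:E < +oo)%E.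
Proof.
by move=> Ef; have [v0 gf] := gaussian_system1 invariant_gaussian Ef; exact: gaussian_rv_lty gf.
Qed.

Hypothesis Y_covariance : forall f h, E f -> E h ->
  (\int[P]_w (pairing (Y 0 w) f * pairing (Y 0 w) h)%:E = (s f h)%:E)%E.

Lemma invariant_covariance f h :
  E f -> E h -> (\int[nu]_y (pairing y f * pairing y h)%:E = (s f h)%:E)%E.
Proof.
move=> Ef Eh.
have mf := measurable_pairing (q := q) Ef; have mh := measurable_pairing (q := q) Eh.
rewrite /invariant_law /distribution integral_pushforward//.
- by rewrite preimage_setT -Y_covariance.
- by apply/measurable_EFinP; exact: measurable_funM.
- rewrite preimage_setT; apply: integrable_sqr_mul.
  + exact: (measurableT_comp mf (@measurable_funPT _ _ _ _ (Y 0))).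
  + exact: (measurableT_comp mh (@measurable_funPT _ _ _ _ (Y 0))).
  + have := invariant_sqr Ef; rewrite /invariant_law /distribution ge0_integral_pushforward//.
    * by apply/measurable_EFinP; exact: measurable_funX.
    * by move=> y _; rewrite lee_fin sqr_ge0.
  + have := invariant_sqr Eh; rewrite /invariant_law /distribution ge0_integral_pushforward//.
    * by apply/measurable_EFinP; exact: measurable_funX.
    * by move=> y _; rewrite lee_fin sqr_ge0.
Qed.

Lemma ou_kernel_covariance t x f h : 0 <= t ->
  E f -> E h ->
  (\int[ou_kernel t x]_y ((pairing y f - decay t * pairing x f) *
    (pairing y h - decay t * pairing x h))%:E = ((1 - decay t ^+ 2) * s f h)%:E)%E.
Proof.
move=> t0 Ef Eh; rewrite -noise_sqr//.
have mf := measurable_pairing (q := q) Ef; have mh := measurable_pairing (q := q) Eh.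
have int : nu.-integrable setT (fun y => (pairing y f * pairing y h)%:E).
  by apply: integrable_sqr_mul => //; exact: invariant_sqr.
have E1 z : ((pairing (affine_step (decay t) (noise t) x z) f - decay t * pairing x f) *
    (pairing (affine_step (decay t) (noise t) x z) h - decay t * pairing x h))%:E =
    ((noise t ^+ 2)%:E * (pairing z f * pairing z h)%:E)%E.
  have P1 k : pairing (affine_step (decay t) (noise t) x z) k =
    decay t * pairing x k + noise t * pairing z k by [].
  by rewrite !P1 -EFinM; congr EFin; ring.
rewrite integral_pushforward//.
- rewrite preimage_setT; transitivity
    (\int[nu]_z ((noise t ^+ 2)%:E * (pairing z f * pairing z h)%:E))%E.
    by apply: eq_integral => z _; exact: E1.
  by rewrite integralZl// invariant_covariance.
- by apply/measurable_EFinP; apply: measurable_funM; apply: measurable_funB.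
- rewrite preimage_setT; apply: eq_integrable (integrableZl measurableT (noise t ^+ 2) int) => // z _.
  by rewrite /= E1.
Qed.

Lemma ou_kernel0 x : ou_kernel 0 x = \d_x :> (set (borel H) -> \bar R).
Proof.
apply/funext => U; rewrite ou_kernelE diracE.
have -> : decay 0 = 1 by rewrite /decay mulr0 expR0.
have -> : noise 0 = 0 by rewrite /noise /decay mulr0 expR0 expr1n subrr sqrtr0.
under eq_fun do rewrite scale1r scale0r addr0.
have [xU|xU] := pselect (U x).
  by rewrite mem_set// (_ : _ @^-1` _ = setT) ?probability_setT//; apply/seteqP; split.
by rewrite memNset// (_ : _ @^-1` _ = set0) ?measure0//; apply/seteqP; split.
Qed.

(** Used with [c' = noise (r + t)] for the Chapman-Kolmogorov equation and with [c' = 1] for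
    invariance. *)
Lemma affine_noise_law d1 (T1 : measurableType d1) (P1 : probability T1 R)
    (X : T1 -> H) (k1 : V -> V -> R) (a c c' : R) (U : set (borel H)) :
  gaussian_system P1 (fun f w => pairing (X w) f) E k1 ->
  (forall f h, a * a * k1 f h + c * c * s f h = c' * c' * s f h) ->
  measurable U ->
  (P1 \x nu)%E ((fun z => a *: X z.1 + c *: (z.2 : H)) @^-1` U) =
  nu ((fun z => c' *: (z : H)) @^-1` U).
Proof.
move=> gX k1E mU.
apply: (@same_law_dual _ _ _ _ (P1 \x nu)%E nu _ _ (fun f h => c' * c' * s f h) U); last exact: mU.
  have g1 := gaussian_system_scale (I' := E) (phi := id) (fun=> a) gX (fun _ => id).
  have g2 := gaussian_system_scale (I' := E) (phi := id) (fun=> c) invariant_gaussian (fun _ => id).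
  by apply: gaussian_system_eq (gaussian_system_add g1 g2) => // f h _ _ /=; rewrite k1E.
exact: (gaussian_system_scale (I' := E) (phi := id) (fun=> c') invariant_gaussian (fun _ => id)).
Qed.

(** Two successive steps accumulate [decay t * noise r] times one noise plus [noise t] times an
    independent one. The squares of these factors add up to [1 - decay (r + t) ^+ 2]. *)
Lemma ou_transition_function : transition_function ou_kernel.
Proof.
split=> [x|r t x U r0 t0 mU]; first exact: ou_kernel0.
have mV := measurable_translate (decay (r + t) *: (x : H)) mU.
transitivity (\int[nu]_y ou_kernel t (affine_step (decay r) (noise r) x y) U)%E; last first.
  rewrite [RHS]ge0_integral_pushforward// ?preimage_setT//.
  exact: (measurable_kernel (ou_kernel t) U mU).
under [RHS]eq_integral do rewrite ou_kernelE.
rewrite (@product_lawE _ _ nu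
  (fun z => decay t *: (affine_step (decay r) (noise r) x z.1 : H) + noise t *: (z.2 : H))).
rewrite ou_kernelE.
transitivity ((nu \x nu)%E ((fun z => (decay t * noise r) *: (z.1 : H) + noise t *: (z.2 : H)) @^-1`
    ((fun z : borel H => decay (r + t) *: (x : H) + (z : H) : borel H) @^-1` U))).
  apply/esym; apply: affine_noise_law invariant_gaussian _ mV.
  move=> f h; rewrite -mulrDl; congr (_ * _); rewrite -!expr2 exprMn !noise_sqr ?addr_ge0//.
  by rewrite decayD; ring.
congr ((nu \x nu)%E _); apply/funext => z; congr (U _).
by rewrite /affine_step scalerDr !scalerA addrA -decayD (addrC r).
Qed.

Lemma ou_invariant : invariant_measure ou_kernel nu.
Proof.
move=> t U t0 mU; under eq_integral do rewrite ou_kernelE.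
rewrite (@product_lawE _ _ nu (fun z => decay t *: (z.1 : H) + noise t *: (z.2 : H))).
rewrite (@affine_noise_law _ _ nu id s _ _ 1)//.
- by under eq_fun do rewrite scale1r.
- exact: invariant_gaussian.
- by move=> f h; rewrite -mulrDl -!expr2 noise_sqr// addrC subrK expr1n.
Qed.

(** Both sides are probabilities of one event [A] about the past and the future value, under the
    true pair and under the pair rebuilt with independent noise. The covariances with the past agree
    because [decay (r + t - u) = decay t * decay (r - u)] for [u <= r]. *)
Lemma ou_markov : markov_process P setT (natural_filtration Y) Y ou_kernel.
Proof.
move=> r t G U _ t0 FG mU.
(* A point of [X] records the past, through the sample point itself, and one
   future value, whose index in [J] is [None]. *)
pose X : Type := (T * H)%type.
pose J : Type := option {u : R | u <= r}.
pose chi (j : J) (x : X) : H := match j with None => x.2 | Some u => Y (sval u) x.1 end.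
pose xi1 (w : T) : X := (w, Y (r + t) w).
pose xi2 (z : T * borel H) : X := (z.1, decay t *: (Y r z.1 : H) + noise t *: (z.2 : H)).
pose A : set X := (fst @^-1` G) `&` (snd @^-1` U).
pose tau (j : J) := match j with None => r + t | Some u => sval u end.
(* The rebuilt observation is [al j] times the process at time [tau' j] plus [be j] times the noise;
   past values are kept as they are, with factors 1 and 0. *)
pose tau' (j : J) := match j with None => r | Some u => sval u end.
pose al (j : J) := match j with None => decay t | Some u => 1 end.
pose be (j : J) := match j with None => noise t | Some u => 0 end.
have sC : sigma_algebra setT <<s chi_sets chi >> by exact: smallest_sigma_algebra.
have mG : <<s chi_sets chi >> (fst @^-1` G).
  apply: (generated_preimage sC _ FG) => _ [u ur [W mW <-]]; apply: sub_gen_smallest.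
  by exists (Some (exist _ u ur)), W => //; rewrite setTI.
have mU' : <<s chi_sets chi >> (snd @^-1` U).
  by apply: sub_gen_smallest; exists None, U.
have mA : <<s chi_sets chi >> A.
  pose C := g_sigma_algebraType (chi_sets chi).
  have : measurable ((fst @^-1` G) `&` (snd @^-1` U) : set C) by exact: measurableI.
  by [].
transitivity (P (xi1 @^-1` A)); first by [].
have Edecay u v : expR (- g * `|u - v|) = decay `|u - v| by [].
rewrite (@same_law _ _ _ _ Eq _ _ b_basis X J chi _ _ _ _ P (P \x nu)%E xi1 xi2
  (fun x y => decay `|tau x.2 - tau y.2| * s x.1 y.1) A)//.
- rewrite [RHS]integral_mkcond; apply: eq_integral => w _; rewrite /= patchE xsectionE.
  case: ifPn => [|] wG.
    by congr (distribution P (Y 0) _); apply/seteqP; split => [z []//|z zU]; split => //; exact: set_mem.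
  rewrite (_ : _ @^-1` _ = set0) ?measure0//.
  by apply/seteqP; split => // z [Gw _]; move: wG; rewrite (mem_set (Gw : G w)).
- apply: gaussian_system_eq (gaussian_system_reindex Y_gaussian
    (phi := fun fj : V * J => (fj.1, tau fj.2)) _) => //.
  by move=> [f [u|]] w _.
- have g1 := gaussian_system_scale (I' := [set fj | E fj.1])
    (phi := fun fj : V * J => (fj.1, tau' fj.2)) (fun fj => al fj.2) Y_gaussian (fun _ => id).
  have g2 := gaussian_system_scale (I' := [set fj | E fj.1])
    (phi := fun fj : V * J => fj.1) (fun fj => be fj.2) invariant_gaussian (fun _ => id).
  apply: gaussian_system_eq (gaussian_system_add g1 g2).
    move=> [f [u|]] w _ //=; first by rewrite mul1r mul0r addr0.
  move=> [f [[u ur]|]] [h [[v vr]|]] _ _ /=; rewrite Edecay.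
  + by ring.
  + rewrite !ler0_norm ?subr_le0// ?(le_trans ur) ?lerDl//.
    have -> : - (u - (r + t)) = - (u - r) + t by ring.
    by rewrite decayD; ring.
  + rewrite !ger0_norm ?subr_ge0// ?(le_trans vr) ?lerDl//.
    have -> : r + t - v = (r - v) + t by ring.
    by rewrite decayD; ring.
  + rewrite !subrr normr0 /decay mulr0 expR0 -/(decay t) -!expr2 noise_sqr//; ring.
Qed.

End gaussian_markov.

(** * Existence of a continuous version *)

Section existence.
Context (R : realType) (V : lmodType R) (D : set V) (r : V -> V -> R).
Hypothesis Dr : inner_product_on D r.
Hypothesis D_complete : complete_on D r.
Context (I : set nat) (e : nat -> V).
Hypothesis e_basis : orthonormal_basis D r I e.
Context (lambda : nat -> R).
Hypothesis lambda_gt0 : forall n, 0 < lambda n.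
Context (Lambda : R).
Hypothesis lambda_le : forall N, \sum_(n < N) lambda n ^+ 2 <= Lambda.

Local Notation H := (dual (diag_range D r e lambda) (diag_q D r e lambda)).

Context d (T : measurableType d) (P : probability T R) (Z : V -> R -> T -> R) (g kappa : R).
Hypothesis g_ge0 : 0 <= g.
Hypothesis kappa_ge0 : 0 <= kappa.
Hypothesis Z_gaussian : gaussian_field P (fun ft w => Z ft.1 ft.2 w) [set ft | D ft.1]
  (fun x y => expR (- g * `|x.2 - y.2|) * (kappa * r x.1 y.1)).
Hypothesis Z_linear : forall a f h t, D f -> D h ->
  \forall w \ae P, Z (a *: f + h) t w = a * Z f t w + Z h t w.

Let b := diag_basis e lambda.
Let rK := diag_inner_product Dr D_complete e_basis lambda_gt0 lambda_le.
Let b_basis := diag_orthonormal_basis Dr D_complete e_basis lambda_gt0 lambda_le.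
Let X n t := Z (e n) t.

Let De n : D (e n). Proof. exact: (basis_sub e_basis). Qed.

Let mZ f t : D f -> measurable_fun setT (Z f t).
Proof. by move=> Df; have [m _ _] := Z_gaussian; exact: (m (f, t)). Qed.

Lemma field_sqr f t : D f -> (\int[P]_w (Z f t w ^+ 2)%:E = (kappa * r f f)%:E)%E.
Proof.
move=> Df; have [_ c _] := Z_gaussian; have := c (f, t) (f, t) Df Df.
rewrite subrr normr0 mulr0 expR0 mul1r => <-.
by apply: eq_integral => w _; rewrite expr2.
Qed.

Lemma basis_norm_le n : r (e n) (e n) <= 1.
Proof. by rewrite (basis_q e_basis) lern1 leq_b1. Qed.

(** The variance is [2 * (1 - expR (- g * |t - s|))] times the variance at one time; the bound is
    [1 - expR (- x) <= x]. *)
Lemma field_increment n s t : exists v, [/\ 0 <= v, v <= 2 * g * kappa * `|t - s| &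
  gaussian_rv P (fun w => X n t w - X n s w) v].
Proof.
have [_ _ gs] := Z_gaussian.
have [v0] := gs 2 (fun i => if i == ord0 then 1 else -1)
  (fun i => (e n, if i == ord0 then t else s)) (fun=> De n).
set v := qform _ _ _ in v0 *.
have -> : combo (fun ft w => Z ft.1 ft.2 w) (fun i => if i == ord0 then 1 else -1)
    (fun i : 'I_2 => (e n, if i == ord0 then t else s)) = (fun w => X n t w - X n s w).
  apply/funext => w; rewrite /combo !big_ord_recl big_ord0/= addr0.
  by rewrite mul1r mulN1r.
move=> gv; exists v; split => //.
have -> : v = 2 * (1 - expR (- g * `|t - s|)) * (kappa * r (e n) (e n)).
  rewrite /v /qform !big_ord_recl !big_ord0/= !subrr normr0 mulr0 expR0 (distrC s t).
  by ring.
have k1 : kappa * r (e n) (e n) <= kappa by rewrite ler_piMr// basis_norm_le.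
have := expR_ge1Dx (- g * `|t - s|); have k0 : 0 <= kappa * r (e n) (e n).
  by rewrite mulr_ge0// (q_ge0 Dr).
have : 0 <= g * `|t - s| by rewrite mulr_ge0.
have : expR (- g * `|t - s|) <= 1 by rewrite -expR0 ler_expR mulNr oppr_le0 mulr_ge0.
rewrite mulNr -!mulrA (mulrCA g kappa).
move: (g * _) (expR _) (kappa * r _ _) k1 k0 => y x z k1 k0 x1 y0 xy.
rewrite ler_pM2l// mulrC; apply: ler_pM => //; lra.
Qed.

(** One constant for three bounds: [kappa] for the values, [2 * g * kappa] for second moments of
    increments, and [3 * (2 * g * kappa) ^+ 2] for fourth moments, a normal variable of variance [v]
    having fourth moment at most [3 * v ^+ 2]. *)
Let K := kappa + 2 * g * kappa + 3 * (2 * g * kappa) ^+ 2.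
Let gk0 : 0 <= 2 * g * kappa. Proof. by rewrite !mulr_ge0. Qed.
Let K0 : 0 <= K. Proof. by rewrite !addr_ge0// mulr_ge0// sqr_ge0. Qed.

Let mX n t : measurable_fun setT (X n t). Proof. exact: mZ. Qed.

Let X2 n t : (\int[P]_w (X n t w ^+ 2)%:E <= K%:E)%E.
Proof.
rewrite field_sqr// lee_fin (le_trans (y := kappa))//.
  by rewrite ler_piMr// basis_norm_le.
by rewrite /K -addrA lerDl addr_ge0// mulr_ge0// sqr_ge0.
Qed.

Let Xinc2 n s t : (\int[P]_w ((X n t w - X n s w) ^+ 2)%:E <= (K * `|t - s|)%:E)%E.
Proof.
have [v [v0 vl gv]] := field_increment n s t; rewrite (gaussian_rv_sqr v0 gv) lee_fin.
rewrite (le_trans vl)// ler_wpM2r// /K addrAC lerDr addr_ge0// mulr_ge0// sqr_ge0//.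
Qed.

Let Xinc4 n s t : (\int[P]_w ((X n t w - X n s w) ^+ 4)%:E <= (K * (t - s) ^+ 2)%:E)%E.
Proof.
have [v [v0 vl gv]] := field_increment n s t.
apply: (le_trans (gaussian_rv_exp4 v0 gv)); rewrite lee_fin.
rewrite -(real_normK (num_real (t - s))).
apply: (le_trans (y := 3 * (2 * g * kappa * `|t - s|) ^+ 2)).
  by rewrite ler_wpM2l// ler_sqr ?nnegrE// mulr_ge0.
by rewrite exprMn mulrA ler_wpM2r ?sqr_ge0// /K lerDr addr_ge0.
Qed.

Let xi := cont_version X lambda.

Lemma dual_version : exists Y : R -> T -> H,
  forall t w n, I n -> pairing (Y t w) (b n) = lambda n * xi n t w.
Proof.
have : forall tw : R * T, exists y : H, forall n, I n -> pairing y (b n) = lambda n * xi n tw.1 tw.2.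
  move=> [t w]; have [M M0 hM] := cont_version_square X K0 lambda_gt0 w t.
  apply: (dual_of_coefficients rK b_basis (M := Num.sqrt M)); first exact: sqrtr_ge0.
  by move=> N; rewrite sqr_sqrtr.
by move=> /choice[Y hY]; exists (fun t w => Y (t, w)) => t w n In; exact: (hY (t, w)).
Qed.

Lemma version_continuous (Y : R -> T -> H) w :
  (forall t w n, I n -> pairing (Y t w) (b n) = lambda n * xi n t w) ->
  continuous (fun t => Y t w).
Proof.
move=> YE t; apply/cvgrPdist_le => eps eps0.
(* The margin 1 keeps every [u] within distance 1 of [t] inside the range of the modulus. *)
have [N tN] : exists N : nat, `|t| + 1 < N%:R.
  by exists (Num.bound (`|t| + 1)); rewrite archi_boundP// addr_ge0.
have [M M0 hM] := cont_version_modulus X K0 lambda_gt0 w N.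
(* [9 / 10] is the ratio fixed in Kolmogorov's argument. *)
have [k Mk] : exists k, M * (9 / 10) ^+ k <= eps.
  have : M * (9 / 10) ^+ k @[k --> \oo] --> (M * 0 : R).
    by apply: cvgMr; apply: cvg_expr; rewrite ger0_norm; lra.
  rewrite mulr0 => /cvgrPdist_le/(_ _ eps0)[k _ hk].
  exists k; have := hk k (leqnn k); rewrite sub0r normrN; apply: le_trans; exact: ler_norm.
near=> u.
have ut1 : `|u - t| < 1.
  by rewrite distrC; near: u; exact: (@cvgr_dist_lt _ _ _ (nbhs t) _ id t cvg_id).
have utk : `|u - t| < 2 ^- k.
  rewrite distrC; near: u; apply: (@cvgr_dist_lt _ _ _ (nbhs t) _ id t cvg_id).
  by rewrite invr_gt0 exprn_gt0.
have uN : - N%:R <= u < N%:R.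
  have := ler_norm u; have := ler_norm (- u); rewrite normrN.
  have : `|u| <= `|u - t| + `|t| by rewrite -{1}(subrK t u) ler_normD.
  move=> *; apply/andP; split; lra.
have tN' : - N%:R <= t < N%:R.
  have := ler_norm t; have := ler_norm (- t); rewrite normrN.
  move=> *; apply/andP; split; lra.
apply: le_trans Mk; rewrite distrC.
apply: (dual_norm_le_sum rK b_basis).
  by rewrite mulr_ge0// exprn_ge0//; lra.
move=> m; apply: le_trans (hM k t u tN' uN utk m).
apply: ler_sum => n _; rewrite pairing_subl.
have [In|nIn] := pselect (I n); first by rewrite !YE// mulrBr.
by rewrite !(pairing_basis_out rK b_basis)// subrr expr0n sqr_ge0.
Unshelve. all: by end_near. Qed.

Lemma field0 t : \forall w \ae P, Z 0 t w = 0.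
Proof.
have := Z_linear (-1) t (sub0 Dr) (sub0 Dr); rewrite scaler0 addr0.
by apply: filterS => w ->; rewrite mulN1r addNr.
Qed.

Lemma field_bsum (c : nat -> R) N t :
  \forall w \ae P, Z (bsum e c N) t w = \sum_(n < N) c n * X n t w.
Proof.
elim: N => [|N IH].
  by rewrite /bsum big_ord0; apply: filterS (field0 t) => w ->; rewrite big_ord0.
rewrite /bsum big_ord_recr/= addrC.
have := Z_linear (c N) t (De N) (bsum_sub Dr e_basis c N).
apply: filterS2 IH => w IH ->; rewrite big_ord_recr/= addrC; congr (_ + _); exact: IH.
Qed.

(** The partial expansions [U N] converge pointwise to the pairing. They also converge in mean
    square to [Z f t], since the error is almost surely the field at [bsum - f] up to sign, whose
    second moment is [kappa] times the squared norm. *)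
Lemma version_ae (Y : R -> T -> H) t f :
  (forall t w n, I n -> pairing (Y t w) (b n) = lambda n * xi n t w) ->
  diag_range D r e lambda f -> \forall w \ae P, pairing (Y t w) f = Z f t w.
Proof.
move=> YE Kf; have Df : D f by exact: (diag_range_sub Dr D_complete e_basis lambda_le Kf).
have [h Dh hf] := Kf.
pose U N w := \sum_(n < N) diag_q D r e lambda (b n) f * pairing (Y t w) (b n).
(* The weights cancel: for [f] the image of [h], the coefficient of [f] on [b n] is [r (e n) h], and
   [lambda n * r (e n) h = r (e n) f]. *)
have UE N w : U N w = \sum_(n < N) r (e n) f * xi n t w.
  apply: eq_bigr => n _; have [In|nIn] := pselect (I n); last first.
    by rewrite (pairing_basis_out rK b_basis)// (basis_out e_basis)// (q0l Dr)// mul0r mulr0.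
  rewrite YE// -hf /b (diag_basisE Dr D_complete e_basis lambda_le).
  rewrite (diag_qE Dr D_complete e_basis lambda_gt0 lambda_le)//.
  by rewrite (diag_op_coefficient Dr D_complete e_basis lambda_le)//; ring.
have mxi n : measurable_fun setT (xi n t).
  exact: (measurable_cont_version mX K0 lambda_gt0).
have mU N : measurable_fun setT (U N).
  rewrite (funext (UE N)); apply: measurable_sum => n.
  by apply: measurable_funM => //; exact: mxi.
have cU w : U N w @[N --> \oo] --> pairing (Y t w) f by exact: (cvg_pairing rK b_basis Kf).
have mY : measurable_fun setT (fun w => pairing (Y t w) f).
  exact: (measurable_fun_cvg mU (fun w _ => cU w)).
apply: (cvg_L2_ae_eq mU (mZ t Df) mY cU).
have -> : (fun N => \int[P]_w ((U N w - Z f t w) ^+ 2)%:E)%E =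
    (fun N => (kappa * qnorm r (bsum e (fun n => r (e n) f) N - f) ^+ 2)%:E).
  apply/funext => N; have DS := bsum_sub Dr e_basis (fun n => r (e n) f) N.
  have DSf := subB Dr DS Df.
  rewrite (qnorm_sqr Dr)// -(field_sqr t DSf).
  apply: ae_eq_integral => //.
  - by apply/measurable_EFinP; apply: measurable_funX; apply: measurable_funB => //; exact: mZ.
  - by apply/measurable_EFinP; apply: measurable_funX; exact: mZ.
  have xiX : \forall w \ae P, forall n : 'I_N, xi n t w = X n t w.
    apply: filter_forall => n.
    exact: (cont_version_ae mX K0 X2 Xinc2 Xinc4 lambda_gt0 lambda_le).
  have := Z_linear (-1) t Df DS; rewrite scaleN1r (addrC (- f)).
  apply: filterS3 xiX (field_bsum (fun n => r (e n) f) N t) => w xiX ZS -> _.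
  rewrite UE ZS mulN1r addrC; congr ((- _ + _) ^+ 2)%:E.
  by apply: eq_bigr => n _; rewrite xiX.
have := basis_cvg e_basis Df; rewrite /q_cvg => c0.
rewrite -[X in _ --> X]/((0 : R)%:E); apply: cvg_EFin; first by near=> N.
have : kappa * qnorm r (bsum e (fun n => r (e n) f) N - f) ^+ 2 @[N --> \oo] -->
    kappa * (0 * 0).
  by apply: cvgMr; exact: (cvgM c0 c0).
by rewrite !mulr0.
Unshelve. all: by end_near. Qed.

(** The domain and the form are variables with equations so that the result can be typed with [D_K]
    and [r_K], which are convertible to [diag_range] and [diag_q]. *)
Lemma continuous_version_exists (KD : set V) (qK : V -> V -> R) :
  KD = diag_range D r e lambda -> qK = diag_q D r e lambda ->
  exists Y : R -> {RV P >-> borel (dual KD qK)},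
    (forall w, continuous (fun t => Y t w : dual KD qK)) /\
    (forall t f, KD f -> \forall w \ae P, pairing (Y t w) f = Z f t w).
Proof.
move=> -> ->.
have [Y YE] := dual_version.
have mY t : measurable_fun setT (Y t : T -> borel H).
  apply: (measurable_dual rK b_basis) => n.
  have [In|nIn] := pselect (I n); last first.
    under eq_fun do rewrite (pairing_basis_out rK b_basis)//.
    exact: measurable_cst.
  under eq_fun do rewrite YE//.
  by apply: measurable_funM => //; exact: (measurable_cont_version mX K0 lambda_gt0).
pose Y' t : {RV P >-> borel H} := HB.pack (Y t : T -> borel H)
  (isMeasurableFun.Build _ _ _ _ (Y t : T -> borel H) (mY t)).
exists Y'; split => [w|t f Kf]; first exact: version_continuous YE.
exact: version_ae YE Kf.
Qed.

End existence.

(** * The stationary field *)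

Section stationary_field.
Context dS (S : measurableType dS) (R : realType) (mu : probability S R).
Local Notation L2 := (LspaceType2 mu).
Context (DA : set L2) (A : L2 -> L2) (gamma : R).
Hypothesis gamma_lt0 : gamma < 0.
Hypothesis A_selfadjoint : self_adjoint (ip mu) DA A.
Hypothesis A_range : A @` DA = one_perp mu.
Context d (T : measurableType d) (P : probability T R) (B : L2 -> R -> T -> R).
Hypothesis B_brownian : brownian_field P DA A B.

Local Notation Z := (stationary_field gamma B).
Local Notation sigma := (fun f g => ip mu f (Sigma_op DA A gamma g)).

Let g_gt0 : 0 < `|gamma|. Proof. by rewrite normr_gt0 lt_eqF. Qed.

Definition brownian_cov (x y : L2 * R) : R :=
  if 0 < x.2 * y.2
  then Num.min `|x.2| `|y.2| * (- 2 * ip mu x.1 (op_inv (ip mu) DA A y.1)) else 0.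

Lemma brownian_gaussian_field : gaussian_field P (fun ft => B ft.1 ft.2)
  [set ft | one_perp mu ft.1] brownian_cov.
Proof.
have [cB _ covB] := B_brownian; apply: centered_gaussian_field => //.
by move=> [f t] [h u] /= Df Dh; rewrite covB.
Qed.

Let a (t : R) : R := expR (- `|gamma| * t) * (Num.sqrt (2 * `|gamma|))^-1.

(** Doob's time change: for [t <= u], the minimum [expR (2 * |gamma| * t)] times the two damping
    factors is [expR (- |gamma| * (u - t))]. The normalisation by [Num.sqrt (2 * |gamma|)] absorbs
    the factor of [brownian_covarianceE]. *)
Lemma stationary_covE f h t u : one_perp mu h ->
  a t * a u * brownian_cov (f, expR (2 * `|gamma| * t)) (h, expR (2 * `|gamma| * u)) =
  expR (- `|gamma| * `|t - u|) * sigma f h.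
Proof.
move=> Dh; rewrite /brownian_cov/= mulr_gt0 ?expR_gt0// !(ger0_norm (expR_ge0 _)).
rewrite (brownian_covarianceE gamma_lt0 A_selfadjoint A_range)// mulrA.
have sq : (Num.sqrt (2 * `|gamma|))^-1 * (Num.sqrt (2 * `|gamma|))^-1 * (2 * `|gamma|) = 1.
  by rewrite -invfM -expr2 sqr_sqrtr ?mulr_ge0// mulVf// gt_eqF// mulr_gt0.
have -> : a t * a u * Num.min (expR (2 * `|gamma| * t)) (expR (2 * `|gamma| * u)) *
    (2 * `|gamma| * ip mu f (Sigma_op DA A gamma h)) =
  (expR (- `|gamma| * t) * expR (- `|gamma| * u) *
    Num.min (expR (2 * `|gamma| * t)) (expR (2 * `|gamma| * u))) *
    ((Num.sqrt (2 * `|gamma|))^-1 * (Num.sqrt (2 * `|gamma|))^-1 * (2 * `|gamma|)) * sigma f h.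
  by rewrite /a; ring.
rewrite sq mulr1; congr (_ * _).
wlog tu : t u / t <= u.
  move=> H; have [|/ltW] := leP t u; first exact: H.
  by move/H; rewrite distrC minC [X in X * _]mulrC.
have -> : `|t - u| = u - t by rewrite ler0_norm ?subr_le0// opprB.
rewrite min_l ?ler_expR ?ler_wpM2l ?mulr_ge0// -!expRD.
by congr expR; ring.
Qed.

Lemma stationary_gaussian_field : gaussian_field P (fun ft => Z ft.1 ft.2)
  [set ft | one_perp mu ft.1] (fun x y => expR (- `|gamma| * `|x.2 - y.2|) * sigma x.1 y.1).
Proof.
have [mB cB gB] := brownian_gaussian_field.
pose phi (x : L2 * R) : L2 * R := (x.1, expR (2 * `|gamma| * x.2)).
split.
- by move=> [f t] /= Df; apply: measurable_funM => //; exact: (mB (phi (f, t))).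
- move=> [f t] [h u] /= Df Dh; rewrite -stationary_covE//.
  rewrite EFinM -(cB (phi (f, t)) (phi (h, u)))// -integralZl//.
    by apply: eq_integral => w _; rewrite -EFinM; congr EFin; rewrite /stationary_field /a/=; ring.
  have sqB k v : one_perp mu k -> (\int[P]_w (B k v w ^+ 2)%:E < +oo)%E.
    move=> Dk; have := cB (k, v) (k, v) Dk Dk; under eq_integral do rewrite -expr2.
    by move=> ->; rewrite ltry.
  by apply: integrable_sqr_mul; [exact: (mB (phi (f, t)))|exact: (mB (phi (h, u)))|exact: sqB..].
- move=> n c j Dj.
  apply: (gaussian_system_eq _ _ (gaussian_system_scale
    (I' := [set ft | one_perp mu ft.1]) (phi := phi) (fun x => a x.2) gB (fun _ => id))) => //.
  by move=> [f t] [h u] /= Df Dh; rewrite -stationary_covE.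
Qed.

Lemma stationary_field_linear c f h t : one_perp mu f -> one_perp mu h ->
  \forall w \ae P, Z (c *: f + h) t w = c * Z f t w + Z h t w.
Proof.
move=> Df Dh; have [_ lB _] := B_brownian.
apply: filterS (lB c f h (expR (2 * `|gamma| * t)) Df Dh) => w e.
by rewrite /stationary_field e; ring.
Qed.

End stationary_field.

Lemma summable_bounded (R : realType) (u : nat -> R) : (forall n, 0 <= u n) ->
  cvgn (series u) -> exists M, forall N, \sum_(n < N) u n <= M.
Proof.
move=> u0 cu; exists (limn (series u)) => N.
have nu : nondecreasing_seq (series u).
  by apply/nondecreasing_seqP => n; rewrite seriesSr lerDl.
by have := nondecreasing_cvgn_le nu cu N; rewrite /series/= big_mkord.
Qed.

Theorem corollary3p3 (R : realType)
    (dS : measure_display) (S : measurableType dS) (mu : probability S R)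
    (* the Markov process X, its filtration and its transition function *)
    (d0 : measure_display) (Om0 : measurableType d0) (P0 : probability Om0 R)
    (F : R -> set (set Om0)) (X : R -> Om0 -> S) (pX : R -> R.-pker S ~> S)
    (P0_complete : measure_is_complete P0)
    (F_filtration : filtration F)
    (X_progressive : progressively_measurable F X)
    (pX_transition : transition_function pX)
    (X_markov : markov_process P0 [set t | 0 <= t] F X pX)
    (X_initial : forall U, measurable U -> P0 (X 0 @^-1` U) = mu U)
    (mu_invariant : invariant_measure pX mu)
    (mu_ergodic : ergodic_measure pX mu)
    (* its generator A on L^2(S, mu) *)
    (pX_continuous : strongly_continuous pX mu)
    (DA : set (LspaceType2 mu)) (A : LspaceType2 mu -> LspaceType2 mu)
    (A_generator : generator pX DA A)
    (A_dense : dense_in setT (ip mu) DA)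
    (A_selfadjoint : self_adjoint (ip mu) DA A)
    (A_range : A @` DA = one_perp mu)
    (Ainv_bounded : bounded_on (ip mu) (one_perp mu)
       (op_inv (ip mu) DA A))
    (* the Brownian field *)
    (d : measure_display) (Om : measurableType d) (P : probability Om R)
    (B : LspaceType2 mu -> R -> Om -> R)
    (B_brownian : brownian_field P DA A B)
    (* the rigged Hilbert space *)
    (gamma : R) (gamma_lt0 : gamma < 0)
    (D_hilbert : separable_hilbert (one_perp mu) (r_D DA A gamma))
    (I : set nat) (e : nat -> LspaceType2 mu)
    (e_basis : orthonormal_basis (one_perp mu) (r_D DA A gamma) I e)
    (lambda : nat -> R)
    (lambda_gt0 : forall n, 0 < lambda n)
    (lambda_summable : cvgn (series (fun n => lambda n ^+ 2))) :
  let H := H_space DA A gamma e lambda in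
  let Z := stationary_field gamma B in
  let Sigma := Sigma_op DA A gamma in
  (exists Y : R -> {RV P >-> borel H}, continuous_version Z Y) /\
  (forall Y : R -> {RV P >-> borel H}, continuous_version Z Y ->
    [/\ centered_gaussian P (fun ft w => pairing (Y ft.2 w) ft.1)
          [set ft : LspaceType2 mu * R | D_K DA A gamma e lambda ft.1],
        stationary P Y &
        exists (p : R -> R.-pker borel H ~> borel H) (nu : probability (borel H) R),
          [/\ transition_function p /\
              (* y ranges over the whole state space H, which contains D_K through the
                 Gelfand triple *)
              (forall (t : R) (y : H), 0 <= t ->
                 gaussian_measure (ip mu) (p t y)
                   (expR (- `|gamma| * t) *: y)
                   (fun f => (1 - expR (- 2 * `|gamma| * t)) *: Sigma f)),
              markov_process P setT (natural_filtration Y) Y p,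
              gaussian_measure (ip mu) nu (0 : H) Sigma,
              invariant_measure p nu &
              forall t U, measurable U -> P (Y t @^-1` U) = nu U]]).
Proof.
move=> H Z Sigma.
have [Lambda lambda_le] : exists Lambda, forall N, \sum_(n < N) lambda n ^+ 2 <= Lambda.
  by apply: (@summable_bounded _ (fun n => lambda n ^+ 2)) => // n; exact: sqr_ge0.
have [Dr D_complete _] := D_hilbert.
have g0 : 0 <= `|gamma| by [].
have Zfield := stationary_gaussian_field gamma_lt0 A_selfadjoint A_range B_brownian.
have K_inner : inner_product_on (D_K DA A gamma e lambda) (r_K DA A gamma e lambda).
  exact: (diag_inner_product Dr D_complete e_basis lambda_gt0 lambda_le).
have K_basis : orthonormal_basis (D_K DA A gamma e lambda) (r_K DA A gamma e lambda) I
    (diag_basis e lambda).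
  exact: (diag_orthonormal_basis Dr D_complete e_basis lambda_gt0 lambda_le).
have K_sub f : D_K DA A gamma e lambda f -> one_perp mu f.
  exact: (diag_range_sub Dr D_complete e_basis lambda_le).
split.
  (* The existence argument needs the covariance as a multiple of [r_D]; the multiple is its
     [kappa]. *)
  have Zfield' : gaussian_field P (fun ft w => Z ft.1 ft.2 w) [set ft | one_perp mu ft.1]
      (fun x y => expR (- `|gamma| * `|x.2 - y.2|) *
        ((1 + `|gamma|) ^- 2 * r_D DA A gamma x.1 y.1)).
    have [m c s] := Zfield; split; first exact: m.
      by move=> x y Dx Dy; rewrite -(ip_Sigma gamma_lt0 A_selfadjoint A_range)//; exact: c.
    move=> n k j Dj; apply: gaussian_system_eq s _ _ _ _ => //.
    by move=> x y _ Dy; rewrite -(ip_Sigma gamma_lt0 A_selfadjoint A_range).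
  have k0 : 0 <= (1 + `|gamma|) ^- 2 by rewrite invr_ge0 exprn_ge0 ?addr_ge0.
  have [Y [cY YZ]] := continuous_version_exists Dr D_complete e_basis lambda_gt0 lambda_le
    g0 k0 Zfield' (fun a f h t => stationary_field_linear gamma B_brownian a t)
    (erefl (D_K DA A gamma e lambda)) (erefl (r_K DA A gamma e lambda)).
  exists Y; split; [exact: cY|exact: YZ].
move=> Y [cY YZ].
pose s f g := ip mu f (Sigma g).
(* Each combination involves finitely many pairs [(f, t)], so almost sure equality at each pair
   transfers its law from [Z] to [Y]. *)
have Y_gaussian : gaussian_system P (fun ft w => pairing (Y ft.2 w) ft.1)
    [set ft | D_K DA A gamma e lambda ft.1]
    (fun x y => expR (- `|gamma| * `|x.2 - y.2|) * s x.1 y.1).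
  have [_ _ gs] := Zfield.
  apply: (gaussian_system_ae (W := fun ft => Z ft.1 ft.2)).
  - move=> [f t] /= Df.
    exact: (measurableT_comp (measurable_pairing Df) (@measurable_funPT _ _ _ _ (Y t))).
  - by move=> [f t] /= Df; exact: YZ.
  - by move=> n c j Dj; apply: gs => i; exact: (K_sub _ (Dj i)).
have Y_cov f h : D_K DA A gamma e lambda f -> D_K DA A gamma e lambda h ->
    (\int[P]_w (pairing (Y 0 w) f * pairing (Y 0 w) h)%:E = (s f h)%:E)%E.
  move=> Kf Kh; have [mZ cZ _] := Zfield.
  have := cZ (f, 0) (h, 0) (K_sub _ Kf) (K_sub _ Kh).
  rewrite /= subrr normr0 mulr0 expR0 mul1r => <-; apply: ae_eq_integral => //.
  - apply/measurable_EFinP; apply: measurable_funM.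
      exact: (measurableT_comp (measurable_pairing Kf) (@measurable_funPT _ _ _ _ (Y 0))).
    exact: (measurableT_comp (measurable_pairing Kh) (@measurable_funPT _ _ _ _ (Y 0))).
  - apply/measurable_EFinP; apply: measurable_funM.
      exact: (mZ (f, 0) (K_sub _ Kf)).
    exact: (mZ (h, 0) (K_sub _ Kh)).
  - by apply: filterS2 (YZ 0 f Kf) (YZ 0 h Kh) => w -> ->.
have sZ a f h : ip mu f (a *: h) = a * ip mu f h.
  have qT := L2_inner_product mu.
  by rewrite (qC qT)// (qZl qT)// (qC qT).
split.
- split=> [[f t] /= Df|n c j Dj].
    exact: (measurableT_comp (measurable_pairing Df) (@measurable_funPT _ _ _ _ (Y t))).
  have [v0 [_ lv]] := Y_gaussian n c j Dj.
  by exists (qform (fun x y => expR (- `|gamma| * `|x.2 - y.2|) * s x.1 y.1) c j).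
- exact: (gaussian_stationary K_inner K_basis Y_gaussian).
exists (ou_kernel K_inner K_basis Y `|gamma|), (invariant_law Y); split.
- split; first exact: (ou_transition_function K_inner K_basis g0 Y_gaussian).
  move=> t y t0; have dt := decay_sqr `|gamma| t.
  split=> [f U Df mU|f h Df Dh]; rewrite sZ -dt.
    exact: (ou_kernel_gaussian K_inner K_basis g0 Y_gaussian y t0 Df mU).
  exact: (ou_kernel_covariance K_inner K_basis g0 Y_gaussian Y_cov y t0 Df Dh).
- exact: (ou_markov K_inner K_basis g0 Y_gaussian).
- split=> [f U Df mU|f h Df Dh].
    have [_ [_ l]] := gaussian_system1 (invariant_gaussian Y_gaussian) Df.
    exact: l.
  have := invariant_covariance Y_gaussian Y_cov Df Dh.
  (* The mean is the zero of [H], whose pairings reduce to 0. *)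
  by under eq_integral do rewrite -[X in (X * _)%:E]subr0 -[X in (_ * X)%:E]subr0.
- exact: (ou_invariant K_inner K_basis g0 Y_gaussian).
- exact: (law_at K_inner K_basis Y_gaussian).
Qed.
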